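(* Let $f_1,f_2$ be real nonconstant Lipschitz functions on a compact interval $[a,b]$ and consider the Abel equation on $[a,b]$ $$\frac{dv}{dt}=f_1'v^2+f_2'v^3,$$ where $F:=(f_1,f_2):[a,b]\to\mathbb R^2$ satisfies $F(a)=F(b)=0$, has Lipschitz triangulable image $\Gamma_F:=F([a,b])$, and belongs to the class $\mathcal A$ defined in the context. Then this equation determines a center if and only if $$\int_a^b f_1(t)\,f_2'(t)\,dt=0.$$ Moreover, all centers of such equations are universal (i.e. if the equation determines a center, it determines a universal center).
   Context: Center: the equation determines a center if for all sufficiently small initial values $v_0$ the solution with $v(a)=v_0$ satisfies $v(b)=v(a)$. Universal center: the equation determines a universal center if all iterated integrals $\int\cdots\int_{a\le t_1\le\cdots\le t_k\le b}f'_{i_k}(t_k)\cdots f'_{i_1}(t_1)\,dt_k\cdots dt_1$, $k\ge1$, $i_1,\dots,i_k\in\{1,2\}$, vanish. (For Lipschitz $F$ with Lipschitz triangulable image this is known to be equivalent to: $F$ is a closed path contractible in $\Gamma_F$; and to: there are a finite tree $T$ and continuous maps $\tilde F:T\to\Gamma_F$, $\tilde f:[a,b]\to T$ with $\tilde f(a)=\tilde f(b)$ and $F=\tilde F\circ\tilde f$.) A compact set $\Gamma\subset\mathbb R^2$ is a Lipschitz triangulable curve if it is the union of finitely many arcs $\gamma_i$ such that for $i\ne j$ the intersection $\gamma_i\cap\gamma_j$ is either empty or consists of at most one of their endpoints, and each $\gamma_i$ is parameterized by a Lipschitz map $h_i:[0,1]\to\gamma_i\subset\mathbb R^2$ whose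 inverse is locally Lipschitz apart from the endpoints. Traversable curves: an Eulerian trail in an undirected connected graph is a path that uses each edge exactly once; the graph is traversable if such a path exists, and unicursal if in addition the path is closed. A connected one-dimensional CW-complex $X$ is traversable (unicursal) if it is homeomorphic to a traversable (unicursal) graph. An Eulerian trail in such $X$ is then regarded as a continuous surjective map $\gamma:I\to X$, injective outside a finite set of points and traversing each edge exactly once, where $I$ is a closed arc of the unit circle $\mathbb S$, and $I=\mathbb S$ if and only if $X$ is unicursal. A path $\tilde\gamma:[a,b]\to X$ covers $\gamma$ if there is a path $\gamma':[a,b]\to I$ with $\tilde\gamma=\gamma\circ\gamma'$. For a compact Lipschitz triangulable curve $\Gamma\subset\mathbb R^2$, $P_2(\Gamma)$ is the set of closed Lipschitz paths $[a,b]\to\Gamma$ that cover Eulerian trails of traversable subcurves of $\Gamma$, and $P_2:=\bigcup_\Gamma P_2(\Gamma)$ over all such $\Gamma$. The class $\mathcal A\subset P_2$ consists of the paths belonging to $P_2(\Gamma)$ for compact Lipschitz triangulable curves $\Gamma\subset\mathbb R^2$ with the following property: there are simple closed Lipschitz curves $\ell_1,\dots,\ell_m:[0,1]\to\Gamma$, oriented counterclockwise, $m=\operatorname{rank}H_1(\Gamma)$, whose classes generate $H_1(\Gamma)$ and such that the areas of the bounded simply connected domains $D_1,\dots,D_m\subset\mathbb R^2$ with boundaries $\ell_1([0,1]),\dots,\ell_m([0,1])$ are linearly independent over $\mathbb Q$. *)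

(* Defs.v *)
From HB Require Import structures.
From mathcomp Require Import all_boot all_order all_algebra.
From mathcomp Require Import all_classical all_reals all_analysis.
From mathcomp Require Import freeg.

Set Implicit Arguments.
Unset Strict Implicit.
Unset Printing Implicit Defensive.

Import Order.TTheory GRing.Theory Num.Theory.
Import numFieldNormedType.Exports.

Local Open Scope classical_set_scope.
Local Open Scope ring_scope.

(* The plane is [R * R]; its library norm is the sup norm, which yields the
   same Lipschitz maps, topology and bounded sets as the Euclidean norm. *)

Section Abel.
Context {R : realType}.
Implicit Types (a b : R) (f v : R -> R).

Definition nonconstant a b f : Prop :=
  ~ exists c, forall t, t \in `[a, b] -> f t = c.

(* Lipschitz functions are differentiable almost everywhere; a solution is a
   Lipschitz function satisfying the equation almost everywhere.  As f1' and
   f2' are bounded, every absolutely continuous solution is Lipschitz.  The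
   junk value of [derive1] at points of non-differentiability, and its value at
   the endpoints a and b, only concern null sets. *)
Definition abel_solution a b (f1 f2 : R -> R) v : Prop :=
  [lipschitz v t | t in `[a, b]] /\
  {ae (@lebesgue_measure R), forall t, t \in `]a, b[ ->
     is_derive t 1 v (derive1 f1 t * v t ^+ 2 + derive1 f2 t * v t ^+ 3)}.

Definition abel_center a b (f1 f2 : R -> R) : Prop :=
  exists2 eps : R, 0 < eps & forall v0 : R, `|v0| < eps ->
    (exists2 v, abel_solution a b f1 f2 v & v a = v0) /\
    (forall v, abel_solution a b f1 f2 v -> v a = v0 -> v b = v a).

(* The word [w] lists i_k, ..., i_1 (outermost variable t_k first), with
   [false] for the index 1 and [true] for the index 2. *)
Fixpoint iterated_integral a (f1 f2 : R -> R) (w : seq bool) (t : R) : R :=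
  if w is i :: w' then
    \int[lebesgue_measure]_(s in `[a, t])
       (derive1 (if i then f2 else f1) s * iterated_integral a f1 f2 w' s)
  else 1.

Definition universal_center a b (f1 f2 : R -> R) : Prop :=
  forall w : seq bool, (0 < size w)%N -> iterated_integral a f1 f2 w b = 0.

End Abel.

Section Curves.
Context {R : realType}.
Implicit Types (X Y G D : set (R * R)).

Definition lipschitz_arc (h : R -> R * R) : Prop :=
  [/\ [lipschitz h s | s in `[0, 1]],
      {in `[0, 1] &, injective h} &
      (* the inverse is locally Lipschitz away from the endpoints *)
      forall s, s \in `]0, 1[ -> exists2 U, nbhs (h s) U &
        exists K : R, forall x y, x \in `[0, 1] -> y \in `[0, 1] ->
          U (h x) -> U (h y) -> `|x - y| <= K * `|h x - h y| ].

Definition lipschitz_triangulable G : Prop :=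
  exists (n : nat) (h : 'I_n -> R -> R * R),
    [/\ forall i, lipschitz_arc (h i),
        G = \bigcup_(i in [set: 'I_n]) (h i @` `[0, 1]),
        forall i j s t, i != j -> s \in `[0, 1] -> t \in `[0, 1] ->
          h i s = h j t -> (s = 0 \/ s = 1) /\ (t = 0 \/ t = 1) &
        forall i j, i != j ->
          is_subset1 (h i @` `[0, 1] `&` h j @` `[0, 1]) ].

(* A finite one-dimensional CW structure on X, i.e. a homeomorphism of X with a
   finite graph (loops and multiple edges allowed): V is the set of vertices and
   [h i] is the characteristic map of the i-th edge. *)
Definition graph_structure X (V : set (R * R)) (n : nat)
    (h : 'I_n -> R -> R * R) : Prop :=
  [/\ finite_set V /\ (0 < n)%N,
      forall i, {within `[0, 1], continuous (h i)} /\ V (h i 0) /\ V (h i 1),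
      forall i s, s \in `]0, 1[ -> ~ V (h i s),
      forall i j s t, s \in `]0, 1[ -> t \in `]0, 1[ ->
        h i s = h j t -> i = j /\ s = t &
      X = V `|` \bigcup_(i in [set: 'I_n]) (h i @` `[0, 1]) ].

(* An oriented edge is a pair (i, o); [h i] is run from 0 to 1 when o is true
   and backwards otherwise. *)
Definition edge_src n (h : 'I_n -> R -> R * R) (d : 'I_n * bool) : R * R :=
  h d.1 (if d.2 then 0 else 1).
Definition edge_tgt n (h : 'I_n -> R -> R * R) (d : 'I_n * bool) : R * R :=
  h d.1 (if d.2 then 1 else 0).
Definition edge_next n (h : 'I_n -> R -> R * R) : rel ('I_n * bool) :=
  fun d e => edge_tgt h d == edge_src h e.

Definition graph_euler_trail n (h : 'I_n -> R -> R * R)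
    (w : seq ('I_n * bool)) : Prop :=
  perm_eq (map fst w) (enum 'I_n) /\ sorted (edge_next h) w.

Definition graph_euler_circuit n (h : 'I_n -> R -> R * R)
    (w : seq ('I_n * bool)) : Prop :=
  perm_eq (map fst w) (enum 'I_n) /\ cycle (edge_next h) w.

Definition traversable X : Prop :=
  connected X /\ exists (V : set (R * R)) (n : nat) (h : 'I_n -> R -> R * R),
    graph_structure X V h /\ exists w, graph_euler_trail h w.

Definition unicursal X : Prop :=
  connected X /\ exists (V : set (R * R)) (n : nat) (h : 'I_n -> R -> R * R),
    graph_structure X V h /\ exists w, graph_euler_circuit h w.

Definition unit_circle : set (R * R) := [set z | z.1 ^+ 2 + z.2 ^+ 2 = 1].

(* Nondegenerate closed arcs, including the whole circle. *)
Definition circle_arc (I : set (R * R)) : Prop :=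
  exists alpha beta : R, alpha < beta /\
    I = [set (cos x, sin x) | x in `[alpha, beta]].

(* An edge is traversed exactly once when each of its interior points is
   visited exactly once: I being compact, gamma then restricts to a
   homeomorphism from a subarc of I onto the open edge. *)
Definition euler_trail X (I : set (R * R)) (gamma : R * R -> R * R) : Prop :=
  [/\ circle_arc I,
      {within I, continuous gamma} /\ gamma @` I = X,
      exists2 Z, finite_set Z & {in I `\` Z &, injective gamma},
      exists (V : set (R * R)) (n : nat) (h : 'I_n -> R -> R * R),
        graph_structure X V h /\
        forall i s, s \in `]0, 1[ -> exists! z, I z /\ gamma z = h i s &
      I = unit_circle <-> unicursal X ].

Definition P2 (a b : R) G (F : R -> R * R) : Prop :=
  [/\ [lipschitz F t | t in `[a, b]], F a = F b,
      F @` `[a, b] `<=` G &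
      exists X I gamma,
        [/\ X `<=` G, traversable X, euler_trail X I gamma &
            exists g : R -> R * R,
              [/\ {within `[a, b], continuous g}, g @` `[a, b] `<=` I &
                  forall t, t \in `[a, b] -> F t = gamma (g t)]] ].

(* Singular homology of G with integer coefficients, in degree 1.  A singular
   simplex is extended by 0 outside the standard simplex, so that equality of
   simplices is equality of functions. *)
Definition simplex2 : set (R * R) :=
  [set p | [/\ 0 <= p.1, 0 <= p.2 & p.1 + p.2 <= 1]].

Definition restrict1 (s : R -> R * R) : R -> R * R :=
  patch (fun=> 0) `[0, 1] s.

Definition singular1 G (s : R -> R * R) : Prop :=
  [/\ {within `[0, 1], continuous s}, s @` `[0, 1] `<=` G & s = restrict1 s].

Definition singular2 G (s : R * R -> R * R) : Prop :=
  [/\ {within simplex2, continuous s}, s @` simplex2 `<=` G &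
      s = patch (fun=> 0) simplex2 s].

Definition chain1 := {freeg (R -> R * R) / int}.
Definition chain2 := {freeg (R * R -> R * R) / int}.

Definition boundary1 (c : chain1) : {freeg (R * R)%type / int} :=
  fglift (fun s : R -> R * R => << s 1 >> - << s 0 >>) c.

Definition boundary2 (c : chain2) : chain1 :=
  fglift (fun s : R * R -> R * R =>
    << restrict1 (fun t => s (1 - t, t)) >>
    - << restrict1 (fun t => s (0, t)) >>
    + << restrict1 (fun t => s (t, 0)) >>) c.

Definition cycle1 G (c : chain1) : Prop :=
  (forall s, s \in dom c -> singular1 G s) /\ boundary1 c = 0.

Definition null_homologous G (c : chain1) : Prop :=
  exists2 d : chain2, (forall s, s \in dom d -> singular2 G s) &
    c = boundary2 d.

Definition H1_independent G (m : nat) (c : 'I_m -> chain1) : Prop :=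
  (forall i, cycle1 G (c i)) /\
  forall k : 'I_m -> int,
    null_homologous G (\sum_i c i *~ k i) -> forall i, k i = 0.

Definition H1_rank G (m : nat) : Prop :=
  (exists c : 'I_m -> chain1, H1_independent G c) /\
  forall (k : nat) (c : 'I_k -> chain1), H1_independent G c -> (k <= m)%N.

Definition H1_generated G (m : nat) (c : 'I_m -> chain1) : Prop :=
  forall z, cycle1 G z ->
    exists k : 'I_m -> int, null_homologous G (z - \sum_i c i *~ k i).

(* The fundamental cycle of a closed path parameterized by [0, 1]. *)
Definition loop_cycle (l : R -> R * R) : chain1 := << restrict1 l >>.

Definition simple_closed_lipschitz (l : R -> R * R) : Prop :=
  [/\ [lipschitz l t | t in `[0, 1]], l 0 = l 1 &
      {in `[0, 1[ &, injective l}].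

Definition simply_connected D : Prop :=
  (forall x y, D x -> D y -> exists p : R -> R * R,
     [/\ {within `[0, 1], continuous p}, p @` `[0, 1] `<=` D,
         p 0 = x & p 1 = y]) /\
  (forall l : R -> R * R, {within `[0, 1], continuous l} ->
     l @` `[0, 1] `<=` D -> l 0 = l 1 ->
     exists H : R * R -> R * R,
       [/\ {within `[0, 1] `*` `[0, 1], continuous H},
           H @` (`[0, 1] `*` `[0, 1]) `<=` D,
           forall t, t \in `[0, 1] -> H (0, t) = l t,
           forall s, s \in `[0, 1] -> H (s, 0) = H (s, 1) &
           exists c, forall t, t \in `[0, 1] -> H (1, t) = c]).

Definition bounded_domain_with_boundary D (J : set (R * R)) : Prop :=
  [/\ open D /\ D !=set0, connected D, bounded_set D, simply_connected D &
      closure D `\` interior D = J].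

(* The winding number of [l] about [z] is 1. *)
Definition winds_once (l : R -> R * R) (z : R * R) : Prop :=
  exists rho theta : R -> R,
    [/\ {within `[0, 1], continuous rho},
        {within `[0, 1], continuous theta},
        forall t, t \in `[0, 1] -> 0 < rho t /\
          l t = (z.1 + rho t * cos (theta t), z.2 + rho t * sin (theta t)) &
        theta 1 = theta 0 + 2 * pi].

Definition area D : R :=
  fine ((@lebesgue_measure R \x @lebesgue_measure R)%E D).

Definition Q_independent (m : nat) (x : 'I_m -> R) : Prop :=
  forall q : 'I_m -> rat, \sum_i ratr (q i) * x i = 0 -> forall i, q i = 0.

Definition class_A (a b : R) (F : R -> R * R) : Prop :=
  exists G : set (R * R),
    [/\ compact G, lipschitz_triangulable G, P2 a b G F &
      exists (m : nat) (l : 'I_m -> R -> R * R) (D : 'I_m -> set (R * R)),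
        [/\ H1_rank G m,
            forall i, simple_closed_lipschitz (l i) /\ l i @` `[0, 1] `<=` G,
            H1_generated G (fun i => loop_cycle (l i)),
            forall i, bounded_domain_with_boundary (D i) (l i @` `[0, 1]) /\
                      (* counterclockwise orientation of [l i] *)
                      (forall z, D i z -> winds_once (l i) z) &
            Q_independent (fun i => area (D i))] ].

End Curves.

(* Main.v *)
(* If the equation determines a center, the expansion of 1/v in powers of a small
   initial value v(a) shows that f1 f2' has integral 0.

   Conversely, the integral of f1 f2' is, by Green's formula, the integral over
   the plane of the winding number of F.  Since F is homologous in G to a
   combination of the loops l_i with coefficients k_i, that winding number is the
   sum of the k_i such that z lies in D_i, for all z off the null set G; hence the
   integral is the sum of the k_i area(D_i).  If it vanishes then so do the k_i,
   by independence over Q, and F is null homologous in G.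

   Write F = gamma o (cos th, sin th), for gamma an Eulerian trail.  If th a and
   th b were different, F would pass through a point visited once by gamma, always
   in the same direction, and the map from G to the circle that wraps an arc of G
   around the circle and collapses the rest of G would give F a nonzero winding
   number.  So th a = th b, and F factors through the segment th([a, b]).

   Finally, if F = Phi o g with g a = g b then, measuring g by the variation of
   Phi, we may take Phi Lipschitz; solutions and iterated integrals of the
   equation driven by Phi along the line, composed with g, are those driven by F,
   and they return to their initial values at b. *)

Require Import Defs.
From HB Require Import structures.
From mathcomp Require Import all_boot all_order all_algebra.
From mathcomp Require Import all_classical all_reals all_analysis.
From mathcomp Require Import measurable_realfun freeg ring lra zify.

Set Implicit Arguments.
Unset Strict Implicit.
Unset Printing Implicit Defensive.

Import Order.TTheory GRing.Theory Num.Theory.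
Import numFieldNormedType.Exports.

Local Open Scope classical_set_scope.
Local Open Scope ring_scope.

(** * Lipschitz functions and the fundamental theorem of calculus *)

(** Lipschitz functions are differentiable only almost everywhere, and [Phi] may fail to be
    differentiable at [g t] even where [F] is differentiable at t, so the chain rule is out of
    reach. Solutions and iterated integrals along the line are therefore handled through
    second-order increment estimates, with errors at most C (t - s)^2. These survive composition
    with a Lipschitz map and give back derivatives wherever [f1] and [f2] have them. Homology enters
    only through maps from [G] to the punctured plane: an argument exists over a whole singular
    triangle, so boundaries do not turn. Two kinds of maps suffice, the translations by -z and the
    wrapping of one arc of [G]. The winding number of l_i is prescribed inside D_i only; elsewhere a
    bounded component of the complement could a priori carry a nonzero one. An argument in the style
    of Brouwer excludes this. Green's formula for Lipschitz curves rests on an exact identity: at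
    dyadic times, a Riemann sum of x dy is the integral of a count of signed crossings of a
    half-line. *)

Section NullSets.
Context d (T : measurableType d) (R : realType) (mu : {measure set T -> \bar R}).
Import HBNNSimple.

(* No measurability of f or g is assumed: the integral of a nonnegative function
   is a supremum over simple functions, which may be cut off outside N. *)
Lemma eq_integral_negligible (D N : set T) (f g : T -> \bar R) :
  measurable N -> mu N = 0%E -> (forall x, D x -> ~ N x -> f x = g x) ->
  (\int[mu]_(x in D) f x = \int[mu]_(x in D) g x)%E.
Proof.
move=> mN N0.
suff le_nn (u v : T -> \bar R) : (forall x, 0 <= u x)%E -> (forall x, 0 <= v x)%E ->
    (forall x, ~ N x -> u x = v x) -> (\int[mu]_x u x <= \int[mu]_x v x)%E.
  have eq_nn (u v : T -> \bar R) : (forall x, 0 <= u x)%E ->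
      (forall x, 0 <= v x)%E -> (forall x, ~ N x -> u x = v x) ->
      (\int[mu]_x u x = \int[mu]_x v x)%E.
    move=> u0 v0 uv; apply/le_anti/andP; split; apply: le_nn => // x Nx.
    by rewrite uv.
  move=> fg; rewrite integral_mkcond [RHS]integral_mkcond.
  have fgD x : ~ N x -> (f \_ D) x = (g \_ D) x.
    move=> Nx; rewrite !patchE; case: ifPn => // /set_mem Dx; exact: fg.
  rewrite integralE [RHS]integralE; congr (_ - _)%E; apply: eq_nn => // x Nx;
    by rewrite ?funeposE ?funenegE fgD.
move=> u0 v0 uv; rewrite !ge0_integralTE//; apply: ge_ereal_sup => _ [h /= hu <-].
pose h' := proj_nnsfun h (measurableC mN).
have h'E x : h' x = if x \in N then 0 else h x.
  rewrite [LHS](_ : _ = h x * \1_(~` N) x)// indicE in_setC.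
  case: ifP => /= _; first by rewrite mulr0.
  by rewrite mulr1.
have -> : sintegral mu h = sintegral mu h'.
  have sE (k : {nnsfun T >-> R}) : sintegral mu k = (\int[mu]_x (k x)%:E)%E.
    by rewrite integral_nnsfun// patch_setT.
  rewrite !sE.
  apply: ge0_ae_eq_integral => //.
  - exact/measurable_EFinP.
  - exact/measurable_EFinP.
  - by move=> x _; rewrite lee_fin.
  - by move=> x _; rewrite lee_fin.
  - exists N; split => //; move=> x /= hx; apply: contrapT => Nx.
    by apply: hx => _; move: (h'E x); rewrite memNset //= => ->.
apply: ereal_sup_ubound; exists h' => //= x.
rewrite [X in X%:E](h'E x); case: ifPn => [_|]; first exact: v0.
by rewrite notin_setE => Nx; rewrite -uv.
Qed.

Lemma eq_Rintegral_negligible (D N : set T) (f g : T -> R) :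
  measurable N -> mu N = 0%E -> (forall x, D x -> ~ N x -> f x = g x) ->
  \int[mu]_(x in D) f x = \int[mu]_(x in D) g x.
Proof.
move=> mN N0 fg; congr fine; apply: (@eq_integral_negligible _ N) => // x Dx Nx.
by rewrite fg.
Qed.

End NullSets.

Section LipschitzFTC.
Context {R : realType}.
Notation mu := (@lebesgue_measure R).
Implicit Types (a b p q s t x y K : R) (f g : R -> R).

Definition lip a b K f : Prop :=
  forall s t, a <= s <= b -> a <= t <= b -> `|f s - f t| <= K * `|s - t|.

Definition clip a b x : R := Num.max a (Num.min x b).

Lemma clip_itv a b x : a <= b -> a <= clip a b x <= b.
Proof. by move=> ab; rewrite le_max lexx /= ge_max ab ge_min lexx orbT. Qed.

Lemma clip_id a b x : a <= x <= b -> clip a b x = x.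
Proof. by move=> /andP[ax xb]; rewrite /clip min_l// max_r. Qed.

Lemma clip_le a b x y : x <= y -> clip a b x <= clip a b y <= clip a b x + (y - x).
Proof.
move=> xy; have minxy : Num.min x b <= Num.min y b <= Num.min x b + (y - x).
  by rewrite /Order.min; case: ltP => ?; case: ltP => ?; apply/andP; split; lra.
by move: minxy; rewrite /clip /Order.max; case: ltP => ?; case: ltP => ? /andP[? ?];
  apply/andP; split; lra.
Qed.

Lemma lipschitz_lip a b f : [lipschitz f t | t in `[a, b]] ->
  exists2 K, 0 <= K & lip a b K f.
Proof.
move=> [M [_ MH]]; exists (Num.max 0 (M + 1)); first by rewrite le_max lexx.
move=> s t sab tab; have /MH/(_ (s, t)) : M < Num.max 0 (M + 1).
  by rewrite lt_max; apply/orP; right; lra.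
by rewrite /= !in_itv/=; apply.
Qed.

Lemma lip_lipschitz a b K f : lip a b K f -> [lipschitz f t | t in `[a, b]].
Proof.
move=> fK; exists K; split; first exact: num_real.
move=> M KM [s t] /= []; rewrite !in_itv/= => sab tab.
by rewrite (le_trans (fK _ _ sab tab))// ler_wpM2r// ltW.
Qed.

(** Both [f] and x - [f] x are nondecreasing, hence cumulative functions of two Stieltjes measures
    whose sum is Lebesgue measure. So the measure of [f] is absolutely continuous, and the
    Radon-Nikodym theorem supplies the density. Invariance under [clip] makes that measure
    finite. *)
Lemma density_of_cumulative a b f : a <= b ->
  {homo f : s t / s <= t} -> (forall s t, s <= t -> f t - f s <= t - s) ->
  (forall x, f (clip a b x) = f x) ->
  exists2 g : R -> R, mu.-integrable setT (EFin \o g) &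
    forall s t, s <= t -> f t - f s = \int[mu]_(x in `[s, t]) g x.
Proof.
move=> ab fnd flip fclip.
have lc (h : R -> R) : {homo h : s t / s <= t} ->
    (forall s t, s <= t -> h t - h s <= t - s) -> right_continuous h.
  move=> hnd hl x; apply: cvg_within_filter; apply/cvgrPdist_le => e e0.
  near=> t; apply: (@le_trans _ _ `|x - t|); last first.
    by near: t; apply: cvgr_dist_le => //; exact: cvg_id.
  have [xt|/ltW tx] := leP x t.
    by have ? := hnd _ _ xt; have ? := hl _ _ xt; rewrite !ler0_norm; lra.
  by have ? := hnd _ _ tx; have ? := hl _ _ tx; rewrite !ger0_norm; lra.
pose F : cumulative R R := HB.pack f (isCumulative.Build R _ R f fnd (lc _ fnd flip)).
pose h x := x - f x.
have hnd : {homo h : s t / s <= t} by move=> s t /flip; rewrite /h; lra.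
have hl s t : s <= t -> h t - h s <= t - s by move=> /fnd; rewrite /h; lra.
pose H : cumulative R R := HB.pack h (isCumulative.Build R _ R h hnd (lc _ hnd hl)).
pose nu := lebesgue_stieltjes_measure F.
pose nuH := lebesgue_stieltjes_measure H.
have nuE (G : cumulative R R) s t : s <= t ->
    lebesgue_stieltjes_measure G `]s, t] = (G t - G s)%:E.
  move=> st; rewrite /lebesgue_stieltjes_measure /measure_extension measurable_mu_extE/=; last exact: is_ocitv.
  by rewrite wlength_itv_bnd.
have muE A : measurable A -> mu A = (nu A + nuH A)%E.
  rewrite -measure_addE; apply: lebesgue_measure_unique => _ [[s t] _ <-].
  rewrite [RHS](measure_addE nu nuH).
  change (mu `]s, t]%classic = (nu `]s, t]%classic + nuH `]s, t]%classic)%E).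
  have [st|ts] := leP s t.
    rewrite lebesgue_measure_itv /= lte_fin.
    rewrite /nu /nuH !nuE //= -EFinD /h; case: ltP => ? ; rewrite -?EFinB; congr EFin; lra.
  have -> : `]s, t]%classic = set0 :> set R by rewrite set_itv_ge// bnd_simp -leNgt ltW.
  by rewrite /nu /nuH !measure0 adde0.
have nu_itv n : (nu `](- n%:R)%R, n%:R%R]%classic <= (f b - f a)%:E)%E.
  have fclip' x : f a <= f x <= f b.
    by rewrite -(fclip x); have /andP[? ?] := clip_itv x ab; rewrite !fnd.
  rewrite /nu nuE ?lee_fin; last by rewrite -subr_ge0 opprK addr_ge0.
  by have := fclip' n%:R; have := fclip' (- n%:R) => /=; lra.
have nu_fin : fin_num_fun nu.
  apply: lty_fin_num_fun; apply: (@le_lt_trans _ _ (f b - f a)%:E); last exact: ltry.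
  have UE : [set: R] = \bigcup_n `](- n%:R)%R, n%:R%R]%classic.
    by rewrite -(bigcup_itvT false false).
  have ndU : {homo (fun n : nat => `](- n%:R)%R, n%:R%R]%classic : set R) : n m / (n <= m)%N >-> (n <= m)%O}.
    move=> n m nm; rewrite subsetEset; apply: subset_itv; rewrite bnd_simp.
      by rewrite lerN2 ler_nat.
    by rewrite ler_nat.
  have cvU : (nu \o (fun n : nat => `](- n%:R)%R, n%:R%R]%classic : set R)) n @[n --> \oo] --> nu setT.
    by rewrite UE; apply: nondecreasing_cvg_mu => //; rewrite -UE.
  change (nu setT <= (f b - f a)%:E)%E.
  rewrite -(cvg_lim _ cvU)//; apply: lime_le; first by apply/cvg_ex; exists (nu setT).
  by near=> n; exact: nu_itv.
pose nuf : {finite_measure set _ -> \bar R} := HB.pack nu (Measure_isFinite.Build _ _ _ nu nu_fin).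
have numu : nuf `<< mu.
  apply/null_content_dominatesP => A mA muA.
  move: (muE _ mA); rewrite muA => /esym/eqP.
  by rewrite padde_eq0// => /andP[/eqP].
have [g [g0 gfin gint gE]] := radon_nikodym_sigma_finite numu.
exists (fine \o g).
  by apply: eq_integrable gint => // x _ /=; rewrite fineK.
move=> s t st; have : nu `]s, t]%classic = (f t - f s)%:E by rewrite /nu nuE.
change (nuf `]s, t]%classic = (f t - f s)%:E -> f t - f s = \int[mu]_(x in `[s, t]) (fine \o g) x).
rewrite (gE `]s, t]%classic)// => fgE; rewrite /Rintegral -integral_itv_obnd_cbnd.
  rewrite (eq_integral g) ?fgE//; by move=> x _; rewrite /= fineK.
apply: (measurable_funS measurableT) => //.
rewrite (_ : (fun x => _) = g); last by apply/funext => x /=; rewrite fineK.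
exact: measurable_int gint.
Unshelve. all: by end_near. Qed.

Lemma is_deriveP (f : R -> R) (t d : R) : is_derive t 1 f d <->
  forall e : R, 0 < e -> exists2 r : R, 0 < r &
    forall s : R, `|s - t| < r -> `|f s - f t - d * (s - t)| <= e * `|s - t|.
Proof.
have key : h^-1 *: ((f \o shift t) (h *: 1) - f t) @[h --> 0^'] --> d <->
  forall e : R, 0 < e -> exists2 r : R, 0 < r &
    forall s : R, `|s - t| < r -> `|f s - f t - d * (s - t)| <= e * `|s - t|.
  have E h : h != 0 -> `|f (h + t) - f t - d * h| = `|h| * `|d - h^-1 *: ((f \o shift t) (h *: 1) - f t)|.
    move=> h0; rewrite -normrM distrC /=; congr (`|_|).
    by rewrite /GRing.scale /= mulr1 mulrBr mulrA divff// mul1r; ring.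
  split=> [/cvgrPdist_le H e e0|H].
    have [r /= r0 Hr] := H e e0; exists r => // s sr.
    have [->|st] := eqVneq s t; first by rewrite !subrr mulr0 subr0 !normr0 mulr0.
    have st0 : s - t != 0 by rewrite subr_eq0.
    rewrite -[X in f X](subrK t) E// mulrC ler_wpM2r//.
    by apply: Hr => //=; rewrite sub0r normrN.
  apply/cvgrPdist_le => e e0; have [r r0 Hr] := H e e0.
  exists r => // h /=; rewrite sub0r normrN => hr h0.
  have hp : 0 < `|h| by rewrite normr_gt0.
  rewrite -(ler_pM2l hp) -E// [leRHS]mulrC.
  by have := Hr (h + t); rewrite addrK; apply.
split=> [[df dE]|H].
  by apply/key; rewrite -dE; exact: df.
have /cvg_lim dE := key.2 H; split; last by rewrite /derive dE.
by apply/cvg_ex; exists d; exact: (key.2 H).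
Qed.

Lemma integrable_itv K f s t : measurable_fun setT f -> (forall x, `|f x| <= K) ->
  mu.-integrable `[s, t] (EFin \o f).
Proof.
move=> mf fK; apply: measurable_bounded_integrable => //.
- by rewrite /= lebesgue_measure_itv /=; case: ifP => _; rewrite ?ltry.
- exact: measurable_funTS.
- exists K; split; first exact: num_real.
  by move=> M KM x _ /=; apply: (le_trans (fK x)); exact: ltW.
Qed.

Lemma lip_derive_bound a b K f t (d : R) : lip a b K f -> a < t < b ->
  is_derive t 1 f d -> `|d| <= K.
Proof.
move=> fK /andP[ta tb] /is_deriveP H; apply/ler_addgt0Pr => e e0.
have [r r0 Hr] := H e e0.
pose h := Num.min (r / 2) ((b - t) / 2).
have h0 : 0 < h by rewrite /h lt_min; lra.
have hr : h <= r / 2 by rewrite /h ge_min lexx.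
have hb : h <= (b - t) / 2 by rewrite /h ge_min lexx orbT.
have /= := Hr (t + h); rewrite (_ : t + h - t = h); last by ring.
rewrite gtr0_norm// => /(_ ltac:(lra)) H1.
have := fK (t + h) t ltac:(lra) ltac:(lra).
rewrite (_ : t + h - t = h) ?(gtr0_norm h0) => [H2|]; last by ring.
rewrite -(ler_pM2r h0) -[X in _ * X](gtr0_norm h0) -normrM.
move: H1 H2; rewrite !ler_norml => /andP[? ?] /andP[? ?].
by apply/andP; split; lra.
Qed.

Lemma eq_Rintegral_ae_itv a b s t (u v : R -> R) : a <= s -> t <= b ->
  {ae mu, forall x, x \in `]a, b[ -> u x = v x} ->
  \int[mu]_(x in `[s, t]) u x = \int[mu]_(x in `[s, t]) v x.
Proof.
move=> sa tb [N [mN N0 subN]].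
have ab0 : mu [set a; b] = 0%E.
  transitivity (mu [set a]); last exact: lebesgue_measure_set1.
  by apply: measureU0 => //; exact: lebesgue_measure_set1.
apply: (@eq_Rintegral_negligible _ _ _ _ _ (N `|` [set a; b])).
- by apply: measurableU => //; exact: measurableU.
- transitivity (mu N); last by [].
  by apply: measureU0 => //; exact: measurableU.
- move=> x /=; rewrite in_itv/= => /andP[sx xt] xN.
  have [xa|/eqP xa] := eqVneq x a; first by case: xN; right; left.
  have [xb|/eqP xb] := eqVneq x b; first by case: xN; right; right.
  apply: contrapT => nd; apply: xN; left; apply: subN => /= H; apply: nd; apply: H.
  rewrite in_itv/= !lt_neqAle; apply/andP; split; apply/andP; split; try lra.
Qed.

Lemma lip_density a b K f : a < b -> 0 <= K -> lip a b K f ->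
  exists g : R -> R,
    [/\ measurable_fun setT g, forall x, `|g x| <= K,
        forall s t, a <= s -> s <= t -> t <= b -> f t - f s = \int[mu]_(x in `[s, t]) g x &
        {ae mu, forall t, t \in `]a, b[ -> is_derive t 1 f (g t)}].
Proof.
move=> ab K0 fK.
have ab' := ltW ab.
have c1 x y : x <= y -> 0 <= clip a b y - clip a b x <= y - x.
  by move=> /(clip_le a b); lra.
have fc x y : x <= y -> `|f (clip a b y) - f (clip a b x)| <= K * (clip a b y - clip a b x).
  move=> xy; have := fK _ _ (clip_itv y ab') (clip_itv x ab').
  by rewrite (@ger0_norm _ (clip _ _ _ - _))//; have := c1 _ _ xy; lra.
(* [f] + K x is nondecreasing with slopes at most 2 K. Dividing by [C] brings them below 1, and the
   extra 1 keeps [C] positive when K = 0. *)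
pose C := 2 * K + 1.
have C0 : 0 < C by rewrite /C; lra.
pose F x := C^-1 * (f (clip a b x) + K * clip a b x).
have FE x y : F y - F x = C^-1 * ((f (clip a b y) - f (clip a b x)) + K * (clip a b y - clip a b x)).
  by rewrite /F; ring.
have [|||g gint gE] := @density_of_cumulative a b F ab'.
- move=> x y xy; rewrite -subr_ge0 FE mulr_ge0//; first by rewrite invr_ge0 ltW.
  by have := fc _ _ xy; rewrite ler_norml; lra.
- move=> x y xy; rewrite FE ler_pdivrMl// /C.
  have := fc _ _ xy; rewrite ler_norml; have := c1 _ _ xy; nra.
- by move=> x; rewrite /F clip_id// clip_itv.
pose g1 x := C * g x - K.
have mg : measurable_fun setT g by apply/measurable_EFinP; exact: measurable_int gint.
have gint' s t : mu.-integrable `[s, t] (EFin \o g) by apply: integrableS gint.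
have ab_sub s t : a <= s -> s <= t -> t <= b -> f t - f s = \int[mu]_(x in `[s, t]) g1 x.
  move=> sa st tb; rewrite /g1 RintegralB//; last 2 first.
  - exact: (integrableZl _ C (gint' s t)).
  - by apply: (@integrable_itv K (fun=> K)) => // x; rewrite ger0_norm.
  rewrite RintegralZl// -gE// Rintegral_cst//=.
  rewrite lebesgue_measure_itv/= lte_fin FE !clip_id; try lra.
  rewrite mulrA divff ?gt_eqF// mul1r; move: st.
  rewrite le_eqVlt => /predU1P[->|st]; first by rewrite ltxx /=; ring.
  by rewrite st -EFinD /=; ring.
have := @FTC1 R g (BLeft a) (fun y => gint' _ _) _.
move=> /(_ (open_integrable_locally openT gint))/= dF.
have {}dF : {ae mu, forall t, t \in `]a, b[ -> is_derive t 1 f (g1 t)}.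
  move: dF; apply: filterS; first exact: (ae_filter_ringOfSetsType mu).
  move=> t /= tF.
  rewrite in_itv/= => /andP[ta tb]; have [|dG dGE] := tF _; first by rewrite lte_fin.
  set G := (fun y : R => \int[mu]_(t in _) g t) in dG dGE.
  rewrite derive1E in dGE.
  have {}dG' : @is_derive R R R t 1 G (g t).
    apply: DeriveDef.
    exact: dG.
    exact: dGE.
  move: dG' => {}dG.
  apply/is_deriveP => e e0.
  have [r r0 Hr] := (is_deriveP _ _ _).1 dG (e / C) (divr_gt0 e0 C0).
  exists (Num.min r (Num.min (t - a) (b - t))); first by rewrite !lt_min r0; lra.
  move=> s; rewrite !lt_min => /and3P[/Hr sr].
  rewrite !ltr_norml => /andP[sa _] /andP[_ sb].
  have fE x : a <= x <= b -> f x = f a + (C * G x - K * (x - a)).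
    move=> /andP[ax xb]; have := gE _ _ ax; rewrite -/(G x) => <-.
    by rewrite FE !clip_id ?lexx ?ax ?ab'// mulrA divff ?gt_eqF// mul1r; ring.
  rewrite (fE s) ?(fE t); try (by clear -sa sb ta tb; lra).
  have -> : f a + (C * G s - K * (s - a)) - (f a + (C * G t - K * (t - a))) - g1 t * (s - t)
    = C * (G s - G t - g t * (s - t)) by rewrite /g1; ring.
  by rewrite normrM (gtr0_norm C0) -ler_pdivlMl// mulrA [C^-1 * e]mulrC.
have g1K t : t \in `]a, b[ -> is_derive t 1 f (g1 t) -> `|g1 t| <= K.
  by rewrite in_itv/= => tab df; exact: lip_derive_bound fK tab df.
(* [g1] is known to be bounded by K only where it is the derivative of [f]. Truncation makes the
   bound hold everywhere and changes nothing almost everywhere in ]a, b[. *)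
pose g2 t := clip (- K) K (g1 t).
have KK : - K <= K by lra.
have mg1 : measurable_fun setT g1.
  by apply: measurable_funB => //; apply: measurable_funM.
have mg2 : measurable_fun setT g2.
  by apply: measurable_maxr => //; apply: measurable_minr.
have g12 t : t \in `]a, b[ -> is_derive t 1 f (g1 t) -> g2 t = g1 t.
  by move=> tab /(g1K _ tab); rewrite ler_norml => /clip_id.
have dF2 : {ae mu, forall t, t \in `]a, b[ -> is_derive t 1 f (g2 t)}.
  move: dF; apply: filterS; first exact: (ae_filter_ringOfSetsType mu).
  move=> t H tab; have df := H tab; by rewrite g12.
exists g2; split=> //.
- by move=> x; rewrite ler_norml; exact: clip_itv.
move=> s t sa st tb; rewrite ab_sub//; apply: (eq_Rintegral_ae_itv sa tb).
move: dF; apply: filterS; first exact: (ae_filter_ringOfSetsType mu).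
by move=> x H xab; have df := H xab; rewrite g12.
Qed.

(* u is only required to be a derivative of f almost everywhere. *)
Lemma lip_FTC a b K f (u : R -> R) : a < b -> 0 <= K -> lip a b K f ->
  {ae mu, forall t, t \in `]a, b[ -> is_derive t 1 f (u t)} ->
  forall s t, a <= s -> s <= t -> t <= b -> \int[mu]_(x in `[s, t]) u x = f t - f s.
Proof.
move=> ab K0 fK fu s t sa st tb.
have [g [mg gK gE fg]] := lip_density ab K0 fK; rewrite gE//.
apply: (eq_Rintegral_ae_itv sa tb).
move: fg fu; apply: filterS2; first exact: (ae_filter_ringOfSetsType mu).
move=> x H1 H2 xab; have dg := H1 xab; have du := H2 xab.
by rewrite -(derive_val (is_derive := dg)) -(derive_val (is_derive := du)).
Qed.

Lemma lip_ae_derive1 a b K f : a < b -> 0 <= K -> lip a b K f ->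
  {ae mu, forall t, t \in `]a, b[ -> is_derive t 1 f (derive1 f t)}.
Proof.
move=> ab K0 fK; have [g [_ _ _]] := lip_density ab K0 fK.
apply: filterS; first exact: (ae_filter_ringOfSetsType mu).
move=> t H /H df; rewrite derive1E (derive_val (is_derive := df)).
exact: df.
Qed.

Lemma lip_nonincreasing a b K f (u : R -> R) : a < b -> 0 <= K -> lip a b K f ->
  {ae mu, forall t, t \in `]a, b[ -> is_derive t 1 f (u t) /\ u t <= 0} ->
  forall t, a <= t <= b -> f t <= f a.
Proof.
move=> ab K0 fK fu t /andP[at_ tb].
(* The positive part is nonnegative everywhere, while it equals - [u] almost everywhere on ]a,
   b[. *)
pose v t := Num.max (- u t) 0.
have Nf : lip a b K (fun x => - f x).
  by move=> x y xab yab; rewrite -opprD normrN; exact: fK.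
rewrite -lerN2 -subr_ge0 -(@lip_FTC a b K _ v ab K0 Nf)//.
  by apply: Rintegral_ge0 => x _; rewrite le_max lexx orbT.
move: fu; apply: filterS; first exact: (ae_filter_ringOfSetsType mu).
move=> x H /H[df u0]; rewrite /v max_l; last by rewrite oppr_ge0.
exact: is_deriveN.
Qed.

End LipschitzFTC.

(** * The Abel equation driven by Lipschitz functions *)

Section ControlledIntegral.
Context {R : realType}.
Notation mu := (@lebesgue_measure R).
Implicit Types (a b p q s t x y K L : R) (f g k : R -> R).

Lemma lip_clip p q L k : p <= q -> lip p q L k -> forall s t : R,
  0 <= L -> `|k (clip p q s) - k (clip p q t)| <= L * `|s - t|.
Proof.
move=> pq kL s t L0; apply: (le_trans (kL _ _ _ _)); rewrite ?clip_itv//.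
rewrite ler_wpM2l//.
have [st|/ltW ts] := leP s t.
  by have ? := clip_le p q st; rewrite !ler0_norm; lra.
by have ? := clip_le p q ts; rewrite !ger0_norm; lra.
Qed.

Lemma lip_clip_measurable p q L k : p <= q -> 0 <= L -> lip p q L k ->
  measurable_fun setT (k \o clip p q).
Proof.
move=> pq L0 kL; apply: continuous_measurable_fun => x.
apply/cvgrPdist_le => e e0; exists (e / (L + 1)); first by rewrite /= divr_gt0//; lra.
move=> y /= xy; apply: (le_trans (lip_clip pq kL _ _ L0)).
rewrite ltr_pdivlMr in xy; last by lra.
by have := normr_ge0 (x - y); nra.
Qed.

Lemma lip_bounded p q L k : p <= q -> 0 <= L -> lip p q L k ->
  exists2 M, 0 <= M & forall s, p <= s <= q -> `|k s| <= M.
Proof.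
move=> pq L0 kL; exists (`|k p| + L * (q - p)).
  by rewrite addr_ge0// mulr_ge0// subr_ge0.
move=> s spq; rewrite -[k s](subrK (k p)) addrC (le_trans (ler_normD _ _))// lerD2l.
apply: (le_trans (kL _ _ spq _)); first by rewrite lexx.
by rewrite ler_wpM2l// ger0_norm; lra.
Qed.

(* I k is the indefinite integral of k against dPsi. *)
Lemma stieltjes_integral p q K (Psi : R -> R) : p < q -> 0 <= K -> lip p q K Psi ->
  exists I : (R -> R) -> R -> R,
    (forall k k' (L L' e s t : R), 0 <= L -> 0 <= L' -> lip p q L k -> lip p q L' k' ->
       p <= s -> s <= t -> t <= q -> (forall x, s <= x <= t -> `|k x - k' x| <= e) ->
       `|(I k t - I k s) - (I k' t - I k' s)| <= K * e * (t - s)) /\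
    (forall c s t : R, p <= s -> s <= t -> t <= q ->
       I (fun=> c) t - I (fun=> c) s = c * (Psi t - Psi s)).
Proof.
move=> pq K0 PsiK; have [g [mg gK gE _]] := lip_density pq K0 PsiK.
have pq' := ltW pq.
pose I k s := \int[mu]_(x in `[p, s]) (g x * k (clip p q x)).
have int k L s t : 0 <= L -> lip p q L k ->
    mu.-integrable `[s, t] (EFin \o (fun x => g x * k (clip p q x))).
  move=> L0 kL; have [M M0 kM] := lip_bounded pq' L0 kL.
  apply: (@integrable_itv _ (K * M)).
    by apply: measurable_funM => //; exact: (lip_clip_measurable pq' L0 kL).
  by move=> x; rewrite normrM ler_pM// kM// clip_itv.
have IB k L s t : 0 <= L -> lip p q L k -> p <= s -> s <= t -> t <= q ->
    I k t - I k s = \int[mu]_(x in `[s, t]) (g x * k (clip p q x)).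
  move=> L0 kL ps st tq; rewrite /I Rintegral_itvB ?bnd_simp//; last exact: int kL.
  by rewrite Rintegral_itv_obnd_cbnd//; apply: integrableS (int _ _ _ _ L0 kL) => //;
    exact: subset_itv_oc_cc.
exists I; split.
  move=> k k' L L' e s t L0 L'0 kL k'L ps st tq kk'.
  rewrite (IB k L s t)// (IB k' L' s t)//.
  rewrite -RintegralB//; [|exact: (int k L)|exact: (int k' L')].
  have iB : mu.-integrable `[s, t] (EFin \o (fun x => g x * k (clip p q x) - g x * k' (clip p q x))).
    exact: (integrableB _ (int k L s t L0 kL) (int k' L' s t L'0 k'L)).
  apply: (le_trans (le_normr_Rintegral _ iB)) => //.
  have -> : K * e * (t - s) = \int[mu]_(x in `[s, t]) (K * e).
    rewrite Rintegral_cst//= lebesgue_measure_itv/= lte_fin.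
    move: st; rewrite le_eqVlt => /predU1P[->|st]; first by rewrite ltxx/=; ring.
    by rewrite st -EFinD.
  apply: le_Rintegral => //.
  - exact: (integrable_norm iB).
  - by apply: (@integrable_itv _ `|K * e|).
  - move=> x /=; rewrite in_itv/= => /andP[sx xt].
    rewrite -mulrBr normrM ler_pM// clip_id ?kk'//; lra.
move=> c s t ps st tq.
have cL : lip p q 0 (fun=> c) by move=> ? ? _ _; rewrite subrr normr0 mul0r.
rewrite (IB _ 0)// gE// mulrC -RintegralZr//.
by apply: (@integrable_itv _ K).
Qed.

Lemma geometric_ler (x y c : R) : (forall n, x <= y + c * 2^-1 ^+ n) -> x <= y.
Proof.
move=> H; apply/ler_addgt0Pr => e e0.
have /cvgrPdist_lt/(_ e e0)[N _ HN] : (fun n : nat => c * 2^-1 ^+ n : R) @ \oo --> (0 : R).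
  rewrite -[X in _ --> X](mulr0 c); apply: cvgMr; apply: cvg_expr.
  by rewrite ger0_norm//; lra.
have := HN N (leqnn N); rewrite sub0r normrN => /ltr_normlW HNe.
by apply: (le_trans (H N)); rewrite lerD2l ltW.
Qed.

(** The intervals of radius 2 e 2^-n about [u n] are nested, since consecutive terms differ by at
    most the decrease of the radius. The supremum of their left ends belongs to all of them. *)
Lemma geometric_limit (u : nat -> R) (e : R) :
  (forall n, `|u n.+1 - u n| <= e * 2^-1 ^+ n) ->
  exists l, forall n, `|u n - l| <= 2 * e * 2^-1 ^+ n.
Proof.
move=> ue; pose d n : R := 2 * e * 2^-1 ^+ n.
have dS n : d n.+1 = d n - e * 2^-1 ^+ n by rewrite /d exprS; field.
have lo n m : (n <= m)%N -> u n - d n <= u m - d m /\ u m + d m <= u n + d n.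
  elim: m => [|m IH]; first by rewrite leqn0 => /eqP ->.
  rewrite leq_eqVlt => /predU1P[->//|/IH[]]; have := ue m; rewrite dS ler_norml.
  by move=> /andP[? ?] ? ?; split; lra.
have d0 n : 0 <= d n.
  have := normr_ge0 (u n.+1 - u n) => /le_trans/(_ (ue n)); rewrite /d; lra.
have ab n m : u n - d n <= u m + d m.
  have [/lo[? ?]|/ltnW/lo[? ?]] := leqP n m; have := d0 n; have := d0 m; lra.
pose A : set R := range (fun n => u n - d n).
have supA : has_sup A.
  split; first by exists (u 0%N - d 0%N); exists 0%N.
  by exists (u 0%N + d 0%N) => _ [n _ <-].
exists (sup A) => n; rewrite -/(d n) distrC ler_distl; apply/andP; split.
  by apply: ub_le_sup; [exact: supA.2|exists n].
by apply: ge_sup => [|_ [m _ <-]]; [exact: supA.1|].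
Qed.

Lemma lip_cst p q (c : R) : lip p q 0 (fun=> c).
Proof. by move=> ? ? _ _; rewrite subrr normr0 mul0r. Qed.

Lemma lipW p q K L f : K <= L -> lip p q K f -> lip p q L f.
Proof. by move=> KL fK s t sp tp; rewrite (le_trans (fK _ _ sp tp))// ler_wpM2r. Qed.

Lemma lipD p q K L f g : lip p q K f -> lip p q L g -> lip p q (K + L) (fun x => f x + g x).
Proof.
move=> fK gL s t sp tp; rewrite opprD addrACA mulrDl.
by rewrite (le_trans (ler_normD _ _))// lerD ?fK ?gL.
Qed.

Lemma lipM p q K L M N f g : 0 <= M -> 0 <= N -> lip p q K f -> lip p q L g ->
  (forall x, p <= x <= q -> `|f x| <= M) -> (forall x, p <= x <= q -> `|g x| <= N) ->
  lip p q (K * N + M * L) (fun x => f x * g x).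
Proof.
move=> M0 N0 fK gL fM gN s t sp tp.
have -> : f s * g s - f t * g t = (f s - f t) * g s + f t * (g s - g t) by ring.
rewrite (le_trans (ler_normD _ _))// !normrM mulrDl lerD//.
  by rewrite mulrAC ler_pM ?fK ?gN.
by rewrite -mulrA ler_pM ?gL ?fM.
Qed.

(** Comparing [k] with 0 makes the indefinite integral Lipschitz; comparing it with the constant
    [k s] gives the second-order estimate, as [k] moves by at most L |t - s| between s and t. From
    here on these bounds, valid for s and t in either order, are all that is used of [I]. *)
Lemma stieltjes_integral_bounds p q K (Psi : R -> R) : p < q -> 0 <= K -> lip p q K Psi ->
  exists I : (R -> R) -> R -> R,
  [/\ forall k k' (L L' e s t : R), 0 <= L -> 0 <= L' -> lip p q L k -> lip p q L' k' ->
       p <= s <= q -> p <= t <= q -> (forall x, p <= x <= q -> `|k x - k' x| <= e) ->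
       `|(I k t - I k s) - (I k' t - I k' s)| <= K * e * `|t - s|,
      forall k (L M s t : R), 0 <= L -> lip p q L k ->
       (forall x, p <= x <= q -> `|k x| <= M) ->
       p <= s <= q -> p <= t <= q -> `|I k t - I k s| <= K * M * `|t - s| &
      forall k (L s t : R), 0 <= L -> lip p q L k -> p <= s <= q -> p <= t <= q ->
       `|I k t - I k s - k s * (Psi t - Psi s)| <= K * L * (t - s) ^+ 2].
Proof.
move=> pq K0 PsiK; have [I [IB IC]] := stieltjes_integral pq K0 PsiK.
have IB' k k' (L L' e s t : R) : 0 <= L -> 0 <= L' -> lip p q L k -> lip p q L' k' ->
    p <= s <= q -> p <= t <= q -> (forall x, p <= x <= q -> `|k x - k' x| <= e) ->
    `|(I k t - I k s) - (I k' t - I k' s)| <= K * e * `|t - s|.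
  move=> L0 L'0 kL k'L sp tp kk'; have [st|/ltW ts] := leP s t.
    rewrite (@ger0_norm _ (t - s)) ?subr_ge0//; apply: (IB k k' L L') => //; try lra.
    by move=> x ?; apply: kk'; lra.
  have -> : I k t - I k s - (I k' t - I k' s) = - (I k s - I k t - (I k' s - I k' t)) by ring.
  rewrite normrN.
  rewrite (@ler0_norm _ (t - s)) ?subr_le0// (opprB t s); apply: (IB k k' L L') => //; try lra.
  by move=> x ?; apply: kk'; lra.
have IC' (c s t : R) : p <= s <= q -> p <= t <= q ->
    I (fun=> c) t - I (fun=> c) s = c * (Psi t - Psi s).
  move=> sp tp; have [st|/ltW ts] := leP s t; first by rewrite IC//; lra.
  have -> : I (fun=> c) t - I (fun=> c) s = - (I (fun=> c) s - I (fun=> c) t) by ring.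
  by rewrite IC; [ring|lra..].
exists I; split=> //.
  move=> k L M s t L0 kL kM sp tp.
  have := IB' k (fun=> 0) L 0 M s t L0 (lexx 0) kL (@lip_cst p q 0) sp tp.
  by rewrite IC'// mul0r subr0; apply=> x xp; rewrite subr0 kM.
move=> k L s t L0 kL sp tp; rewrite -(IC' _ s t)//.
have -> : K * L * (t - s) ^+ 2 = K * (L * `|t - s|) * `|t - s|.
  by rewrite mulrA -!mulrA -expr2 real_normK ?num_real.
have [st|/ltW ts] := leP s t.
  rewrite [X in _ * X]ger0_norm ?subr_ge0//.
  apply: (IB k (fun=> k s) L 0) => //; [exact: lip_cst|lra|lra|].
  move=> x ?; apply: (le_trans (kL _ _ _ _)); try lra.
  by rewrite ler_wpM2l// !ger0_norm; lra.
have -> : I k t - I k s - (I (fun=> k s) t - I (fun=> k s) s)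
  = - (I k s - I k t - (I (fun=> k s) s - I (fun=> k s) t)) by ring.
rewrite normrN.
rewrite [X in _ * X]ler0_norm ?subr_le0// (opprB t s).
apply: (IB k (fun=> k s) L 0) => //; [exact: lip_cst|lra|lra|].
move=> x ?; apply: (le_trans (kL _ _ _ _)); try lra.
by rewrite ler_wpM2l// !ler0_norm; lra.
Qed.

(** The increment estimate stands for the equation dJ(i :: w) = J(w) dPsi_i. It keeps its form under
    composition with a Lipschitz map, whereas a derivative known almost everywhere on the line says
    nothing when the inner map lingers on the exceptional null set. *)
Lemma iterated_integral_along p q K (Psi1 Psi2 : R -> R) s0 : p < q -> 0 <= K ->
  lip p q K Psi1 -> lip p q K Psi2 -> p <= s0 <= q ->
  exists J : seq bool -> R -> R, (forall s, J [::] s = 1) /\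
    forall w, (exists2 L, 0 <= L & lip p q L (J w)) /\
      forall i, J (i :: w) s0 = 0 /\
        exists C : R, forall s t, p <= s <= q -> p <= t <= q ->
        `|J (i :: w) t - J (i :: w) s
          - J w s * ((if i then Psi2 else Psi1) t - (if i then Psi2 else Psi1) s)|
        <= C * (t - s) ^+ 2.
Proof.
move=> pq K0 P1 P2 s0p; have pq' := ltW pq.
have [I1 [_ I1b I1c]] := stieltjes_integral_bounds pq K0 P1.
have [I2 [_ I2b I2c]] := stieltjes_integral_bounds pq K0 P2.
pose J := fix J (w : seq bool) (s : R) : R :=
  if w is i :: w' then (if i then I2 else I1) (J w') s - (if i then I2 else I1) (J w') s0 else 1.
exists J; split=> //.
have JL w : exists2 L, 0 <= L & lip p q L (J w).
  elim: w => [|i w [L L0 JL]]; first by exists 0 => //; exact: lip_cst.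
  have [M M0 JM] := lip_bounded pq' L0 JL.
  exists (K * M); first exact: mulr_ge0.
  move=> s t sp tp /=; rewrite opprB addrA subrK.
  by case: i; [exact: (I2b _ L)|exact: (I1b _ L)].
move=> w; split=> // i; split; first by rewrite /= subrr.
have [L L0 Jw] := JL w; exists (K * L) => s t sp tp /=.
rewrite opprB [X in X - _](addrA) subrK.
by case: i; [exact: I2c|exact: I1c].
Qed.

(** Picard iteration, with e = |v0| <= 1. On functions bounded by 2 e the map [T] has values of
    slope at most K (4 e^2 + 8 e^3) <= 12 K e^2, hence within e of v0, and it contracts by the
    factor K (4 e + 12 e^2) (q - p) <= 16 K e (q - p) <= 1/2. This is the origin of the constant
    32. *)
Lemma abel_along p q K (Psi1 Psi2 : R -> R) s0 (v0 : R) : p < q -> 0 <= K ->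
  lip p q K Psi1 -> lip p q K Psi2 -> p <= s0 <= q ->
  `|v0| <= 1 -> 32 * K * (q - p) * `|v0| <= 1 ->
  exists W : R -> R,
    [/\ W s0 = v0, forall s, p <= s <= q -> `|W s| <= 2 * `|v0|,
        lip p q (12 * K * `|v0| ^+ 2) W &
        exists C : R, forall s t, p <= s <= q -> p <= t <= q ->
        `|W t - W s - (W s ^+ 2 * (Psi1 t - Psi1 s) + W s ^+ 3 * (Psi2 t - Psi2 s))|
        <= C * (t - s) ^+ 2].
Proof.
move=> pq K0 P1 P2 s0p; set e := `|v0| => e1 Ke; have pq' := ltW pq.
have e0 : 0 <= e := normr_ge0 v0.
have [I1 [I1a I1b I1c]] := stieltjes_integral_bounds pq K0 P1.
have [I2 [I2a I2b I2c]] := stieltjes_integral_bounds pq K0 P2.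
pose T W s := v0 + (I1 (fun x => W x ^+ 2) s - I1 (fun x => W x ^+ 2) s0) +
                   (I2 (fun x => W x ^+ 3) s - I2 (fun x => W x ^+ 3) s0).
(* The constant [L] is free because [T W] has the Lipschitz constant 12 K e^2 whatever that of [W]
   is; all iterates and their limit share it. *)
pose good L W := 0 <= L /\ lip p q L W /\ forall s, p <= s <= q -> `|W s| <= 2 * e.
have sq2 L W : good L W ->
    [/\ 0 <= 4 * e * L, lip p q (4 * e * L) (fun x => W x ^+ 2) &
        forall s, p <= s <= q -> `|W s ^+ 2| <= 4 * e ^+ 2].
  move=> [L0 [WL WM]]; split; first by rewrite !mulr_ge0.
    have -> : 4 * e * L = L * (2 * e) + (2 * e) * L by ring.
    by apply: lipM => //; rewrite mulr_ge0.
  move=> s sp; rewrite normrX; have := WM s sp; have := normr_ge0 (W s); nra.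
have cu3 L W : good L W ->
    [/\ 0 <= 12 * e ^+ 2 * L, lip p q (12 * e ^+ 2 * L) (fun x => W x ^+ 3) &
        forall s, p <= s <= q -> `|W s ^+ 3| <= 8 * e ^+ 3].
  move=> gW; have [L0 [WL WM]] := gW; have [L0' WL2 WM2] := sq2 _ _ gW.
  split; first by rewrite !mulr_ge0// exprn_ge0.
    have -> : 12 * e ^+ 2 * L = L * (4 * e ^+ 2) + (2 * e) * (4 * e * L) by ring.
    by apply: lipM => //; rewrite mulr_ge0// exprn_ge0.
  move=> s sp; rewrite exprS normrM.
  have -> : 8 * e ^+ 3 = (2 * e) * (4 * e ^+ 2) by ring.
  by rewrite ler_pM ?WM ?WM2.
have TB L W s t : good L W -> p <= s <= q -> p <= t <= q ->
    `|T W t - T W s| <= 12 * K * e ^+ 2 * `|t - s|.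
  move=> gW sp tp; have [L2 WL2 WM2] := sq2 _ _ gW; have [L3 WL3 WM3] := cu3 _ _ gW.
  have -> : T W t - T W s = (I1 (fun x => W x ^+ 2) t - I1 (fun x => W x ^+ 2) s) +
     (I2 (fun x => W x ^+ 3) t - I2 (fun x => W x ^+ 3) s) by rewrite /T; ring.
  rewrite (le_trans (ler_normD _ _))//.
  have H1 := I1b _ _ _ s t L2 WL2 WM2 sp tp; have H2 := I2b _ _ _ s t L3 WL3 WM3 sp tp.
  apply: (le_trans (lerD H1 H2)); rewrite -mulrDl ler_wpM2r// -mulrDr.
  have -> : 12 * K * e ^+ 2 = K * (12 * e ^+ 2) by ring.
  have He : 0 <= e ^+ 2 * (1 - e) by rewrite mulr_ge0 ?exprn_ge0 ?subr_ge0.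
  by rewrite ler_wpM2l//; clear -He; lra.
have TL L W : good L W -> lip p q (12 * K * e ^+ 2) (T W).
  by move=> gW s t sp tp; rewrite (TB L).
have L0 : 0 <= 12 * K * e ^+ 2 by rewrite !mulr_ge0 ?exprn_ge0.
have Ts0 W : T W s0 = v0 by rewrite /T !subrr !addr0.
have dpq s t : p <= s <= q -> p <= t <= q -> `|t - s| <= q - p.
  by move=> ? ?; rewrite ler_norml; lra.
have Tv0 L W s : good L W -> p <= s <= q -> `|T W s - v0| <= e.
  move=> gW sp; rewrite -(Ts0 W); apply: (le_trans (TB _ _ _ _ gW s0p sp)).
  apply: (@le_trans _ _ (12 * K * e ^+ 2 * (q - p))).
    by rewrite ler_wpM2l// dpq.
  have : 0 <= e * (1 - 32 * K * (q - p) * e) by rewrite mulr_ge0 ?subr_ge0.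
  have : 0 <= K * e ^+ 2 * (q - p) by rewrite !mulr_ge0 ?exprn_ge0 ?subr_ge0.
  by clear; lra.
have Tg L W : good L W -> good (12 * K * e ^+ 2) (T W).
  move=> gW; split=> //; split; first exact: TL gW.
  move=> s sp; have := Tv0 _ _ s gW sp; have : `|v0| = e by [].
  by have := ler_normD (T W s - v0) v0; rewrite subrK; clear; lra.
have Tc L L' W V (d : R) : good L W -> good L' V -> (forall s, p <= s <= q -> `|W s - V s| <= d) ->
    forall s, p <= s <= q -> `|T W s - T V s| <= d / 2.
  move=> gW gV WVd s sp.
  have d0 : 0 <= d := le_trans (normr_ge0 _) (WVd _ s0p).
  have [_ [_ WM]] := gW; have [_ [_ VM]] := gV.
  have [W20 WL2 WM2] := sq2 _ _ gW; have [W30 WL3 WM3] := cu3 _ _ gW.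
  have [V20 VL2 VM2] := sq2 _ _ gV; have [V30 VL3 VM3] := cu3 _ _ gV.
  have d2 x : p <= x <= q -> `|W x ^+ 2 - V x ^+ 2| <= 4 * e * d.
    move=> xp; have -> : W x ^+ 2 - V x ^+ 2 = (W x + V x) * (W x - V x) by ring.
    rewrite normrM ler_pM// ?WVd//; have := ler_normD (W x) (V x).
    by have := WM x xp; have := VM x xp; clear; lra.
  have d3 x : p <= x <= q -> `|W x ^+ 3 - V x ^+ 3| <= 12 * e ^+ 2 * d.
    move=> xp.
    have -> : W x ^+ 3 - V x ^+ 3 = W x * (W x ^+ 2 - V x ^+ 2) + V x ^+ 2 * (W x - V x) by ring.
    have -> : 12 * e ^+ 2 * d = (2 * e) * (4 * e * d) + (4 * e ^+ 2) * d by ring.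
    rewrite (le_trans (ler_normD _ _))// lerD//; first by rewrite normrM ler_pM ?WM ?d2.
    by rewrite normrM ler_pM ?VM2 ?WVd.
  have H1 := I1a _ _ _ _ _ s0 s W20 V20 WL2 VL2 s0p sp d2.
  have H2 := I2a _ _ _ _ _ s0 s W30 V30 WL3 VL3 s0p sp d3.
  have -> : T W s - T V s =
    (I1 (fun x => W x ^+ 2) s - I1 (fun x => W x ^+ 2) s0 -
     (I1 (fun x => V x ^+ 2) s - I1 (fun x => V x ^+ 2) s0)) +
    (I2 (fun x => W x ^+ 3) s - I2 (fun x => W x ^+ 3) s0 -
     (I2 (fun x => V x ^+ 3) s - I2 (fun x => V x ^+ 3) s0)) by rewrite /T; ring.
  rewrite (le_trans (ler_normD _ _))//; apply: (le_trans (lerD H1 H2)).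
  rewrite -mulrDl -mulrDr.
  apply: (@le_trans _ _ (K * (4 * e * d + 12 * e ^+ 2 * d) * (q - p))).
    by rewrite ler_wpM2l ?dpq// mulr_ge0// addr_ge0// !mulr_ge0// exprn_ge0.
  have : 0 <= d * (1 - 32 * K * (q - p) * e) by rewrite mulr_ge0 ?subr_ge0.
  have : 0 <= K * (q - p) * d * e * (1 - e) by rewrite !mulr_ge0 ?subr_ge0.
  by clear; lra.
pose W := fix W n := if n is n'.+1 then T (W n') else (fun=> v0).
have g0 : good (12 * K * e ^+ 2) (W 0%N).
  split=> //; split; first by apply: (lipW L0); exact: lip_cst.
  by move=> s _ /=; rewrite -/e; clear -e0; lra.
have gW n : good (12 * K * e ^+ 2) (W n) by elim: n => // n /Tg.
have WS n s : p <= s <= q -> `|W n.+1 s - W n s| <= e * 2^-1 ^+ n.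
  elim: n s => [|n IH] s sp; first by rewrite expr0 mulr1; exact: Tv0 g0 sp.
  have := Tc _ _ _ _ _ (gW n.+1) (gW n) IH s sp.
  by rewrite exprSr mulrA.
have /choice[V VE] : forall s, exists l, p <= s <= q -> forall n, `|W n s - l| <= 2 * e * 2^-1 ^+ n.
  move=> s; have [sp|sp] := pselect (p <= s <= q); last by exists 0.
  by have [l lE] := geometric_limit (fun n => WS n s sp); exists l.
have VL : lip p q (12 * K * e ^+ 2) V.
  move=> s t sp tp; apply: (@geometric_ler _ _ (4 * e)) => n.
  have [_ [/(_ s t sp tp) WL _]] := gW n; have := VE s sp n; have := VE t tp n.
  rewrite !ler_norml => /andP[h1 h2] /andP[h3 h4]; move: WL; rewrite ler_norml => /andP[h5 h6].
  by clear -h1 h2 h3 h4 h5 h6; apply/andP; split; lra.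
have VM s : p <= s <= q -> `|V s| <= 2 * e.
  move=> sp; apply: (@geometric_ler _ _ (2 * e)) => n.
  have [_ [_ /(_ s sp) WM]] := gW n; have := VE s sp n.
  by have := ler_normB (W n s) (W n s - V s); rewrite subKr; clear -WM; lra.
have gV : good (12 * K * e ^+ 2) V by [].
have VT s : p <= s <= q -> T V s = V s.
  move=> sp; apply/eqP; rewrite -subr_eq0 -normr_le0.
  apply: (@geometric_ler _ _ (2 * e)) => n; rewrite add0r.
  have VE' x : p <= x <= q -> `|V x - W n x| <= 2 * e * 2^-1 ^+ n.
    by move=> xp; rewrite distrC; exact: VE.
  have H := Tc _ _ _ _ _ gV (gW n) VE' s sp.
  have := VE s sp n.+1; rewrite exprS /= => H'.
  have := ler_normD (T V s - T (W n) s) (T (W n) s - V s).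
  by rewrite subrKA; clear -H H'; lra.
exists V; split=> //; first by rewrite -VT// Ts0.
have [V20 VL2 VM2] := sq2 _ _ gV; have [V30 VL3 VM3] := cu3 _ _ gV.
eexists => s t sp tp.
have H1 := I1c _ _ s t V20 VL2 sp tp; have H2 := I2c _ _ s t V30 VL3 sp tp.
rewrite -(VT t tp) -[X in _ - X - _](VT s sp) /T.
set i1t := I1 _ t in H1 *; set i1s := I1 _ s in H1 *; set i10 := I1 _ s0.
set i2t := I2 _ t in H2 *; set i2s := I2 _ s in H2 *; set i20 := I2 _ s0.
have -> : v0 + (i1t - i10) + (i2t - i20) - (v0 + (i1s - i10) + (i2s - i20)) -
  (V s ^+ 2 * (Psi1 t - Psi1 s) + V s ^+ 3 * (Psi2 t - Psi2 s)) =
  (i1t - i1s - V s ^+ 2 * (Psi1 t - Psi1 s)) + (i2t - i2s - V s ^+ 3 * (Psi2 t - Psi2 s)) by ring.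
rewrite (le_trans (ler_normD _ _))//; apply: (le_trans (lerD H1 H2)).
by rewrite -mulrDl.
Qed.

End ControlledIntegral.

(** * Solutions of the Abel equation: uniqueness and the area condition *)

Section AbelSolutions.
Context {R : realType}.
Notation mu := (@lebesgue_measure R).
Implicit Types (a b p q s t x y K L : R) (f g v : R -> R).

(** The quadratic remainder disappears in the limit, so [y] is differentiable wherever both driving
    functions are. This is the passage from increment estimates back to almost everywhere
    derivatives. *)
Lemma is_derive_of_estimate (f1 f2 y : R -> R) (t c1 c2 d1 d2 C r : R) : 0 < r ->
  (forall s : R, `|s - t| < r ->
     `|y s - y t - (c1 * (f1 s - f1 t) + c2 * (f2 s - f2 t))| <= C * (s - t) ^+ 2) ->
  is_derive t 1 f1 d1 -> is_derive t 1 f2 d2 ->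
  is_derive t 1 y (c1 * d1 + c2 * d2).
Proof.
move=> r0 Hy /is_deriveP H1 /is_deriveP H2; apply/is_deriveP => e e0.
pose M := `|c1| + `|c2| + `|C| + 1.
have M0 : 0 < M by have := normr_ge0 c1; have := normr_ge0 c2; have := normr_ge0 C; rewrite /M; lra.
have e'0 : 0 < e / M by rewrite divr_gt0.
have [r1 r10 Hr1] := H1 _ e'0; have [r2 r20 Hr2] := H2 _ e'0.
exists (Num.min (Num.min r (e / M)) (Num.min r1 r2)); first by rewrite !lt_min r0 e'0 r10.
move=> s; rewrite !lt_min => /andP[/andP[sr se] /andP[sr1 sr2]].
have := Hy s sr; have := Hr1 s sr1; have := Hr2 s sr2.
set u1 := f1 s - f1 t - _; set u2 := f2 s - f2 t - _; set u := y s - y t - (_ + _) => h2 h1 h.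
have -> : y s - y t - (c1 * d1 + c2 * d2) * (s - t) = u + (c1 * u1 + c2 * u2).
  by rewrite /u /u1 /u2; ring.
have n0 := normr_ge0 (s - t).
have hC : C * (s - t) ^+ 2 <= `|C| * (e / M * `|s - t|).
  rewrite (le_trans (ler_norm _))// normrM ler_wpM2l// normrX expr2 ler_wpM2r//.
  exact: ltW.
have hc1 : `|c1 * u1| <= `|c1| * (e / M * `|s - t|) by rewrite normrM ler_wpM2l.
have hc2 : `|c2 * u2| <= `|c2| * (e / M * `|s - t|) by rewrite normrM ler_wpM2l.
apply: (@le_trans _ _ ((`|c1| + `|c2| + `|C|) * (e / M * `|s - t|))).
  have := ler_normD u (c1 * u1 + c2 * u2); have := ler_normD (c1 * u1) (c2 * u2).
  by rewrite !mulrDl; clear -h hC hc1 hc2; lra.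
have -> : e * `|s - t| = M * (e / M * `|s - t|).
  by rewrite mulrA [M * _]mulrC divfK// gt_eqF.
rewrite ler_wpM2r//; last by rewrite /M lerDl ler01.
by apply: mulr_ge0 => //; exact: ltW.
Qed.

Lemma abel_solution_of_estimate a b K L (f1 f2 v : R -> R) (C : R) : a < b -> 0 <= K ->
  lip a b K f1 -> lip a b K f2 -> lip a b L v ->
  (forall s t, a <= s <= b -> a <= t <= b ->
   `|v t - v s - (v s ^+ 2 * (f1 t - f1 s) + v s ^+ 3 * (f2 t - f2 s))| <= C * (t - s) ^+ 2) ->
  abel_solution a b f1 f2 v.
Proof.
move=> ab K0 fK1 fK2 vL Hv; split; first exact: lip_lipschitz vL.
have := lip_ae_derive1 ab K0 fK2; have := lip_ae_derive1 ab K0 fK1.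
apply: filterS2; first exact: (ae_filter_ringOfSetsType mu).
move=> t H1 H2 tab; have d1 := H1 tab; have d2 := H2 tab.
rewrite mulrC [X in _ + X]mulrC.
move: tab; rewrite in_itv/= => /andP[ta tb].
apply: (@is_derive_of_estimate f1 f2 v t _ _ _ _ C (Num.min (t - a) (b - t))) => //.
  by rewrite lt_min; lra.
move=> s; rewrite lt_min !ltr_norml => /andP[/andP[? ?] /andP[? ?]].
by apply: Hv; lra.
Qed.

Lemma lip_mul a b K L f g : a <= b -> 0 <= K -> 0 <= L -> lip a b K f -> lip a b L g ->
  exists2 M, 0 <= M & lip a b M (fun x => f x * g x).
Proof.
move=> ab K0 L0 fK gL; have [M M0 fM] := lip_bounded ab K0 fK.
have [N N0 gN] := lip_bounded ab L0 gL; exists (K * N + M * L).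
  by rewrite addr_ge0// mulr_ge0.
exact: lipM.
Qed.

Lemma lip_exp a b (c : R) : 0 <= c -> a <= b ->
  lip a b (c * expR (- (c * a))) (fun t => expR (- (c * t))).
Proof.
move=> c0 ab; suff H s t : a <= s -> s <= t ->
    0 <= expR (- (c * s)) - expR (- (c * t)) <= c * expR (- (c * a)) * (t - s).
  move=> s t sp tp; have [st|/ltW ts] := leP s t.
    have := H s t; rewrite (@ler0_norm _ (s - t)) ?subr_le0// opprB => /(_ ltac:(lra) st).
    by move=> /andP[? ?]; rewrite ger0_norm.
  have := H t s; rewrite (@ger0_norm _ (s - t)) ?subr_ge0// => /(_ ltac:(lra) ts).
  by move=> /andP[? ?]; rewrite distrC ger0_norm ?subr_ge0.
move=> as_ st; apply/andP; split.
  by rewrite subr_ge0 ler_expR lerN2 ler_wpM2l.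
have -> : - (c * t) = - (c * s) + - (c * (t - s)) by ring.
rewrite expRD -{1}[expR (- (c * s))]mulr1 -mulrBr.
have h1 : 1 - expR (- (c * (t - s))) <= c * (t - s) by have := expR_ge1Dx (- (c * (t - s))); lra.
have h2 : expR (- (c * s)) <= expR (- (c * a)) by rewrite ler_expR lerN2 ler_wpM2l.
rewrite mulrAC [leRHS]mulrC; apply: (le_trans (ler_wpM2l (expR_ge0 _) h1)).
by rewrite ler_wpM2r// mulr_ge0// subr_ge0.
Qed.

(** Gronwall's argument: factoring v^2 - w^2 and v^3 - w^3 shows that d = v - w satisfies d' = m d
    almost everywhere, with |m| <= c / 2. Hence d^2 exp(-c t) is nonincreasing, and it vanishes at
    a. *)
Lemma abel_solution_unique a b K (f1 f2 v w : R -> R) : a < b -> 0 <= K ->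
  lip a b K f1 -> lip a b K f2 ->
  abel_solution a b f1 f2 v -> abel_solution a b f1 f2 w -> v a = w a ->
  forall t, a <= t <= b -> v t = w t.
Proof.
move=> ab K0 fK1 fK2 [/lipschitz_lip[L L0 vL] vE] [/lipschitz_lip[M M0 wM] wE] vwa.
have ab' := ltW ab.
have [V V0 vV] := lip_bounded ab' L0 vL; have [W W0 wW] := lip_bounded ab' M0 wM.
pose c := 2 * (K * (V + W) + K * (V ^+ 2 + V * W + W ^+ 2)).
have c0 : 0 <= c by rewrite /c !(mulr_ge0, addr_ge0, exprn_ge0).
pose d t := v t - w t.
have dL : lip a b (L + M) d.
  move=> s t sp tp; have := vL s t sp tp; have := wM s t sp tp; rewrite /d mulrDl.
  have -> : v s - w s - (v t - w t) = (v s - v t) - (w s - w t) by ring.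
  by have := ler_normB (v s - v t) (w s - w t); lra.
have LM0 : 0 <= L + M by exact: addr_ge0.
have [D D0 dD] := lip_mul ab' LM0 LM0 dL dL.
pose E t := expR (- (c * t)).
have EL := lip_exp c0 ab'.
have cE0 : 0 <= c * expR (- (c * a)) by rewrite mulr_ge0// expR_ge0.
have [G G0 GL] := lip_mul ab' D0 cE0 dD EL.
pose m t := derive1 f1 t * (v t + w t) + derive1 f2 t * (v t ^+ 2 + v t * w t + w t ^+ 2).
have dE : {ae mu, forall t, t \in `]a, b[ ->
   is_derive t 1 (fun x => d x * d x * expR (- (c * x))) (d t ^+ 2 * E t * (2 * m t - c)) /\
   d t ^+ 2 * E t * (2 * m t - c) <= 0}.
  have d1 := lip_ae_derive1 ab K0 fK1; have d2 := lip_ae_derive1 ab K0 fK2.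
  have FF := ae_filter_ringOfSetsType mu.
  have H12 := @filterI _ _ FF _ _ vE wE; have H34 := @filterI _ _ FF _ _ d1 d2.
  move: H12 H34; apply: filterS2 => t [Hv Hw] [H1 H2] tab.
  have dv := Hv tab; have dw := Hw tab; have df1 := H1 tab; have df2 := H2 tab.
  move: tab; rewrite in_itv/= => tab.
  have tab' : a <= t <= b by clear -tab; lra.
  split; last first.
    rewrite mulr_ge0_le0//; first by rewrite mulr_ge0 ?sqr_ge0 ?expR_ge0.
    have k1 := lip_derive_bound fK1 tab df1; have k2 := lip_derive_bound fK2 tab df2.
    have vt := vV _ tab'; have wt := wW _ tab'.
    suff : `|m t| <= c / 2 by move=> /ler_normlW; clear; lra.
    rewrite /m /c [2 * _]mulrC mulfK; last by rewrite pnatr_eq0.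
    rewrite (le_trans (ler_normD _ _))// !normrM lerD// ler_pM//.
      by rewrite (le_trans (ler_normD _ _))// lerD.
    rewrite (le_trans (ler_normD _ _))// lerD//; last by rewrite normrX lerXn2r ?nnegrE.
    rewrite (le_trans (ler_normD _ _))// lerD//; first by rewrite normrX lerXn2r ?nnegrE.
    by rewrite normrM ler_pM.
  have dd : is_derive t 1 d (d t * m t).
    have H := is_deriveB dv dw; apply: (is_derive_eq H).
    by rewrite /d /m; ring.
  have dEx : is_derive t 1 (fun x => expR (- (c * x))) (- c * expR (- (c * t))).
    have H0 : is_derive t 1 (fun x : R => - (c * x)) (- c).
      apply/is_deriveP => e e0; exists 1 => // s _.
      by rewrite (_ : _ - _ - _ = 0) ?normr0 ?mulr_ge0 ?(ltW e0)//; ring.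
    have H := @is_derive1_comp R expR (fun x => - (c * x)) t _ _ (is_derive_expR _) H0.
    by apply: (is_derive_eq H); rewrite mulrC.
  have H := is_deriveM (is_deriveM dd dd) dEx; apply: (is_derive_eq H).
  have -> : (d * d) t = d t * d t by [].
  by rewrite /E /GRing.scale /=; ring.
move=> t tab; apply/eqP; rewrite -subr_eq0 -/(d t) -sqrf_eq0 eq_le sqr_ge0 andbT.
have := lip_nonincreasing ab G0 GL dE tab.
rewrite {3 4}/d vwa subrr !mul0r -expr2.
by rewrite pmulr_lle0// expR_gt0.
Qed.

Lemma lip_total_bound a b K (f u : R -> R) (m : R) : a < b -> 0 <= K -> 0 <= m -> lip a b K f ->
  {ae mu, forall t, t \in `]a, b[ -> is_derive t 1 f (u t) /\ `|u t| <= m} ->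
  forall t, a <= t <= b -> `|f t - f a| <= m * (b - a).
Proof.
move=> ab K0 m0 fK fu t tab.
have lin (c : R) : lip a b `|c| (fun x => c * x).
  by move=> x y _ _; rewrite -mulrBr normrM.
have dlin (c x : R) : is_derive x 1 (fun x : R => c * x) c.
  apply/is_deriveP => e e0; exists 1 => // s _.
  by rewrite (_ : _ - _ - _ = 0) ?normr0 ?mulr_ge0 ?(ltW e0)//; ring.
have Nf : lip a b K (fun x => - f x).
  by move=> x y xab yab; rewrite -opprD normrN; exact: fK.
have KM : 0 <= K + `|- m| by rewrite addr_ge0.
have H1 : f t + - m * t <= f a + - m * a.
  apply: (@lip_nonincreasing _ a b _ _ (fun t => u t + - m) ab KM (lipD fK (lin (- m))) _ _ tab).
  move: fu; apply: filterS; first exact: (ae_filter_ringOfSetsType mu).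
  move=> x H /H[du /ler_normlW um]; split; last by lra.
  by have := is_deriveD du (dlin (- m) x).
have H2 : - f t + - m * t <= - f a + - m * a.
  apply: (@lip_nonincreasing _ a b _ _ (fun t => - u t + - m) ab KM (lipD Nf (lin (- m))) _ _ tab).
  move: fu; apply: filterS; first exact: (ae_filter_ringOfSetsType mu).
  move=> x H /H[du]; rewrite ler_norml => /andP[um _]; split; last by lra.
  by have := is_deriveD (is_deriveN du) (dlin (- m) x).
have : m * (t - a) <= m * (b - a) by rewrite ler_wpM2l//; lra.
by rewrite ler_norml; lra.
Qed.

(** The second-order estimate serves the Riemann sums of x dy; the almost everywhere derivative
    serves the expansion of 1/v. *)
Lemma area_primitive a b K (f1 f2 : R -> R) : a < b -> 0 <= K ->
  lip a b K f1 -> lip a b K f2 ->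
  exists Q : R -> R, exists C : R, [/\ 0 <= C,
    forall s t, a <= s <= b -> a <= t <= b ->
      `|Q t - Q s - f1 s * (f2 t - f2 s)| <= C * (t - s) ^+ 2,
    lip a b C Q,
    {ae mu, forall t, t \in `]a, b[ -> is_derive t 1 Q (f1 t * derive1 f2 t)} &
    \int[mu]_(t in `[a, b]) (f1 t * derive1 f2 t) = Q b - Q a].
Proof.
move=> ab K0 fK1 fK2; have ab' := ltW ab.
have d2 := lip_ae_derive1 ab K0 fK2.
have [I [_ Ib Ic]] := stieltjes_integral_bounds ab K0 fK2.
have [M M0 f1M] := lip_bounded ab' K0 fK1.
have KM0 : 0 <= K * M by exact: mulr_ge0.
have KK0 : 0 <= K * K by exact: mulr_ge0.
have QL : lip a b (K * M) (I f1) by move=> s t sp tp; apply: (Ib f1 K).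
have dQ : {ae mu, forall t, t \in `]a, b[ -> is_derive t 1 (I f1) (f1 t * derive1 f2 t)}.
  move: d2; apply: filterS; first exact: (ae_filter_ringOfSetsType mu).
  move=> t H tab; have df2 := H tab.
  move: tab; rewrite in_itv/= => /andP[ta tb].
  have := @is_derive_of_estimate f2 f2 (I f1) t (f1 t) 0 _ _ (K * K) (Num.min (t - a) (b - t)) _ _ df2 df2.
  rewrite mul0r addr0; apply; first by rewrite lt_min; lra.
  move=> s; rewrite lt_min !ltr_norml => /andP[/andP[? ?] /andP[? ?]].
  by rewrite mul0r addr0; apply: (Ic f1 K) => //; lra.
exists (I f1), (K * M + K * K); split=> //.
- exact: addr_ge0.
- move=> s t sp tp; apply: (le_trans (Ic f1 K s t K0 fK1 sp tp)).
  by rewrite ler_wpM2r ?sqr_ge0// lerDr.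
- by apply: (lipW _ QL); rewrite lerDl.
by apply: (lip_FTC ab KM0 QL dQ).
Qed.

Lemma abel_center_area a b K (f1 f2 : R -> R) : a < b -> 0 <= K ->
  lip a b K f1 -> lip a b K f2 -> f1 a = 0 -> f2 a = 0 -> f1 b = 0 -> f2 b = 0 ->
  abel_center a b f1 f2 ->
  \int[mu]_(t in `[a, b]) (f1 t * derive1 f2 t) = 0.
Proof.
move=> ab K0 fK1 fK2 f1a f2a f1b f2b [eps eps0 Hc]; have ab' := ltW ab.
have FF := ae_filter_ringOfSetsType mu.
have d1 := lip_ae_derive1 ab K0 fK1; have d2 := lip_ae_derive1 ab K0 fK2.
have [Q [M1 [KM0 _ QL dQ ->]]] := area_primitive ab K0 fK1 fK2.
pose len := b - a.
have len0 : 0 < len by rewrite /len; lra.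
(* C1 e^3 bounds W - e - e^2 f1, whose derivative is f1' (W^2 - e^2) + f2' W^3: here |W - e| <= 12 K
   len e^2 and W + e <= 3 e give the 36, and W <= 2 e gives the 8. *)
pose C1 := K * (36 * K * len + 8) * len.
have C10 : 0 <= C1.
  by rewrite /C1 mulr_ge0 ?(ltW len0)// mulr_ge0// addr_ge0// !mulr_ge0// ltW.
(* The half keeps the initial value strictly below [eps]; the other two bounds are the smallness
   conditions of [abel_along]. *)
pose e0 := Num.min (Num.min (eps / 2) 1) (32 * K * len + 1)^-1.
have Kl : 0 < 32 * K * len + 1 by rewrite ltr_pwDr// !mulr_ge0// ltW.
have e00 : 0 < e0 by rewrite !lt_min invr_gt0 Kl ltr01 andbT andbT divr_gt0.
(* with v the solution starting at e, 1/v + f1 has derivative - f2' v, whence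
   the integral of f2' v vanishes, while v = e + e^2 f1 + O(e^3) *)
have key (e : R) : 0 < e -> e <= e0 -> `|Q b - Q a| <= K * C1 * len * e.
  move=> ep; rewrite /e0 !le_min => /andP[/andP[ee e1] eK].
  have ne : `|e| = e by rewrite gtr0_norm.
  have Ke : 32 * K * (b - a) * `|e| <= 1.
    rewrite ne -/len; have : e * (32 * K * len + 1) <= 1 by rewrite -ler_pdivlMr// div1r.
    by lra.
  have [W [W0 WM WL [C WC]]] : exists W : R -> R,
    [/\ W a = e, forall s, a <= s <= b -> `|W s| <= 2 * `|e|,
        lip a b (12 * K * `|e| ^+ 2) W &
        exists C : R, forall s t, a <= s <= b -> a <= t <= b ->
        `|W t - W s - (W s ^+ 2 * (f1 t - f1 s) + W s ^+ 3 * (f2 t - f2 s))|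
        <= C * (t - s) ^+ 2].
    by apply: abel_along => //; [rewrite lexx|rewrite ne].
  rewrite ne in WM WL; rewrite ne -/len in Ke.
  have sol := abel_solution_of_estimate ab K0 fK1 fK2 WL WC.
  have Wb : W b = e.
    have [|_ Hb] := Hc e; first by rewrite ne; lra.
    by rewrite (Hb W sol)// W0.
  have L0 : 0 <= 12 * K * e ^+ 2 by rewrite !mulr_ge0 ?(ltW ep).
  have Wlow s : a <= s <= b -> `|W s - e| <= 12 * K * len * e ^+ 2 /\ e / 2 <= W s.
    move=> sab; have H : `|W s - e| <= 12 * K * len * e ^+ 2.
      rewrite -W0 (le_trans (WL _ _ sab _)) ?lexx// W0.
      rewrite (_ : 12 * K * len * e ^+ 2 = 12 * K * e ^+ 2 * len); last by ring.
      by rewrite ler_wpM2l// ger0_norm /len; clear -sab; lra.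
    split=> //; move: H; rewrite ler_norml => /andP[H _].
    have : 0 <= e * (1 - 32 * K * len * e) by rewrite mulr_ge0 ?(ltW ep) ?subr_ge0.
    have : 0 <= K * len * e ^+ 2 by rewrite !mulr_ge0 ?(ltW ep) ?(ltW len0).
    by clear -H; lra.
  have Wp s : a <= s <= b -> 0 < W s by move=> /Wlow[_ h]; clear -h ep; lra.
  have dW := sol.2.
  pose r t := - (W t)^-1 - f1 t.
  have iL : lip a b (4 / e ^+ 2 * (12 * K * e ^+ 2)) (fun x => - (W x)^-1).
    move=> s t sab tab; have Ws := Wp _ sab; have Wt := Wp _ tab.
    have -> : - (W s)^-1 - - (W t)^-1 = (W s * W t)^-1 * (W s - W t).
      by field; rewrite !gt_eqF.
    have iW : `|(W s * W t)^-1| <= 4 / e ^+ 2.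
      rewrite gtr0_norm ?invr_gt0 ?mulr_gt0// -[4 / _]invf_div.
      rewrite lef_pV2 ?posrE ?mulr_gt0// ?invr_gt0//.
      by have [_ h1] := Wlow _ sab; have [_ h2] := Wlow _ tab; clear -h1 h2 ep; nra.
    by rewrite normrM -[leRHS]mulrA ler_pM ?WL.
  have i0 : 0 <= 4 / e ^+ 2 * (12 * K * e ^+ 2) by rewrite mulr_ge0// divr_ge0// exprn_ge0// ltW.
  have Nf1 : lip a b K (fun x => - f1 x).
    by move=> x y xab yab; rewrite -opprD normrN; exact: fK1.
  have rL := lipD iL Nf1.
  pose u t := W t + - e ^+ 2 * f1 t.
  have scl c L f : lip a b L f -> lip a b (`|c| * L) (fun x => c * f x).
    by move=> fL s t sab tab; rewrite -mulrBr normrM -mulrA ler_wpM2l ?fL.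
  have uL := lipD WL (scl (- e ^+ 2) _ _ fK1).
  have scl0 (c L : R) : 0 <= L -> 0 <= `|c| * L by move=> ?; rewrite mulr_ge0.
  have uE t : a <= t <= b -> `|u t - e| <= C1 * e ^+ 3.
    move=> tab.
    have -> : e = u a by rewrite /u W0 f1a mulr0 addr0.
    have -> : C1 * u a ^+ 3 = K * (36 * K * len + 8) * e ^+ 3 * (b - a).
      by rewrite {1}/u W0 f1a mulr0 addr0 /C1 -/len; ring.
    apply: (@lip_total_bound a b _ _ (fun t => derive1 f1 t * (W t ^+ 2 - e ^+ 2) +
      derive1 f2 t * W t ^+ 3) _ ab _ _ uL _ _ tab).
    - by rewrite addr_ge0// scl0.
    - by rewrite mulr_ge0 ?exprn_ge0 ?(ltW ep)// mulr_ge0// addr_ge0// !mulr_ge0// ltW.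
    have H := @filterI _ _ FF _ _ d1 d2; move: dW H; apply: filterS2.
    move=> x dWx [dx1 dx2] xab; have dw := dWx xab; have df1 := dx1 xab; have df2 := dx2 xab.
    split.
      have H1 : is_derive x 1 (fun x => - e ^+ 2 * f1 x) (- e ^+ 2 * derive1 f1 x).
        exact: (is_deriveZ (- e ^+ 2) df1).
      by apply: (is_derive_eq (is_deriveD dw H1)); ring.
    move: xab; rewrite in_itv/= => xab; have xab' : a <= x <= b by clear -xab; lra.
    have k1 := lip_derive_bound fK1 xab df1; have k2 := lip_derive_bound fK2 xab df2.
    have [w1 _] := Wlow _ xab'; have w2 := WM _ xab'; have wp := Wp _ xab'.
    rewrite (le_trans (ler_normD _ _))// !normrM -mulrA mulrDl mulrDr lerD// ler_pM//.
      have -> : W x ^+ 2 - e ^+ 2 = (W x - e) * (W x + e) by ring.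
      rewrite normrM (_ : 36 * K * len * e ^+ 3 = 12 * K * len * e ^+ 2 * (3 * e)); last by ring.
      rewrite ler_pM// gtr0_norm ?addr_gt0//; move: w2; rewrite gtr0_norm//; clear; lra.
    rewrite (_ : 8 * e ^+ 3 = (2 * e) ^+ 3); last by ring.
    by rewrite (exprS _ 2) expr2 !ler_pM ?mulr_ge0.
  (* As r' = f2' W, the derivative of [Z] is f2' (W - e - e^2 f1) = f2' (u - e), of order e^3. All
     terms of [Z] except the one in [Q] agree at a and b, so division by e^2 leaves |Q b - Q a| =
     O(e). *)
  pose Z t := (r t + - e * f2 t) + - e ^+ 2 * Q t.
  have ZL := lipD (lipD rL (scl (- e) _ _ fK2)) (scl (- e ^+ 2) _ _ QL).
  have HZ : `|Z b - Z a| <= K * C1 * e ^+ 3 * (b - a).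
    apply: (@lip_total_bound a b _ _ (fun t => derive1 f2 t * (u t - e)) _ ab _ _ ZL).
    - by rewrite !addr_ge0// ?scl0.
    - by rewrite mulr_ge0 ?exprn_ge0 ?(ltW ep)// mulr_ge0.
    - have H := @filterI _ _ FF _ _ d1 d2; have H' := @filterI _ _ FF _ _ dW dQ.
      move: H' H; apply: filterS2.
      move=> x [dWx dQx] [dx1 dx2] xab; have dw := dWx xab; have dq := dQx xab.
      have df1 := dx1 xab; have df2 := dx2 xab.
      have [xab' xab''] : a < x < b /\ a <= x <= b by move: xab; rewrite in_itv/=; clear; lra.
      have W0x : W x != 0 by rewrite gt_eqF// Wp.
      split; last first.
        rewrite normrM -mulrA ler_pM ?uE//; exact: lip_derive_bound fK2 xab' df2.
      have dV := is_deriveN (is_deriveV W0x dw).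
      have H2 : is_derive x 1 (fun x => - e * f2 x) (- e * derive1 f2 x).
        exact: (is_deriveZ (- e) df2).
      have H3 : is_derive x 1 (fun x => - e ^+ 2 * Q x) (- e ^+ 2 * (f1 x * derive1 f2 x)).
        exact: (is_deriveZ (- e ^+ 2) dq).
      apply: (is_derive_eq (is_deriveD (is_deriveD (is_deriveB dV df1) H2) H3)).
      by rewrite /u /GRing.scale/=; field.
    - by rewrite lexx ltW.
  move: HZ; rewrite /Z /r W0 Wb f1a f1b f2a f2b.
  have -> : - e^-1 - 0 + - e * 0 + - e ^+ 2 * Q b - (- e^-1 - 0 + - e * 0 + - e ^+ 2 * Q a) =
    - (e ^+ 2 * (Q b - Q a)) by ring.
  rewrite normrN normrM ger0_norm ?exprn_ge0 ?(ltW ep)// => HZ.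
  by rewrite -(ler_pM2l (exprn_gt0 2 ep)); apply: (le_trans HZ); rewrite /len le_eqVlt; apply/orP; left; apply/eqP; ring.
apply/eqP; rewrite -normr_le0; apply/ler_addgt0Pr => d d0; rewrite add0r.
pose B := K * C1 * len.
have B0 : 0 <= B by rewrite /B mulr_ge0 ?(ltW len0)// mulr_ge0.
pose e := Num.min e0 (d / (B + 1)).
have B1 : 0 < B + 1 by lra.
have e_gt0 : 0 < e by rewrite /e lt_min e00 divr_gt0.
apply: (le_trans (key e e_gt0 _)); first by rewrite ge_min lexx.
have : e * (B + 1) <= d by rewrite -ler_pdivlMr// ge_min lexx orbT.
by rewrite -/B; lra.
Qed.

End AbelSolutions.

(** * Paths that factor through an interval *)

Section TreeLike.
Context {R : realType}.
Notation mu := (@lebesgue_measure R).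
Implicit Types (a b p q s t x y K L : R) (f g h v : R -> R).

(* McShane extension *)
Lemma factor_through_lipschitz a b f h : a <= b ->
  (forall s t, a <= s <= b -> a <= t <= b -> `|f s - f t| <= `|h s - h t|) ->
  exists Psi : R -> R, (forall x y, `|Psi x - Psi y| <= 1 * `|x - y|) /\
    forall t, a <= t <= b -> Psi (h t) = f t.
Proof.
move=> ab fh; pose A x : set R := [set f t + `|x - h t| | t in [set t | a <= t <= b]].
have Alb x t : a <= t <= b -> lbound (A x) (f t - `|h t - x|).
  move=> tab _ [s sab <-]; have := fh _ _ tab sab; have := ler_norm (f t - f s).
  have := ler_distD x (h t) (h s); lra.
have Ai x : has_inf (A x).
  split; first by exists (f a + `|x - h a|); exists a; rewrite //= lexx.
  by exists (f a - `|h a - x|); apply: Alb; rewrite lexx.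
have le x y : inf (A x) - `|x - y| <= inf (A y).
  apply: lb_le_inf; first exact: (Ai y).1.
  move=> _ [t tab <-]; have := ler_distD y x (h t).
  have : inf (A x) <= f t + `|x - h t| by apply: ge_inf; [exact: (Ai x).2|exists t].
  lra.
exists (fun x => inf (A x)); split.
  move=> x y; rewrite mul1r ler_norml; have := le x y; have := le y x.
  by rewrite (distrC y x); lra.
move=> t tab; apply/eqP; rewrite eq_le; apply/andP; split.
  apply: ge_inf; first exact: (Ai _).2.
  by exists t => //; rewrite subrr normr0 addr0.
apply: lb_le_inf; first exact: (Ai _).1.
by have := Alb (h t) t tab; rewrite subrr normr0 subr0.
Qed.

Lemma lip_comp a b p q H L h (W : R -> R) : 0 <= L -> lip a b H h ->
  (forall t, a <= t <= b -> p <= h t <= q) -> lip p q L W ->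
  lip a b (L * H) (fun t => W (h t)).
Proof.
move=> L0 hH hpq WL s t sab tab; rewrite (le_trans (WL _ _ (hpq _ sab) (hpq _ tab)))//.
by rewrite -mulrA ler_wpM2l// hH.
Qed.

Section Center.
Variables (a b H : R) (f1 f2 h : R -> R).
Hypotheses (ab : a < b) (H0 : 0 <= H) (hH : lip a b H h) (hab : h a = h b).
Hypothesis f1h : forall s t, a <= s <= b -> a <= t <= b -> `|f1 s - f1 t| <= `|h s - h t|.
Hypothesis f2h : forall s t, a <= s <= b -> a <= t <= b -> `|f2 s - f2 t| <= `|h s - h t|.

(** [p, q] contains the values of [h]; the summand 1 in [q] keeps p < q when H = 0. *)
Let p := h a - H * (b - a).
Let q := h a + H * (b - a) + 1.

Let hpq t : a <= t <= b -> p <= h t <= q.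
Proof.
move=> tab; have h1 : H * `|t - a| <= H * (b - a) by rewrite ler_wpM2l// ger0_norm; lra.
have := hH tab (_ : a <= a <= b); rewrite lexx ltW// => /(_ isT).
by rewrite ler_norml /p /q => h2; lra.
Qed.

Let pq : p < q.
Proof.
have : 0 <= H * (b - a) by rewrite mulr_ge0// subr_ge0 ltW.
by rewrite /p /q; lra.
Qed.

Let fH f : (forall s t, a <= s <= b -> a <= t <= b -> `|f s - f t| <= `|h s - h t|) ->
  lip a b H f.
Proof. by move=> fh s t sab tab; rewrite (le_trans (fh _ _ sab tab))// hH. Qed.

(** An increment estimate along the line becomes one along [h], the Lipschitz bound of [h] being
    absorbed into the constant as H^2. *)
Let estimate (W k1 k2 Psi1 Psi2 : R -> R) (C : R) :
  (forall t, a <= t <= b -> Psi1 (h t) = f1 t) ->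
  (forall t, a <= t <= b -> Psi2 (h t) = f2 t) ->
  (forall s t, p <= s <= q -> p <= t <= q ->
    `|W t - W s - (k1 s * (Psi1 t - Psi1 s) + k2 s * (Psi2 t - Psi2 s))| <= C * (t - s) ^+ 2) ->
  forall s t, a <= s <= b -> a <= t <= b ->
    `|W (h t) - W (h s) - (k1 (h s) * (f1 t - f1 s) + k2 (h s) * (f2 t - f2 s))|
    <= `|C| * H ^+ 2 * (t - s) ^+ 2.
Proof.
move=> P1 P2 HW s t sab tab; have := HW _ _ (hpq sab) (hpq tab); rewrite !P1 ?P2//.
move=> /le_trans; apply; rewrite (le_trans (ler_norm _))// normrM -mulrA ler_wpM2l//.
rewrite normrX -[X in _ <= _ * X]real_normK ?num_real// -exprMn.
by rewrite lerXn2r ?nnegrE ?mulr_ge0// hH.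
Qed.

Lemma tree_like_center : abel_center a b f1 f2.
Proof.
have [Psi1 [P1L P1]] := factor_through_lipschitz (ltW ab) f1h.
have [Psi2 [P2L P2]] := factor_through_lipschitz (ltW ab) f2h.
have P1L' : lip p q 1 Psi1 by move=> s t _ _; exact: P1L.
have P2L' : lip p q 1 Psi2 by move=> s t _ _; exact: P2L.
have D0 : 0 < 32 * (q - p) + 1 by have := pq; lra.
exists (Num.min 1 (32 * (q - p) + 1)^-1); first by rewrite lt_min ltr01 invr_gt0.
move=> v0; rewrite lt_min => /andP[v1 vD].
have hs : p <= h a <= q by apply: hpq; rewrite lexx ltW.
have vD' : 32 * 1 * (q - p) * `|v0| <= 1.
  have : `|v0| * (32 * (q - p) + 1) <= 1 by rewrite -ler_pdivlMr// div1r ltW.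
  by have := normr_ge0 v0; lra.
have [W [W0 WM WL [C WC]]] := abel_along pq ler01 P1L' P2L' hs (ltW v1) vD'.
have L0 : 0 <= 12 * 1 * `|v0| ^+ 2 by rewrite mulr_ge0// exprn_ge0.
have vL := lip_comp L0 hH hpq WL.
have sol := abel_solution_of_estimate ab H0 (fH f1h) (fH f2h) vL (estimate P1 P2 WC).
split; first by exists (fun t => W (h t)).
move=> v solv va.
have E := abel_solution_unique ab H0 (fH f1h) (fH f2h) solv sol _.
have {}E : forall t, a <= t <= b -> v t = W (h t) by apply: E; rewrite va.
by rewrite va E ?lexx ?ltW// -hab W0.
Qed.

Lemma tree_like_universal : universal_center a b f1 f2.
Proof.
have [Psi1 [P1L P1]] := factor_through_lipschitz (ltW ab) f1h.
have [Psi2 [P2L P2]] := factor_through_lipschitz (ltW ab) f2h.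
have P1L' : lip p q 1 Psi1 by move=> s t _ _; exact: P1L.
have P2L' : lip p q 1 Psi2 by move=> s t _ _; exact: P2L.
have hs : p <= h a <= q by apply: hpq; rewrite lexx ltW.
have [J [J0 JS]] := iterated_integral_along pq ler01 P1L' P2L' hs.
have JE w t : a <= t <= b -> iterated_integral a f1 f2 w t = J w (h t).
  elim: w t => [|i w IH] t tab; first by rewrite J0.
  have [[L L0 JL] Jw] := JS w; have [Js [C JC]] := Jw i.
  have [[M M0 JM] _] := JS (i :: w).
  have uL := lip_comp M0 hH hpq JM.
  pose u s := derive1 (if i then f2 else f1) s * J w (h s).
  have dJ : {ae mu, forall t, t \in `]a, b[ -> is_derive t 1 (fun t => J (i :: w) (h t)) (u t)}.
    have d1 := lip_ae_derive1 ab H0 (fH f1h); have d2 := lip_ae_derive1 ab H0 (fH f2h).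
    move: d1 d2; apply: filterS2; first exact: (ae_filter_ringOfSetsType mu).
    move=> x H1 H2 xab; have dx1 := H1 xab; have dx2 := H2 xab.
    move: xab; rewrite in_itv/= => /andP[ax xb].
    pose c1 (s : R) := if i then 0 else J w s; pose c2 (s : R) := if i then J w s else 0.
    have HC : forall s t, p <= s <= q -> p <= t <= q ->
        `|J (i :: w) t - J (i :: w) s - (c1 s * (Psi1 t - Psi1 s) + c2 s * (Psi2 t - Psi2 s))|
        <= C * (t - s) ^+ 2.
      move=> s' t' sp tp; have := JC _ _ sp tp; rewrite /c1 /c2.
      by case: (i); rewrite mul0r ?addr0 ?add0r.
    have D : is_derive x 1 (fun t => J (i :: w) (h t))
        (c1 (h x) * derive1 f1 x + c2 (h x) * derive1 f2 x).
      apply: (@is_derive_of_estimate R f1 f2 _ x _ _ _ _ (`|C| * H ^+ 2)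
        (Num.min (x - a) (b - x)) _ _ dx1 dx2); first by rewrite lt_min; lra.
      move=> s; rewrite lt_min !ltr_norml => /andP[/andP[? ?] /andP[? ?]].
      by apply: (estimate P1 P2 HC); lra.
    by apply: (is_derive_eq D); rewrite /u /c1 /c2; case: (i); ring.
  have /andP[at_ tb] := tab.
  have := lip_FTC ab (mulr_ge0 M0 H0) uL dJ (lexx a) at_ tb.
  rewrite Js subr0 => <- /=; apply: eq_Rintegral => s.
  by rewrite inE/= in_itv/= => sat; rewrite IH//; lra.
move=> [//|i w] _; have [_ /(_ i)[Js _]] := JS w.
by rewrite JE ?lexx ?ltW// -hab Js.
Qed.

End Center.
End TreeLike.

(** * Reparameterization by variation *)

Section FactorThroughInterval.
Context {R : realType}.
Implicit Types (a b s t x y L : R) (f g h : R -> R).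

Lemma variation_cons x y b (Phi : R -> R) l :
  variation x b Phi (y :: l) = `|Phi y - Phi x| + variation y b Phi l.
Proof. by rewrite /variation big_nat_recl. Qed.

Lemma within_continuous_itvS a b c d g : a <= c -> d <= b ->
  {within `[a, b], continuous g} -> {within `[c, d], continuous g}.
Proof.
by move=> ac db; apply: continuous_subspaceW; apply: subset_itv; rewrite bnd_simp.
Qed.

(* The time needed to run along the graph of Phi dominates its variation. *)
Lemma variation_le_time a b L f g (Phi : R -> R) : {within `[a, b], continuous g} ->
  0 <= L -> lip a b L f -> (forall t, a <= t <= b -> Phi (g t) = f t) ->
  forall l s t, a <= s <= b -> a <= t <= b -> itv_partition (g s) (g t) l ->
    variation (g s) (g t) Phi l <= L * `|t - s|.
Proof.
move=> cg L0 fL fPhi; elim=> [|y l IH] s t sab tab P.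
  by rewrite variation_nil mulr_ge0.
have Py := itv_partition_cons P.
have sy : g s <= y by case: P => /= /andP[/ltW].
have yt : y <= g t := itv_partition_le Py.
have [u [us ut gu]] : exists u, [/\ Num.min s t <= u, u <= Num.max s t & g u = y].
  have mM : Num.min s t <= Num.max s t by rewrite ge_min !le_max !lexx.
  have am : a <= Num.min s t by rewrite le_min; lra.
  have Mb : Num.max s t <= b by rewrite ge_max; lra.
  have [|u] := @IVT R g _ _ y mM (within_continuous_itvS am Mb cg).
    have [st|/ltW ts] := leP s t; rewrite ?(min_l st) ?(max_r st) ?(min_r ts) ?(max_l ts).
      by rewrite ge_min le_max sy yt orbT.
    by rewrite ge_min le_max sy yt orbT.
  by rewrite in_itv/= => /andP[? ?] ?; exists u.
have uab : a <= u <= b.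
  by move: us ut; rewrite ge_min le_max => /orP[?|?] /orP[?|?]; lra.
have -> : `|t - s| = `|u - s| + `|t - u|.
  move: us ut; have [st|/ltW ts] := leP s t; rewrite ?(min_l st) ?(max_r st) ?(min_r ts) ?(max_l ts) => us ut.
    by rewrite !ger0_norm; lra.
  by rewrite !ler0_norm; lra.
rewrite -gu in Py *; rewrite variation_cons !fPhi// mulrDr lerD//; first exact: fL.
exact: IH.
Qed.

(** [f] is a function [Phi] of [g], where [tau] picks a time at which to read it. The clock is the
    total variation of [Phi] from the minimum of [g] up to [g t]. By additivity its increments are
    variations of [Phi] between two values of [g]; they dominate the increments of [f] and are
    bounded by the time needed to join these values. *)
Lemma variation_clock a b L f g : a <= b -> {within `[a, b], continuous g} ->
  0 <= L -> lip a b L f ->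
  (forall s t, a <= s <= b -> a <= t <= b -> g s = g t -> f s = f t) ->
  exists h : R -> R, forall s t, a <= s <= b -> a <= t <= b -> g s <= g t ->
    `|f t - f s| <= h t - h s <= L * `|t - s|.
Proof.
move=> ab cg L0 fL fg.
have /choice[tau tauP] : forall x, exists t, forall s, a <= s <= b -> g s = x -> a <= t <= b /\ g t = x.
  move=> x; have [[s sab gs]|nx] := pselect (exists2 s, a <= s <= b & g s = x).
    by exists s.
  by exists 0 => s sab gs; case: nx; exists s.
pose Phi x := f (tau x).
have fPhi t : a <= t <= b -> Phi (g t) = f t.
  by move=> tab; have [? ?] := tauP (g t) t tab erefl; exact: fg.
have [c] := EVT_min ab cg; rewrite in_itv/= => cab gmin.
have TVle s t : a <= s <= b -> a <= t <= b ->
    (total_variation (g s) (g t) Phi <= (L * `|t - s|)%:E)%E.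
  move=> sab tab; apply: ge_ereal_sup => _ [_ [l Pl <-] <-].
  by rewrite lee_fin; exact: (variation_le_time cg L0 fL fPhi).
have gc t : a <= t <= b -> g c <= g t by move=> tab; apply: gmin; rewrite in_itv.
have TVfin s t : a <= s <= b -> a <= t <= b -> g s <= g t ->
    total_variation (g s) (g t) Phi \is a fin_num.
  move=> sab tab st; rewrite ge0_fin_numE; last exact: total_variation_ge0.
  by apply: (le_lt_trans (TVle _ _ sab tab)); rewrite ltry.
exists (fun t => fine (total_variation (g c) (g t) Phi)) => s t sab tab st.
rewrite (@total_variationD _ _ (g t) (g s))//; last exact: gc.
rewrite fineD ?TVfin ?gc// addrAC subrr add0r.
rewrite -!lee_fin fineK ?TVfin// TVle// andbT.
by rewrite -(fPhi t)// -(fPhi s)//; exact: total_variation_ge.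
Qed.

(** The sum of the clocks of [f1] and [f2] dominates the increments of both. Where [g] takes equal
    values the clock is nondecreasing in both directions, hence equal, which gives h a = h b. *)
Lemma factor_through_interval a b L (f1 f2 g : R -> R) : a < b -> 0 <= L ->
  {within `[a, b], continuous g} -> lip a b L f1 -> lip a b L f2 ->
  (forall s t, a <= s <= b -> a <= t <= b -> g s = g t -> f1 s = f1 t /\ f2 s = f2 t) ->
  g a = g b -> abel_center a b f1 f2 /\ universal_center a b f1 f2.
Proof.
move=> ab L0 cg fL1 fL2 fg gab; have ab' := ltW ab.
have [h1 H1] := variation_clock ab' cg L0 fL1 (fun s t sab tab st => (fg s t sab tab st).1).
have [h2 H2] := variation_clock ab' cg L0 fL2 (fun s t sab tab st => (fg s t sab tab st).2).
pose h t := h1 t + h2 t.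
have L20 : 0 <= 2 * L by rewrite mulr_ge0.
have le s t : a <= s <= b -> a <= t <= b -> g s <= g t ->
    [/\ h t - h s <= 2 * L * `|t - s|, `|f1 t - f1 s| <= h t - h s & `|f2 t - f2 s| <= h t - h s].
  move=> sab tab st; have /andP[? ?] := H1 s t sab tab st; have /andP[? ?] := H2 s t sab tab st.
  have := normr_ge0 (f1 t - f1 s); have := normr_ge0 (f2 t - f2 s).
  by rewrite /h; split; lra.
have hL : lip a b (2 * L) h.
  move=> s t sab tab; have [st|/ltW ts] := leP (g s) (g t).
    have [h_ le1 _] := le s t sab tab st; have ? := normr_ge0 (f1 t - f1 s).
    by rewrite distrC (distrC s t) ger0_norm; lra.
  have [h_ le1 _] := le t s tab sab ts; have ? := normr_ge0 (f1 s - f1 t).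
  by rewrite ger0_norm; lra.
have fh1 s t : a <= s <= b -> a <= t <= b -> `|f1 s - f1 t| <= `|h s - h t|.
  move=> sab tab; have [st|/ltW ts] := leP (g s) (g t).
    have [_ h_ _] := le s t sab tab st.
    by rewrite distrC (distrC (h s)) (le_trans h_)// ler_norm.
  by have [_ h_ _] := le t s tab sab ts; rewrite (le_trans h_)// ler_norm.
have fh2 s t : a <= s <= b -> a <= t <= b -> `|f2 s - f2 t| <= `|h s - h t|.
  move=> sab tab; have [st|/ltW ts] := leP (g s) (g t).
    have [_ _ h_] := le s t sab tab st.
    by rewrite distrC (distrC (h s)) (le_trans h_)// ler_norm.
  by have [_ _ h_] := le t s tab sab ts; rewrite (le_trans h_)// ler_norm.
have hab : h a = h b.
  have aab : a <= a <= b by rewrite lexx.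
  have bab : a <= b <= b by rewrite lexx ab'.
  have [_ h_ _] := le a b aab bab (eq_ind _ (fun z => g a <= z) (lexx _) _ gab).
  have [_ h_' _] := le b a bab aab (eq_ind _ (fun z => z <= g a) (lexx _) _ gab).
  by have := normr_ge0 (f1 b - f1 a); have := normr_ge0 (f1 a - f1 b); lra.
split; first exact: (tree_like_center ab L20 hL hab fh1 fh2).
exact: (tree_like_universal ab L20 hL hab fh1 fh2).
Qed.

End FactorThroughInterval.

(** * Winding numbers and homology *)

Section Angles.
Context {R : realType}.
Implicit Types (p q : R * R) (s t : R).

Definition dot p q : R := p.1 * q.1 + p.2 * q.2.
Definition det2 p q : R := p.1 * q.2 - p.2 * q.1.
(** A relation, since the argument of a nonzero vector is determined only modulo 2 pi. *)
Definition angle p t : Prop := exists2 r : R, 0 < r & p = (r * cos t, r * sin t).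

Lemma angle_unit t : angle (cos t, sin t) t.
Proof. by exists 1; rewrite ?mul1r. Qed.

(** [det2 p q / dot p q] is the tangent of the oriented angle from p to q. Positivity of [dot] puts
    that angle strictly within a right angle of zero, where [atan] recovers it. *)
Lemma angle_rot p q t : angle p t -> 0 < dot p q ->
  angle q (t + atan (det2 p q / dot p q)).
Proof.
move=> [r r0 ->] d0; set u := _ / _.
pose c := cos (atan u).
have c0 : 0 < c by rewrite /c cos_atan invr_gt0 sqrtr_gt0 ltr_pwDl// sqr_ge0.
have sE : sin (atan u) = u * c.
  by rewrite -{2}(atanK u) /tan -/c divfK// gt_eqF.
exists (dot (r * cos t, r * sin t) q / (r * c)); first by rewrite divr_gt0// mulr_gt0.
rewrite cosD sinD sE -/c; case: q d0 @u c c0 sE => x y d0 u c c0 sE.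
have h : cos t ^+ 2 = 1 - sin t ^+ 2 by rewrite cos2sin2.
have ud : u * dot (r * cos t, r * sin t) (x, y) = det2 (r * cos t, r * sin t) (x, y).
  by rewrite /u divfK// gt_eqF.
have rc : r * c != 0 by rewrite mulf_neq0// gt_eqF.
congr (_, _); apply: (mulIf rc); rewrite mulrAC divfK//.
  have -> : dot (r * cos t, r * sin t) (x, y) * (cos t * c - sin t * (u * c)) =
    c * (cos t * dot (r * cos t, r * sin t) (x, y) - sin t * (u * dot (r * cos t, r * sin t) (x, y))).
    by ring.
  by rewrite ud /dot /det2 /=; ring: h.
have -> : dot (r * cos t, r * sin t) (x, y) * (sin t * c + cos t * (u * c)) =
  c * (sin t * dot (r * cos t, r * sin t) (x, y) + cos t * (u * dot (r * cos t, r * sin t) (x, y))).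
  by ring.
by rewrite ud /dot /det2 /=; ring: h.
Qed.

Lemma angle_ex p : p <> 0 -> exists t, angle p t.
Proof.
case: p => x y p0.
have a0 : angle (1, 0) (0 : R) by have := angle_unit 0; rewrite cos0 sin0.
have a1 : angle (0, 1) (pi / 2 : R).
  by have := angle_unit (pi / 2); rewrite cos_pihalf sin_pihalf.
have a2 : angle (-1, 0) (pi : R) by have := angle_unit pi; rewrite cospi sinpi.
have a3 : angle (0, -1) (- (pi / 2) : R).
  by have := angle_unit (- (pi / 2)); rewrite cosN sinN cos_pihalf sin_pihalf.
have [x0|x0|x0] := ltgtP x 0.
- have d : 0 < dot (-1, 0) (x, y) by rewrite /dot /=; lra.
  by eexists; exact: angle_rot a2 d.
- have d : 0 < dot (1, 0) (x, y) by rewrite /dot /=; lra.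
  by eexists; exact: angle_rot a0 d.
have [y0|y0|y0] := ltgtP y 0.
- have d : 0 < dot (0, -1) (x, y) by rewrite /dot /=; lra.
  by eexists; exact: angle_rot a3 d.
- have d : 0 < dot (0, 1) (x, y) by rewrite /dot /=; lra.
  by eexists; exact: angle_rot a1 d.
by case: p0; rewrite x0 y0.
Qed.

Lemma angle_neq0 p t : angle p t -> p <> 0.
Proof.
move=> [r r0 ->] [c0 s0]; have := cos2Dsin2 t.
have -> : cos t = 0 by apply/eqP; move/eqP: c0; rewrite mulf_eq0 gt_eqF.
have -> : sin t = 0 by apply/eqP; move/eqP: s0; rewrite mulf_eq0 gt_eqF.
by rewrite expr0n addr0 => /esym/eqP; rewrite oner_eq0.
Qed.

Lemma angle_cosB p s t : angle p s -> angle p t -> cos (t - s) = 1.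
Proof.
move=> [r r0 ->] [r' r'0 [e1 e2]].
have E : r = r'.
  apply/eqP; rewrite -(@eqrXn2 _ 2) ?ltW//; apply/eqP.
  rewrite -[r ^+ 2]mulr1 -[r' ^+ 2]mulr1 -{1}(cos2Dsin2 s) -(cos2Dsin2 t).
  by rewrite !mulrDr -!exprMn e1 e2.
subst r'; have r00 : r != 0 by rewrite gt_eqF.
by rewrite cosB -(mulfI r00 e1) -(mulfI r00 e2) -!expr2 cos2Dsin2.
Qed.

(** If D a and D b differed, [D] would take a value at distance min(|D b - D a|, pi) from D a, where
    the cosine is less than 1. *)
Lemma cos_eq1_cst (a b : R) (D : R -> R) : a <= b -> {within `[a, b], continuous D} ->
  (forall t, a <= t <= b -> cos (D t) = 1) -> D b = D a.
Proof.
move=> ab cD D1; apply/eqP; apply/negP => /negP neq.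
have cos1 (d : R) : 0 < d -> d <= pi -> cos d < 1.
  by move=> d0 dpi; rewrite -cos0 ltr_cos// in_itv/= ?lexx ?pi_ge0 ?(ltW d0) ?dpi.
have D0 := D1 a; rewrite lexx ab in D0; have {}D0 := D0 isT.
pose d := Num.min `|D b - D a| pi.
have d0 : 0 < d by rewrite lt_min pi_gt0 normr_gt0 subr_eq0 neq.
have dpi : d <= pi by rewrite ge_min lexx orbT.
have dle : d <= `|D b - D a| by rewrite ge_min lexx.
have sD0 : sin (D a) = 0 by apply: cos1sin0; rewrite D0 normr1.
have [Dab|Dba] := leP (D a) (D b).
  have [|t] := @IVT R D a b (D a + d) ab cD.
    rewrite (min_l Dab) (max_r Dab) lerDl (ltW d0)/=.
    by move: dle; rewrite ger0_norm ?subr_ge0//; lra.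
  rewrite in_itv/= => tab Dt; have := D1 t tab; rewrite Dt cosD D0 sD0 mul1r mul0r subr0.
  by have := cos1 d d0 dpi; lra.
have [|t] := @IVT R D a b (D a - d) ab cD.
  rewrite (min_r (ltW Dba)) (max_l (ltW Dba)) gerBl (ltW d0) andbT.
  by move: dle; rewrite ltr0_norm ?subr_lt0//; lra.
rewrite in_itv/= => tab Dt; have := D1 t tab; rewrite Dt cosB D0 sD0 mul1r mul0r addr0.
by have := cos1 d d0 dpi; lra.
Qed.

End Angles.

Lemma within_comp (T U W : topologicalType) (A : set U) (f : U -> W) (r : T -> U) :
  {within A, continuous f} -> continuous r -> (forall x, A (r x)) ->
  continuous (f \o r).
Proof.
move=> /subspace_continuousP cf cr rA x B /(cf _ (rA x)) /= AB.
have := cr x _ AB; apply: (@filterS _ (nbhs x)) => y /=; apply; exact: rA.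
Qed.

Lemma continuous_for_within (U W : topologicalType) (A : set U) (f : U -> W) :
  (forall x, A x -> {for x, continuous f}) -> {within A, continuous f}.
Proof.
by move=> cf; apply/subspace_continuousP => x Ax; apply: cvg_within_filter; exact: cf.
Qed.

Section AngleLifting.
Context {R : realType}.

Lemma fst_cvg (T : Type) (F : set_system T) (FF : Filter F) (f : T -> R * R) (p : R * R) :
  f x @[x --> F] --> p -> (f x).1 @[x --> F] --> p.1.
Proof. by move=> fp; apply: (cvg_comp _ _ fp); exact: cvg_fst. Qed.

Lemma snd_cvg (T : Type) (F : set_system T) (FF : Filter F) (f : T -> R * R) (p : R * R) :
  f x @[x --> F] --> p -> (f x).2 @[x --> F] --> p.2.
Proof. by move=> fp; apply: (cvg_comp _ _ fp); exact: cvg_snd. Qed.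

Lemma dot_cvg (T : Type) (F : set_system T) (FF : Filter F) (f g : T -> R * R) (p q : R * R) :
  f x @[x --> F] --> p -> g x @[x --> F] --> q -> dot (f x) (g x) @[x --> F] --> dot p q.
Proof.
by move=> fp gq; apply: cvgD; apply: cvgM; [exact: fst_cvg|exact: fst_cvg|exact: snd_cvg|exact: snd_cvg].
Qed.

Lemma det2_cvg (T : Type) (F : set_system T) (FF : Filter F) (f g : T -> R * R) (p q : R * R) :
  f x @[x --> F] --> p -> g x @[x --> F] --> q -> det2 (f x) (g x) @[x --> F] --> det2 p q.
Proof.
by move=> fp gq; apply: cvgB; apply: cvgM; [exact: fst_cvg|exact: snd_cvg|exact: snd_cvg|exact: fst_cvg].
Qed.

Lemma turn_cvg (T : Type) (F : set_system T) (FF : Filter F) (f g : T -> R * R) (p q : R * R) :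
  dot p q != 0 -> f x @[x --> F] --> p -> g x @[x --> F] --> q ->
  atan (det2 (f x) (g x) / dot (f x) (g x)) @[x --> F] --> atan (det2 p q / dot p q).
Proof.
move=> d0 fp gq; apply: continuous_cvg; first exact: continuous_atan.
by apply: cvgM; [exact: det2_cvg|apply: cvgV => //; exact: dot_cvg].
Qed.

Lemma dot_gt0 (p : R * R) : p <> 0 -> 0 < dot p p.
Proof.
case: p => x y p0; rewrite /dot /= -!expr2 lt_neqAle addr_ge0 ?sqr_ge0// andbT eq_sym.
apply/negP => /eqP h; apply: p0.
have : x ^+ 2 = 0 /\ y ^+ 2 = 0 by have := sqr_ge0 x; have := sqr_ge0 y; lra.
by case=> /eqP; rewrite sqrf_eq0 => /eqP -> /eqP; rewrite sqrf_eq0 => /eqP ->.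
Qed.

Variable V : normedModType R.

(* The angle of f x is obtained by following f along the segment from 0 to x,
   in finitely many steps that each turn by less than a right angle. *)
Lemma angle_lift (f : V -> R * R) (K : set V) : continuous f -> (forall x, f x <> 0) ->
  compact K -> (forall x (s : R), K x -> 0 <= s <= 1 -> K (s *: x)) ->
  exists th : V -> R, forall x, K x -> {for x, continuous th} /\ angle (f x) (th x).
Proof.
move=> cf f0 cK starK.
pose K01 := K `*` `[0, 1]%classic : set (V * R).
have cK01 : compact K01 by apply: compact_setX => //; exact: segment_compact.
(* Along the ray through z.1, steps of length at most 1 / (N + 1) from the parameter z.2 stay within
   a right angle. Compactness of [K01] yields one N for all rays and parameters. *)
pose P (N : nat) (z : V * R) := forall s : R, `|z.2 - s| <= N.+1%:R^-1 ->
  0 < dot (f (z.2 *: z.1)) (f (s *: z.1)).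
have /compact_near_coveringP/(_ nat \oo P _) := cK01.
move=> /(_ _)[].
  move=> [x s] _.
  pose Phi (w : (V * R) * R) := dot (f (w.1.2 *: w.1.1)) (f (w.2 *: w.1.1)).
  have cPhi : continuous Phi.
    move=> w; apply: dot_cvg.
      apply: continuous_comp; last exact: cf.
      apply: cvgZ; last by apply: (cvg_comp _ _ cvg_fst); exact: cvg_fst.
      by apply: (cvg_comp _ _ cvg_fst); exact: cvg_snd.
    apply: continuous_comp; last exact: cf.
    by apply: cvgZ; [exact: cvg_snd|apply: (cvg_comp _ _ cvg_fst); exact: cvg_fst].
  have Phi0 : 0 < Phi ((x, s), s) by apply: dot_gt0.
  have [[A B] /= [nA /nbhs_ballP[e /= e0 He]] sub] := cPhi ((x, s), s) _ (lt_nbhsr Phi0).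
  have e20 : 0 < e / 2 by rewrite divr_gt0.
  exists (A `&` [set z | `|s - z.2| < e / 2], [set N | N.+1%:R^-1 < e / 2]) => /=.
    split; last exact: near_infty_natSinv_lt (PosNum e20).
    apply: filterI => //; exists (setT, ball s (e / 2)) => /=; last by move=> z [].
    by split; [exact: filterT|exact: nbhsx_ballx].
  move=> [z N] /= [[Az zs] Ne] s' zs'; apply: (sub (z, s')); split => //=.
  apply: He; rewrite /ball /= (le_lt_trans (ler_distD z.2 _ _))// [e]splitr ltrD//.
  exact: le_lt_trans zs' Ne.
move=> N _ HN; have {}HN := HN N (leqnn N).
have [[x0 Kx0]|K0] := pselect (exists x, K x); last first.
  by exists (fun=> 0) => x Kx; case: K0; exists x.
have [t0 ht0] := angle_ex (f0 0).
pose g (j : nat) (x : V) := f ((j%:R / N.+1%:R) *: x).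
pose S := fix S (k : nat) (x : V) : R :=
  if k is k'.+1 then S k' x + atan (det2 (g k' x) (g k'.+1 x) / dot (g k' x) (g k'.+1 x)) else t0.
exists (S N.+1) => x Kx.
have N0 : (0 : R) < N.+1%:R by rewrite ltr0n.
suff H k : (k <= N.+1)%N -> {for x, continuous (S k)} /\ angle (g k x) (S k x).
  have [cS] := H N.+1 (leqnn _).
  by rewrite /g divff ?scale1r// gt_eqF.
elim: k => [_|k IH kN].
  split; first exact: cvg_cst.
  by rewrite /g mul0r scale0r.
have [cS aS] := IH (ltnW kN).
have cg j : {for x, continuous (g j)}.
  apply: continuous_comp; last exact: cf.
  by apply: cvgZ; [exact: cvg_cst|exact: cvg_id].
have d0 : 0 < dot (g k x) (g k.+1 x).
  apply: (HN (x, k%:R / N.+1%:R)) => /=.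
    split => //=; rewrite in_itv/= divr_ge0//= ler_pdivrMr// mul1r ler_nat.
    exact: ltnW.
  rewrite -mulrBl -natr1 opprD addrA subrr sub0r mulN1r normrN ger0_norm//.
split; last exact: angle_rot.
apply: cvgD; first exact: cS.
by apply: turn_cvg; [rewrite gt_eqF|exact: cg|exact: cg].
Qed.

End AngleLifting.

(** * Winding numbers of paths about the origin *)

Section Winding.
Context {R : realType}.
Implicit Types (c : R -> R * R) (w : R).

(** Measured in radians and meaningful for open paths; for a closed path it is 2 pi times the usual
    winding number. *)
Definition wind c w : Prop := exists th : R -> R,
  [/\ {within `[0, 1], continuous th}, forall t, 0 <= t <= 1 -> angle (c t) (th t) &
      th 1 - th 0 = w].

Lemma clip_continuous (a b : R) : continuous (clip a b).
Proof.
move=> x; apply/cvgrPdist_le => e e0; exists e => // y /= xy; apply: le_trans (ltW xy).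
have [lexy|/ltW leyx] := leP x y.
  by have := clip_le a b lexy => ?; rewrite !ler0_norm; lra.
by have := clip_le a b leyx => ?; rewrite !ger0_norm; lra.
Qed.

Lemma angle_lift_path (a b : R) c : a <= b -> {within `[a, b], continuous c} ->
  (forall t, a <= t <= b -> c t <> 0) ->
  exists th : R -> R, {within `[a, b], continuous th} /\
    forall t, a <= t <= b -> angle (c t) (th t).
Proof.
move=> ab cc c0; pose r := clip a b.
have rab x : a <= r x <= b := clip_itv x ab.
have rK x : a <= x <= b -> r x = x by exact: clip_id.
(* The lifting lemma asks for a set that is star-shaped about 0, whence the translation to
   [0, b - a]; clipping extends the path to the whole line. *)
have cr : continuous (fun x => r (a + x)).
  move=> x; apply: continuous_comp; last exact: clip_continuous.
  by apply: cvgD; [exact: cvg_cst|exact: cvg_id].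
have ccr : continuous (c \o (fun x => r (a + x))).
  by apply: (within_comp cc cr) => x /=; rewrite in_itv; exact: rab.
have [||th thP] := @angle_lift R R^o (c \o (fun x => r (a + x))) `[0, b - a]%classic ccr _
  (@segment_compact R 0 (b - a)).
- by move=> x; apply: c0; exact: rab.
- move=> x s /=; rewrite !in_itv /= => /andP[x0 xb] /andP[s0 s1].
  by rewrite mulr_ge0//= (le_trans _ xb)// ler_piMl.
have thP' t : a <= t <= b -> {for t - a, continuous th} /\ angle (c t) (th (t - a)).
  move=> tab; have [|cth] := thP (t - a); first by rewrite /= in_itv/=; lra.
  by rewrite /= (_ : a + (t - a) = t) ?rK//; ring.
exists (fun t => th (t - a)); split; last by move=> t /thP'[].
apply: continuous_for_within => t; rewrite /= in_itv /= => /thP'[cth _].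
apply: continuous_comp; last exact: cth.
by apply: cvgB; [exact: cvg_id|exact: cvg_cst].
Qed.

Lemma wind_ex c : {within `[0, 1], continuous c} ->
  (forall t, 0 <= t <= 1 -> c t <> 0) -> exists w, wind c w.
Proof.
move=> cc c0; have [th [? ?]] := angle_lift_path ler01 cc c0.
by exists (th 1 - th 0), th.
Qed.

Lemma angle_lift_uniq (a b : R) c (th th' : R -> R) : a <= b ->
  {within `[a, b], continuous th} -> {within `[a, b], continuous th'} ->
  (forall t, a <= t <= b -> angle (c t) (th t)) ->
  (forall t, a <= t <= b -> angle (c t) (th' t)) -> th b - th a = th' b - th' a.
Proof.
move=> ab cth cth' H H'.
have : th b - th' b = th a - th' a.
  apply: (@cos_eq1_cst _ a b (fun t => th t - th' t)) => //.
    by move=> x; apply: cvgB; [exact: cth|exact: cth'].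
  by move=> t tab; exact: angle_cosB (H' t tab) (H t tab).
by lra.
Qed.

Lemma wind_uniq c w w' : wind c w -> wind c w' -> w = w'.
Proof.
move=> [th [cth ath <-]] [th' [cth' ath' <-]].
exact: angle_lift_uniq ler01 cth cth' ath ath'.
Qed.

Lemma eq_wind c c' w : (forall t, 0 <= t <= 1 -> c t = c' t) -> wind c w -> wind c' w.
Proof.
move=> cc' [th [cth ath thw]]; exists th; split => // t t01.
by rewrite -cc'//; exact: ath.
Qed.

(* A path staying within a right angle of c turns as much as c does. *)
Lemma wind_dot_gt0 c c' w : c 0 = c 1 -> c' 0 = c' 1 ->
  {within `[0, 1], continuous c} -> {within `[0, 1], continuous c'} ->
  (forall t, 0 <= t <= 1 -> 0 < dot (c t) (c' t)) -> wind c w -> wind c' w.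
Proof.
move=> c01 c'01 cc cc' d0 [th [cth ath <-]].
exists (fun t => th t + atan (det2 (c t) (c' t) / dot (c t) (c' t))); split.
- apply/subspace_continuousP => x x01; have x01' := x01; rewrite /= in_itv in x01'.
  apply: cvgD; first by move/subspace_continuousP : cth; exact.
  apply: turn_cvg; first by rewrite gt_eqF// d0.
    by move/subspace_continuousP : cc; exact.
  by move/subspace_continuousP : cc'; exact.
- by move=> t t01; apply: angle_rot; [exact: ath|exact: d0].
- by rewrite c01 c'01; ring.
Qed.

End Winding.

(** * Turning of singular chains *)

Section HomologyTurning.
Context {R : realType}.
Implicit Types (G : set (R * R)) (c : R -> R * R) (w : R).

(** A retraction of the plane onto the standard simplex. Composition with it extends a singular
    simplex continuously to the plane, where the lifting lemma applies. *)
Definition simplex_retraction (p : R * R) : R * R :=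
  let u := Num.max 0 p.1 in let v := Num.max 0 p.2 in
  (u / Num.max 1 (u + v), v / Num.max 1 (u + v)).

Lemma simplex_retraction_in p : simplex2 (simplex_retraction p).
Proof.
rewrite /simplex_retraction /simplex2 /=; set u := Num.max 0 p.1; set v := Num.max 0 p.2.
have u0 : 0 <= u by rewrite le_max lexx.
have v0 : 0 <= v by rewrite le_max lexx.
have m0 : 0 < Num.max 1 (u + v) by rewrite lt_max ltr01.
split; [by rewrite divr_ge0// ltW|by rewrite divr_ge0// ltW|].
by rewrite -mulrDl ler_pdivrMr// mul1r le_max lexx orbT.
Qed.

Lemma simplex_retraction_id p : simplex2 p -> simplex_retraction p = p.
Proof.
case: p => x y [/= x0 y0 xy]; rewrite /simplex_retraction /= (max_r x0) (max_r y0).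
by rewrite max_l// !divr1.
Qed.

Lemma max0_cvg (T : Type) (F : set_system T) (FF : Filter F) (f : T -> R) (c l : R) :
  f x @[x --> F] --> l -> Num.max c (f x) @[x --> F] --> Num.max c l.
Proof.
move=> fl; apply/cvgrPdist_le => e e0; have /cvgrPdist_le/(_ e e0) := fl.
apply: filterS => x; rewrite !ler_norml => /andP[h1 h2].
by rewrite /Order.max; case: ltP => ?; case: ltP => ?; apply/andP; split; lra.
Qed.

Lemma pair_cvg (T : Type) (F : set_system T) (FF : Filter F) (f g : T -> R) (l m : R) :
  f x @[x --> F] --> l -> g x @[x --> F] --> m -> (f x, g x) @[x --> F] --> (l, m).
Proof. exact: cvg_pair. Qed.

Lemma simplex_retraction_continuous : continuous simplex_retraction.
Proof.
move=> p; set u := fun p : R * R => Num.max 0 p.1; set v := fun p : R * R => Num.max 0 p.2.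
have cu : u x @[x --> p] --> u p by apply: max0_cvg; exact: cvg_fst.
have cv : v x @[x --> p] --> v p by apply: max0_cvg; exact: cvg_snd.
have cm : Num.max 1 (u x + v x) @[x --> p] --> Num.max 1 (u p + v p).
  by apply: max0_cvg; apply: cvgD.
have m0 : Num.max 1 (u p + v p) != 0 by rewrite gt_eqF// lt_max ltr01.
by apply: pair_cvg; apply: cvgM => //; apply: cvgV.
Qed.

Lemma simplex2_compact : compact (@simplex2 R).
Proof.
have -> : @simplex2 R = simplex_retraction @` (`[0, 1] `*` `[0, 1])%classic.
  apply/seteqP; split => [p sp|_ [p _ <-]]; last exact: simplex_retraction_in.
  exists p; last exact: simplex_retraction_id.
  by case: sp => ? ? ?; split; rewrite /= in_itv/=; lra.
apply: continuous_compact; first exact/continuous_subspaceT/simplex_retraction_continuous.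
by apply: compact_setX; exact: segment_compact.
Qed.

(* The total turning of a path about the origin; 0 if the path meets the origin. *)
Definition turning c : R := xget 0 [set w | wind c w].

Lemma wind_turning c w : wind c w -> turning c = w.
Proof. by move=> cw; apply: (wind_uniq _ cw); exact: xgetI cw. Qed.

Lemma fglift_is_additive (K : choiceType) (f : K -> zmodule R) : additive (fglift f).
Proof. exact: lift_is_additive. Qed.

Lemma wind_restrict1 (pi_ : R * R -> R * R) c w : wind (pi_ \o c) w ->
  wind (pi_ \o restrict1 c) w.
Proof.
apply: eq_wind => t t01 /=; by rewrite /restrict1 patchE mem_set//= in_itv.
Qed.

Variables (G : set (R * R)) (proj : R * R -> R * R).
Hypotheses (cproj : {within G, continuous proj}) (proj0 : forall p, G p -> proj p <> 0).

Let chain_turning (c : @chain1 R) : zmodule R := fglift (fun s => turning (proj \o s) : zmodule R) c.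

Let ctB (c d : @chain1 R) : chain_turning (c - d) = chain_turning c - chain_turning d.
Proof. exact: fglift_is_additive. Qed.

Let ctU s : chain_turning << s >> = turning (proj \o s).
Proof. by rewrite /chain_turning liftU scale1r. Qed.

Let ct0 : chain_turning 0 = 0.
Proof. by rewrite -(subrr 0) ctB subrr. Qed.

Let ctN (c : @chain1 R) : chain_turning (- c) = - chain_turning c.
Proof. by rewrite -sub0r ctB ct0 sub0r. Qed.

Let ctD (c d : @chain1 R) : chain_turning (c + d) = chain_turning c + chain_turning d.
Proof. by rewrite -{1}[d]opprK ctB ctN opprK. Qed.

Let ctZ (c : @chain1 R) (k : int) : chain_turning (c *~ k) = chain_turning c *~ k.
Proof.
have H n : chain_turning (c *+ n) = chain_turning c *+ n.
  by elim: n => [|n IH]; rewrite ?mulr0n ?ct0// !mulrS ctD IH.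
by case: k => n; [exact: H|rewrite NegzE !mulrNz ctN; congr (- _); exact: H].
Qed.

(** The simplex is compact and star-shaped about 0, so [proj] has a continuous argument over the
    whole singular triangle. The turning of each edge is then a difference of its values at two
    vertices, and the three differences cancel. *)
Let ct_boundary_face s : singular2 G s ->
  chain_turning (<< restrict1 (fun t => s (1 - t, t)) >>
    - << restrict1 (fun t => s (0, t)) >> + << restrict1 (fun t => s (t, 0)) >>) = 0.
Proof.
move=> [cs sG _]; rewrite ctD ctB !ctU.
have crs : continuous (s \o simplex_retraction).
  exact: within_comp cs simplex_retraction_continuous simplex_retraction_in.
have sGr p : G ((s \o simplex_retraction) p).
  by apply: sG; exists (simplex_retraction p) => //; exact: simplex_retraction_in.
have cf : continuous (proj \o (s \o simplex_retraction)) by exact: within_comp cproj crs sGr.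
have [||th thP] := @angle_lift R (R * R)%type _ simplex2 cf _ simplex2_compact.
- by move=> x; apply: proj0; exact: sGr.
- move=> [x y] t [/= x0 y0 xy] /andP[t0 t1].
  have e1 : t *: (x, y) = (t * x, t * y) by [].
  by rewrite e1; split => /=; [rewrite mulr_ge0|rewrite mulr_ge0|rewrite -mulrDr mulr_ile1// addr_ge0].
have edge (e : R -> R * R) : continuous e -> (forall t, 0 <= t <= 1 -> simplex2 (e t)) ->
    turning (proj \o restrict1 (s \o e)) = th (e 1) - th (e 0).
  move=> ce es; apply: wind_turning; apply: wind_restrict1.
  exists (th \o e); split => //.
    apply: continuous_for_within => t; rewrite /= in_itv/= => t01.
    by apply: continuous_comp; [exact: ce|have [] := thP _ (es t t01)].
  move=> t t01; have [_] := thP _ (es t t01).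
  by rewrite /= simplex_retraction_id//; exact: es.
rewrite (edge (fun t => (1 - t, t))); last 2 first.
- by move=> t; apply: pair_cvg; [apply: cvgB; [exact: cvg_cst|exact: cvg_id]|exact: cvg_id].
- by move=> t t01; split => /=; lra.
rewrite (edge (fun t => (0, t))); last 2 first.
- by move=> t; apply: pair_cvg; [exact: cvg_cst|exact: cvg_id].
- by move=> t t01; split => /=; lra.
rewrite (edge (fun t => (t, 0))); last 2 first.
- by move=> t; apply: pair_cvg; [exact: cvg_id|exact: cvg_cst].
- by move=> t t01; split => /=; lra.
by rewrite subrr subr0; ring.
Qed.

Let null_homologous_turning (c : @chain1 R) : null_homologous G c -> chain_turning c = 0.
Proof.
move=> [d dG ->]; rewrite /boundary2 -[d in fglift _ d]freeg_sumE.
set bd := fun s : R * R -> R * R => _.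
have bdB := lift_is_additive bd.
have bd0 : fglift bd 0 = 0 by rewrite -(subrr 0) bdB subrr.
have bdD x y : fglift bd (x + y) = fglift bd x + fglift bd y.
  by rewrite -{1}[y]opprK bdB -[- y]sub0r bdB bd0 sub0r opprK.
rewrite (big_morph _ bdD bd0) (big_morph _ ctD ct0) big_seq big1// => s sd.
have -> : fglift bd << coeff s d *g s >> = bd s *~ coeff s d.
  by rewrite liftU -[X in X *: _]intz scaler_int.
by rewrite ctZ ct_boundary_face ?mul0rz//; exact: dG.
Qed.

(* Homologous cycles turn by the same amount, as seen through any continuous
   map from G to the punctured plane. *)
Lemma homologous_turning (m : nat) (c : R -> R * R) (l : 'I_m -> R -> R * R) (k : 'I_m -> int)
    (w : R) (wl : 'I_m -> R) :
  wind (proj \o c) w -> (forall i, wind (proj \o l i) (wl i)) ->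
  null_homologous G (loop_cycle c - \sum_i loop_cycle (l i) *~ k i) ->
  w = \sum_i wl i *~ k i.
Proof.
move=> cw lw /null_homologous_turning.
rewrite ctB (big_morph _ ctD ct0) ctU (wind_turning (wind_restrict1 cw)).
move=> /eqP; rewrite subr_eq0 => /eqP ->; apply: eq_bigr => i _.
by rewrite ctZ ctU (wind_turning (wind_restrict1 (lw i))).
Qed.

End HomologyTurning.

(** * Green's formula *)

Section CrossingNumbers.
Context {R : realType}.
Implicit Types (p q z : R * R) (s t x y : R) (c : R -> R * R).

Definition revolutions t : R := (Num.floor (t / (2 * pi)))%:~R.

(** Signed crossing of the positive half-axis by the vertical move from [p] to the height of [q].
    Testing the abscissa of [p] alone makes [crossing (p - z) (q - z)] a difference of indicators of
    two quadrants, as a function of z. *)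
Definition crossing p q : R :=
  (0 < p.1)%R%:R * ((0 <= q.2)%R%:R - (0 <= p.2)%R%:R).

Let twopi_gt0 : 0 < 2 * pi :> R.
Proof. by rewrite mulr_gt0// pi_gt0. Qed.

Lemma revolutions_eq (k : int) t : 2 * pi * k%:~R <= t < 2 * pi * (k + 1)%:~R ->
  revolutions t = k%:~R.
Proof.
move=> /andP[h1 h2]; rewrite /revolutions; congr (_%:~R); apply: floor_def.
by rewrite ler_pdivlMr// ltr_pdivrMr// mulrC h1 /= mulrC.
Qed.

Lemma revolutions_itv t : exists k : int, 2 * pi * k%:~R <= t < 2 * pi * (k + 1)%:~R.
Proof.
exists (Num.floor (t / (2 * pi))).
have /andP[h1 h2] := floor_itv (t / (2 * pi)).
by rewrite mulrC -ler_pdivlMr// h1/= mulrC -ltr_pdivrMr.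
Qed.

Lemma sincos_shift (k : int) t :
  sin (t + 2 * pi * k%:~R) = sin t /\ cos (t + 2 * pi * k%:~R) = cos t.
Proof.
have H (n : nat) (u : R) : sin (u + 2 * pi * n%:R) = sin u /\ cos (u + 2 * pi * n%:R) = cos u.
  have -> : 2 * pi * n%:R = pi *+ 2 *+ n :> R by rewrite -[pi *+ 2]mulr_natl mulr_natr.
  by split; apply: periodicn; [exact: sinD2pi|exact: cosD2pi].
case: k => n; first exact: H.
have [<- <-] := H n.+1 (t + 2 * pi * (Negz n)%:~R).
by rewrite NegzE mulrNz mulrN subrK.
Qed.

Lemma angle_shift (k : int) p t : angle p t -> angle p (t - 2 * pi * k%:~R).
Proof.
move=> [r r0 ->]; exists r => //.
have [<- <-] := sincos_shift k (t - 2 * pi * k%:~R); by rewrite subrK.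
Qed.

Lemma cos_eq1 t : cos t = 1 -> exists k : int, t = 2 * pi * k%:~R.
Proof.
have [k /andP[k1 k2]] := revolutions_itv t; move=> ct; exists k.
pose u := t - 2 * pi * k%:~R.
have u0 : 0 <= u by rewrite /u subr_ge0.
have u2 : u < 2 * pi by move: k2; rewrite intrD mulrDr mulr1 /u; lra.
have cu : cos u = 1.
  by have [_ <-] := sincos_shift k u; rewrite /u subrK.
have pi0 := @pi_gt0 R.
suff : u = 0 by rewrite /u; lra.
have [upi|upi] := leP u pi.
  by apply: cos_inj; rewrite ?in_itv/= ?u0 ?lexx ?(ltW pi0)// cos0.
have cu' : cos (2 * pi - u) = 1.
  have [_ h] := sincos_shift 1 (- u).
  transitivity (cos (- u + 2 * pi * 1%:~R)); last by rewrite h cosN.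
  by congr cos; rewrite mulr1; ring.
have : 2 * pi - u = 0.
  by apply: cos_inj; rewrite ?in_itv/= ?lexx ?(ltW pi0) ?cos0//; lra.
by lra.
Qed.

(** The number of revolutions changes when the positive half-axis is passed. A turn by less than a
    right angle that passes it starts in the open right half-plane, and one that starts there cannot
    pass the negative half-axis; so the sign of p.1 and the change of sign of the ordinate detect
    the passage. *)
Lemma crossing_revolutions p q s t : angle p s -> angle q t -> `|t - s| < pi / 2 ->
  crossing p q = revolutions t - revolutions s.
Proof.
move=> aps aqt; have [k /andP[k1 k2]] := revolutions_itv s.
rewrite (@revolutions_eq k s) ?k1//.
move: (angle_shift k aps) (angle_shift k aqt) => [r r0 pE] [r' r'0 qE].
set u := s - _ in pE; set v := t - 2 * pi * k%:~R in qE.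
have u0 : 0 <= u by rewrite /u subr_ge0.
have u2 : u < 2 * pi by move: k2; rewrite intrD mulrDr mulr1 /u; lra.
have -> : t - s = v - u by rewrite /u /v; ring.
have rev (e : int) : 2 * pi * e%:~R <= v < 2 * pi * (e + 1)%:~R ->
    revolutions t - k%:~R = e%:~R.
  move=> /andP[v1 v2]; rewrite (@revolutions_eq (k + e)).
    by rewrite intrD; ring.
  by move: v1 v2; rewrite /v !intrD; lra.
have pi0 := @pi_gt0 R.
rewrite ltr_norml => /andP[uv1 uv2].
rewrite /crossing pE qE /= (pmulr_rgt0 _ r0) !pmulr_rge0//.
have sin_neg x : pi < x < 2 * pi -> (0 <= sin x) = false.
  move=> xp; apply/negbTE; rewrite -ltNge.
  have -> : sin x = - sin (x - pi) by rewrite -{1}(subrK pi x) sinDpi.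
  by rewrite oppr_lt0 sin_gt0_pi//; lra.
have [up|up] := ltP u (pi / 2).
  rewrite cos_gt0_pihalf ?(@sin_ge0_pi _ u); try lra.
  have [v0|v0] := ltP v 0.
    rewrite (rev (-1)); last by rewrite mulrN1 mulr0; lra.
    rewrite (_ : 0 <= sin v = false); first by rewrite sub0r mulrN1.
    apply/negbTE; rewrite -ltNge -[v]opprK sinN oppr_lt0 sin_gt0_pi//; lra.
  rewrite (rev 0); last by rewrite mulr0 mulr1; lra.
  by rewrite sin_ge0_pi ?subrr ?mulr0//; lra.
have [u3|u3] := leP u (3 * (pi / 2)).
  rewrite (rev 0); last by rewrite mulr0 mulr1; lra.
  rewrite (_ : 0 < cos u = false) ?mul0r//.
  apply/negbTE; rewrite -leNgt.
  have -> : cos u = - cos (u - pi) by rewrite -{1}(subrK pi u) cosDpi.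
  by rewrite oppr_le0 cos_ge0_pihalf//; lra.
have -> : 0 < cos u.
  have [_] := sincos_shift 1 (u - 2 * pi); rewrite mulr1 subrK => ->.
  by rewrite cos_gt0_pihalf//; lra.
rewrite (sin_neg u); last by lra.
have [v2|v2] := ltP v (2 * pi).
  rewrite (rev 0); last by rewrite mulr0 mulr1; lra.
  by rewrite sin_neg ?subrr ?mulr0//; lra.
rewrite (rev 1); last by rewrite intrD !mulr1; lra.
have -> : 0 <= sin v; last by rewrite subr0 mulr1.
have [+ _] := sincos_shift 1 (v - 2 * pi); rewrite mulr1 subrK => ->.
by rewrite sin_ge0_pi//; lra.
Qed.

Lemma uniformly_continuous01 (f : R -> R) (e : R) : 0 < e -> continuous f ->
  exists N : nat, forall s t, 0 <= s <= 1 -> `|s - t| <= 2^-1 ^+ N -> `|f t - f s| < e.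
Proof.
move=> e0 cf; have e20 : 0 < e / 2 by rewrite divr_gt0.
have geo (d : R) : 0 < d -> \forall N \near \oo, (2^-1 : R) ^+ N < d.
  move=> d0; have /cvgrPdist_lt/(_ _ d0) : (fun n : nat => 2^-1 ^+ n : R) @ \oo --> (0 : R).
    by apply: cvg_expr; rewrite ger0_norm//; lra.
  by apply: filterS => n; rewrite sub0r normrN => /ltr_normlW.
pose P (N : nat) (s : R) := forall t, `|s - t| <= 2^-1 ^+ N -> `|f t - f s| < e.
have /compact_near_coveringP/(_ nat \oo P _) := @segment_compact R 0 1.
move=> /(_ _)[].
  move=> x _; have /cvgrPdist_lt/(_ _ e20) := cf x.
  move=> /nbhs_ballP[d /= d0 Hd]; have d20 : 0 < d / 2 by rewrite divr_gt0.
  exists (ball x (d / 2), [set N | (2^-1 : R) ^+ N < d / 2]) => /=.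
    by split; [exact: nbhsx_ballx|exact: geo].
  move=> [s N] /= [xs Nd] t st.
  have h1 : `|f x - f s| < e / 2 by apply: Hd; apply: lt_trans xs _; lra.
  have h2 : `|f x - f t| < e / 2.
    apply: Hd; rewrite /ball /= (le_lt_trans (ler_distD s _ _))// [d]splitr ltrD//.
    exact: le_lt_trans st Nd.
  rewrite (le_lt_trans (ler_distD (f x) _ _))// [e]splitr ltrD//.
  by rewrite distrC.
move=> N _ HN; exists N => s t s01; apply: (HN N (leqnn N)).
by rewrite /= in_itv.
Qed.

Definition dyadic_crossings c (n : nat) z : R :=
  \sum_(j < 2 ^ n) crossing (c (j%:R / 2 ^+ n) - z) (c (j.+1%:R / 2 ^+ n) - z).

(** Once all dyadic steps turn by less than a right angle, the crossings are increments of
    [revolutions] and telescope; adding 2 pi m to an argument adds m revolutions. *)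
Lemma dyadic_crossings_wind c z (m : int) : c 0 = c 1 ->
  wind (fun t => c t - z) (2 * pi * m%:~R) ->
  exists N, forall n, (N <= n)%N -> dyadic_crossings c n z = m%:~R.
Proof.
move=> c01 [th [cth ath thm]].
have cth' : continuous (th \o clip 0 1).
  by apply: (within_comp cth (@clip_continuous _ 0 1)) => x /=; rewrite in_itv; exact: clip_itv.
have [|N HN] := uniformly_continuous01 _ cth' (e := pi / 2).
  by rewrite divr_gt0// pi_gt0.
exists N => n Nn.
have n0 : (0 : R) < 2 ^+ n by rewrite exprn_gt0.
have d01 (j : nat) : (j <= 2 ^ n)%N -> 0 <= (j%:R / 2 ^+ n : R) <= 1.
  move=> jn; rewrite divr_ge0 ?(ltW n0)//= ler_pdivrMr// mul1r.
  by rewrite -natrX ler_nat.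
have -> : dyadic_crossings c n z = \sum_(j < 2 ^ n)
    (revolutions (th (j.+1%:R / 2 ^+ n)) - revolutions (th (j%:R / 2 ^+ n))).
  apply: eq_bigr => j _; apply: crossing_revolutions.
  - exact/ath/d01/ltnW.
  - exact/ath/d01.
  have := HN (j%:R / 2 ^+ n) (j.+1%:R / 2 ^+ n) (d01 _ (ltnW (ltn_ord j))).
  rewrite /= !clip_id; try exact: d01; last exact/d01/ltnW.
  apply; rewrite -mulrBl -natr1 opprD addrA subrr sub0r mulN1r normrN.
  rewrite ger0_norm ?invr_ge0 ?(ltW n0)// exprVn lef_pV2 ?posrE ?exprn_gt0//.
  by rewrite ler_eXn2l// ltr1n.
rewrite -(big_mkord xpredT (fun j => revolutions (th (j.+1%:R / 2 ^+ n)) - revolutions (th (j%:R / 2 ^+ n)))).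
rewrite (telescope_sumr (fun j => revolutions (th (j%:R / 2 ^+ n))))//.
rewrite natrX divff ?gt_eqF// mul0r.
have -> : th 1 = th 0 + 2 * pi * m%:~R by rewrite -thm; ring.
have [k /andP[k1 k2]] := revolutions_itv (th 0).
rewrite (@revolutions_eq k (th 0)) ?k1// (@revolutions_eq (k + m)) ?intrD; first ring.
by move: k1 k2; rewrite !intrD; lra.
Qed.

End CrossingNumbers.

Section StepFunctions.
Context d (T : measurableType d) {R : realType}.
Variable mu : {measure set T -> \bar R}.
Variable E : set T.
Hypotheses (mE : measurable E) (Efin : (mu E < +oo)%E).

Lemma integrable_indic_on (r : R) (A : set T) : measurable A ->
  mu.-integrable E (EFin \o (fun z => r * \1_A z)).
Proof.
move=> mA; apply: measurable_bounded_integrable => //.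
  by apply: measurable_funM => //; exact: measurable_indic.
exists `|r|; split; first exact: num_real.
move=> M rM z _ /=; rewrite normrM (le_trans _ (ltW rM))// ler_piMr//.
by rewrite indicE; case: (_ \in _); rewrite ?normr0 ?normr1.
Qed.

Lemma Rintegral_indic_on (r : R) (A : set T) : measurable A ->
  \int[mu]_(z in E) (r * \1_A z) = r * fine (mu (A `&` E)).
Proof.
move=> mA; rewrite RintegralZl//; last first.
  have := integrable_indic_on 1 mA; congr (integrable _ _).
  by apply/funext => z /=; rewrite mul1r.
by rewrite /Rintegral integral_indic.
Qed.

Lemma integrable_Rsum (I : Type) (s : seq I) (h : I -> T -> R) :
  (forall i, mu.-integrable E (EFin \o h i)) ->
  mu.-integrable E (EFin \o (fun z => \sum_(i <- s) h i z)).
Proof.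
move=> hI; have := @integrable_sum _ _ _ mu E mE _ s xpredT (fun i => EFin \o h i) (fun i _ => hI i).
by congr (integrable _ _); apply/funext => z /=; rewrite -sumEFin.
Qed.

Lemma Rintegral_sum (I : Type) (s : seq I) (h : I -> T -> R) :
  (forall i, mu.-integrable E (EFin \o h i)) ->
  \int[mu]_(z in E) (\sum_(i <- s) h i z) = \sum_(i <- s) \int[mu]_(z in E) h i z.
Proof.
move=> hI; elim: s => [|i s IH].
  rewrite big_nil -[RHS](mul0r (fine (mu E))) -Rintegral_cst//.
  by apply: eq_Rintegral => z _; rewrite big_nil.
rewrite big_cons -IH -RintegralD//; last exact: integrable_Rsum.
by apply: eq_Rintegral => z _; rewrite big_cons.
Qed.

End StepFunctions.

Section Green.
Context {R : realType}.
Implicit Types (p q z : R * R) (s t x y u v : R) (c : R -> R * R).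

Local Notation mu := (@lebesgue_measure R).
(* the measurable structure for which [lebesgue_measure] is a measure *)
Local Notation plane := (measurableTypeR R * measurableTypeR R)%type.
Local Notation mu2 := ((@lebesgue_measure R \x @lebesgue_measure R)%E).

Lemma lebesgue_rectangle (a b a' b' : R) (x y x' y' : bool) : a <= b -> a' <= b' ->
  mu2 ([set` Interval (BSide x a) (BSide y b)] `*` [set` Interval (BSide x' a') (BSide y' b')])
  = ((b - a) * (b' - a'))%:E.
Proof.
move=> ab ab'; rewrite product_measure1E//= !lebesgue_measure_itv/= !lte_fin.
have H (u v : R) : u <= v -> (if u < v then (v%:E - u%:E)%E else 0%E) = (v - u)%:E.
  by rewrite le_eqVlt => /orP[/eqP ->|->//]; rewrite ltxx subrr.
by rewrite (H _ _ ab) (H _ _ ab').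
Qed.

Variable B : R.
Hypothesis B0 : 0 <= B.

Definition box : set (R * R) := `[- B, B] `*` `[- B, B].
Let quadrant u v : set (R * R) := `]-oo, u[ `*` `]-oo, v].
Let lower v : set (R * R) := setT `*` `]-oo, v].

Lemma measurable_box : measurable (box : set plane).
Proof. by apply: measurableX. Qed.

Lemma box_lty : (mu2 box < +oo)%E.
Proof.
have BB : - B <= B by have := B0; lra.
by rewrite /box lebesgue_rectangle ?ltry.
Qed.

Let mquadrant u v : measurable (quadrant u v : set plane).
Proof. by apply: measurableX. Qed.

Let mlower v : measurable (lower v : set plane).
Proof. by apply: measurableX. Qed.

Let quadrant_box u v : - B <= u <= B -> - B <= v <= B ->
  fine (mu2 (quadrant u v `&` box)) = (u + B) * (v + B).
Proof.
move=> uB vB; have -> : quadrant u v `&` box = `[- B, u[ `*` `[- B, v].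
  apply/seteqP; split => -[z1 z2] /=; rewrite /quadrant /box /= !in_itv/=.
    by move=> [[? ?] [? ?]]; split; lra.
  by move=> [? ?]; split; split; lra.
by rewrite lebesgue_rectangle/= ?opprK//; lra.
Qed.

Let lower_box v : - B <= v <= B -> fine (mu2 (lower v `&` box)) = 2 * B * (v + B).
Proof.
move=> vB; have -> : lower v `&` box = `[- B, B] `*` `[- B, v].
  apply/seteqP; split => -[z1 z2] /=; rewrite /lower /box /= !in_itv/=.
    by move=> [[? ?] [? ?]]; split; lra.
  by move=> [? ?]; split; split; lra.
by rewrite lebesgue_rectangle/= ?opprK; [ring|lra|lra].
Qed.

Let level c (n j : nat) : set (R * R) := lower (c (j%:R / 2 ^+ n)).2.
(** The number of dyadic steps that pass the height of z, a discrete Banach indicatrix of the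
    ordinate. It grows under refinement and bounds the crossing numbers, so its limit dominates them
    all. *)
Let level_crossings c n z : R := \sum_(j < 2 ^ n) `|\1_(level c n j.+1) z - \1_(level c n j) z|.

Let crossingE p q z : crossing (p - z) (q - z) = \1_(quadrant p.1 q.2) z - \1_(quadrant p.1 p.2) z.
Proof.
rewrite /crossing !indicE /quadrant /= !subr_ge0 subr_gt0 mulrBr.
rewrite -!natrM !mulnb; congr (_%:R - _%:R); congr nat_of_bool;
by apply/idP/idP; rewrite !inE/= !in_itv/= => /andP.
Qed.

Let crossing_le p q z : `|crossing (p - z) (q - z)| <= `|\1_(lower q.2) z - \1_(lower p.2) z|.
Proof.
rewrite /crossing !indicE /lower /= !subr_ge0 subr_gt0 normrM.
have H v : (z \in [set: R] `*` `]-oo, v]) = (z.2 <= v).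
  by apply/idP/idP; rewrite !inE/= !in_itv/=; [case|split].
rewrite !H ler_piMl//; case: (_ < _); rewrite ?normr0 ?normr1//.
Qed.

Let level_crossings_mono c z : {homo (fun n => level_crossings c n z) : n m / (n <= m)%N >-> n <= m}.
Proof.
apply/nondecreasing_seqP => n; rewrite /level_crossings.
pose g j : R := \1_(level c n.+1 j) z.
have gE j : \1_(level c n j) z = g j.*2.
  rewrite /g /level; have -> : (j.*2)%:R / 2 ^+ n.+1 = j%:R / 2 ^+ n :> R by rewrite -muln2 natrM exprSr -mulf_div divff ?mulr1.
  by [].
have -> : \sum_(j < 2 ^ n) `|\1_(level c n j.+1) z - \1_(level c n j) z| =
   \sum_(0 <= j < 2 ^ n) `|g j.+1.*2 - g j.*2|.
  by rewrite big_mkord; apply: eq_bigr => j _; rewrite !gE.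
have -> : \sum_(j < 2 ^ n.+1) `|\1_(level c n.+1 j.+1) z - \1_(level c n.+1 j) z| =
   \sum_(0 <= j < 2 ^ n) (`|g j.*2.+1 - g j.*2| + `|g j.*2.+2 - g j.*2.+1|).
  rewrite -(big_mkord xpredT (fun j => `|g j.+1 - g j|)) expnS mul2n.
  elim: (2 ^ n)%N => [|N IH]; first by rewrite !big_geq.
  by rewrite doubleS !big_nat_recr//= IH addrA.
apply: ler_sum => j _; rewrite doubleS [leRHS]addrC.
exact: ler_distD.
Qed.

(** Each step contributes the signed area (x_j + B) (y_{j+1} - y_j), a difference of two quadrants
    cut by the box. The terms in B telescope to zero because the curve is closed. *)
Lemma dyadic_crossings_integral c n : c 0 = c 1 ->
  (forall t, 0 <= t <= 1 -> - B <= (c t).1 <= B /\ - B <= (c t).2 <= B) ->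
  mu2.-integrable box (EFin \o dyadic_crossings c n) /\
  \int[mu2]_(z in box) dyadic_crossings c n z =
  \sum_(j < 2 ^ n) (c (j%:R / 2 ^+ n)).1 * ((c (j.+1%:R / 2 ^+ n)).2 - (c (j%:R / 2 ^+ n)).2).
Proof.
move=> c01 cB; have mE := measurable_box; have Efin := box_lty.
have iI (S : set (R * R)) : measurable (S : set plane) -> mu2.-integrable box (EFin \o (fun z => 1 * \1_S z)).
  by move=> mS; apply: integrable_indic_on.
have d01 (j : nat) : (j <= 2 ^ n)%N -> 0 <= (j%:R / 2 ^+ n : R) <= 1.
  move=> jn; have n0 : (0 : R) < 2 ^+ n by rewrite exprn_gt0.
  by rewrite divr_ge0 ?(ltW n0)//= ler_pdivrMr// mul1r -natrX ler_nat.
pose x j := (c (j%:R / 2 ^+ n)).1; pose y j := (c (j%:R / 2 ^+ n)).2.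
pose h (j : 'I_(2 ^ n)) z : R := 1 * \1_(quadrant (x j) (y j.+1)) z - 1 * \1_(quadrant (x j) (y j)) z.
have hI j : mu2.-integrable box (EFin \o h j).
  have := integrableB mE (iI _ (mquadrant (x j) (y j.+1))) (iI _ (mquadrant (x j) (y j))).
  by congr (integrable _ _); apply/funext => z.
have fE : dyadic_crossings c n = fun z => \sum_(j <- index_enum 'I_(2 ^ n)) h j z.
  by apply/funext => z; apply: eq_bigr => j _; rewrite crossingE /h !mul1r.
rewrite fE; split; first exact: integrable_Rsum.
rewrite Rintegral_sum//.
have xB j : (j <= 2 ^ n)%N -> - B <= x j <= B by move=> /d01/cB[].
have yB j : (j <= 2 ^ n)%N -> - B <= y j <= B by move=> /d01/cB[].
transitivity (\sum_(j < 2 ^ n) (x j * (y j.+1 - y j) + B * (y j.+1 - y j))).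
  apply: eq_bigr => j _; have jn := ltn_ord j; have jn' := ltnW jn.
  rewrite (RintegralB mE (iI _ (mquadrant (x j) (y j.+1))) (iI _ (mquadrant (x j) (y j)))).
  rewrite (Rintegral_indic_on mE Efin 1 (mquadrant (x j) (y j.+1))).
  rewrite (Rintegral_indic_on mE Efin 1 (mquadrant (x j) (y j))).
  transitivity (1 * ((x j + B) * (y j.+1 + B)) - 1 * ((x j + B) * (y j + B))); last by ring.
  by congr (1 * _ - 1 * _); apply: quadrant_box; [exact: xB|exact: yB|exact: xB|exact: yB].
rewrite big_split/= -mulr_sumr -(big_mkord xpredT (fun j => y j.+1 - y j)) telescope_sumr//.
by rewrite /y natrX divff ?gt_eqF// mul0r -c01 subrr mulr0 addr0.
Qed.

(** Dominated convergence for the crossing numbers, whose integrals are the Riemann sums of x dy.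
    The dominating function [g] is the monotone limit of the level crossings, integrable because
    their integrals stay below 2 B K. *)
Lemma green (c : R -> R * R) (K : R) (W : R * R -> R) : 0 <= K -> c 0 = c 1 ->
  (forall t, 0 <= t <= 1 -> - B <= (c t).1 <= B /\ - B <= (c t).2 <= B) ->
  lip 0 1 K (snd \o c) -> measurable_fun (box : set plane) (W : plane -> R) ->
  {ae mu2, forall z, box z -> dyadic_crossings c n z @[n --> \oo] --> W z} ->
  \sum_(j < 2 ^ n) (c (j%:R / 2 ^+ n)).1 * ((c (j.+1%:R / 2 ^+ n)).2 - (c (j%:R / 2 ^+ n)).2)
    @[n --> \oo] --> \int[mu2]_(z in box) W z.
Proof.
move=> K0 c01 cB cK mW cW; have mE := measurable_box; have Efin := box_lty.
have iI (S : set (R * R)) : measurable (S : set plane) -> mu2.-integrable box (EFin \o (fun z => 1 * \1_S z)).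
  by move=> mS; apply: integrable_indic_on.
have d01 (n j : nat) : (j <= 2 ^ n)%N -> 0 <= (j%:R / 2 ^+ n : R) <= 1.
  move=> jn; have n0 : (0 : R) < 2 ^+ n by rewrite exprn_gt0.
  by rewrite divr_ge0 ?(ltW n0)//= ler_pdivrMr// mul1r -natrX ler_nat.
have fI n := (dyadic_crossings_integral n c01 cB).1.
pose h n (j : nat) z : R := 1 * \1_(level c n j.+1) z - 1 * \1_(level c n j) z.
have hI n j : mu2.-integrable box (EFin \o h n j).
  have := integrableB mE (iI _ (mlower (c (j.+1%:R / 2 ^+ n)).2)) (iI _ (mlower (c (j%:R / 2 ^+ n)).2)).
  by congr (integrable _ _); apply/funext => z.
have hN n j : mu2.-integrable box (EFin \o (fun z => `|h n j z|)).
  exact: (integrable_norm (hI n j)).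
have LE n : level_crossings c n = fun z => \sum_(j <- index_enum 'I_(2 ^ n)) `|h n j z|.
  by apply/funext => z; apply: eq_bigr => j _; rewrite /h !mul1r.
have LI n : mu2.-integrable box (EFin \o level_crossings c n).
  by rewrite LE; apply: integrable_Rsum.
(* Lower half-planes are nested, so [h n j] has a constant sign and the integral of its absolute
   value is 2 B |y_{j+1} - y_j|. *)
have hInt n (j : 'I_(2 ^ n)) : \int[mu2]_(z in box) `|h n j z| <= 2 * B * K / 2 ^+ n.
  pose y j := (c (j%:R / 2 ^+ n)).2.
  have jn := ltn_ord j; have jn' := ltnW jn.
  have yB i : (i <= 2 ^ n)%N -> - B <= y i <= B by move=> /d01/cB[].
  have hE : \int[mu2]_(z in box) h n j z = 2 * B * (y j.+1 - y j).
    rewrite (RintegralB mE (iI _ (mlower (y j.+1))) (iI _ (mlower (y j)))).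
    rewrite (Rintegral_indic_on mE Efin 1 (mlower (y j.+1))).
    rewrite (Rintegral_indic_on mE Efin 1 (mlower (y j))).
    transitivity (1 * (2 * B * (y j.+1 + B)) - 1 * (2 * B * (y j + B))); last by ring.
    by congr (1 * _ - 1 * _); apply: lower_box; exact: yB.
  have -> : \int[mu2]_(z in box) `|h n j z| = `|\int[mu2]_(z in box) h n j z|.
    have sub u v z : u <= v -> (\1_(lower u) z : R) <= \1_(lower v) z.
      move=> uv; rewrite !indicE; case: (boolP (z \in lower u)) => //.
      rewrite inE /lower/= in_itv/= => -[_ zu].
      by rewrite mem_set// /lower /= in_itv/=; split=> //; lra.
    have [yy|/ltW yy] := leP (y j) (y j.+1).
      rewrite ger0_norm; first by apply: eq_Rintegral => z _; rewrite ger0_norm// /h !mul1r subr_ge0 sub.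
      by apply: Rintegral_ge0 => z _; rewrite /h !mul1r subr_ge0 sub.
    rewrite hE ler0_norm -?hE.
      rewrite -mulN1r -RintegralZl//; apply: eq_Rintegral => z _.
      by rewrite mulN1r ler0_norm// /h !mul1r subr_le0 sub.
    by rewrite hE mulr_ge0_le0 ?subr_le0// mulr_ge0.
  rewrite hE normrM ger0_norm ?mulr_ge0// -mulrA ler_wpM2l ?mulr_ge0//.
  apply: (le_trans (cK _ _ (d01 _ _ jn) (d01 _ _ jn'))).
  rewrite -natr1 -mulrBl addrC addKr mul1r ger0_norm ?invr_ge0 ?exprn_ge0//.
have LInt n : \int[mu2]_(z in box) level_crossings c n z <= 2 * B * K.
  rewrite LE Rintegral_sum//.
  apply: (le_trans (ler_sum _ (fun j _ => hInt n j))).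
  rewrite sumr_const card_ord -[_ *+ (2 ^ n)]mulr_natr natrX mulfVK// gt_eqF//.
pose g (z : plane) : \bar R := limn (fun n => (level_crossings c n z)%:E).
have mL n : measurable_fun box (EFin \o level_crossings c n).
  exact: measurable_int (LI n).
have L0 n z : 0 <= level_crossings c n z by apply: sumr_ge0.
have mono z : {homo (fun n => (level_crossings c n z)%:E) : n m / (n <= m)%N >-> (n <= m)%E}.
  by move=> n m nm; rewrite lee_fin level_crossings_mono.
have gcvg (z : plane) : (level_crossings c n z)%:E @[n --> \oo] --> g z.
  have : cvgn (fun n => (level_crossings c n z)%:E) by apply: ereal_nondecreasing_is_cvgn; exact: mono.
  by [].
have gI : mu2.-integrable box g.
  apply/integrableP; split.
    by apply: (@emeasurable_fun_cvg _ _ _ _ _ _ mL) => z _; exact: gcvg.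
  have -> : (\int[mu2]_(z in box) `|g z| = \int[mu2]_(z in box) g z)%E.
    apply: eq_integral => z _; rewrite gee0_abs//.
    apply: lime_ge; first by apply/cvg_ex; exists (g z).
    by apply: nearW => n; rewrite lee_fin.
  rewrite /g (monotone_convergence mu2 mE mL (fun n z _ => L0 n z) (fun z _ => mono z)).
  apply: (@le_lt_trans _ _ (2 * B * K)%:E); last exact: ltry.
  apply: lime_le.
    apply: ereal_nondecreasing_is_cvgn => n m nm; apply: ge0_le_integral => //.
    - by move=> z _; rewrite /= lee_fin.
    - exact: mL.
    - exact: mL.
    - by move=> z _; exact: mono.
  apply: nearW => n; rewrite -(fineK (integrable_fin_num mE (LI n))) lee_fin.
  exact: LInt.
have [||||WI _ +] := @dominated_convergence _ _ _ mu2 box mE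
    (fun n => EFin \o dyadic_crossings c n) (EFin \o W) g (fun n => measurable_int _ (fI n)).
- exact/measurable_EFinP.
- move: cW; apply: filterS; first exact: (ae_filter_ringOfSetsType mu2).
  move=> z H Bz; apply/fine_cvgP; split; [exact: nearW|exact: H Bz].
- exact: gI.
- apply: aeW => z n _ /=; apply: (@le_trans _ _ (level_crossings c n z)%:E).
    rewrite lee_fin /dyadic_crossings (le_trans (ler_norm_sum _ _ _))//.
    by apply: ler_sum => j _; exact: crossing_le.
  apply: lime_ge; first by apply/cvg_ex; exists (g z).
  by exists n => // m nm; exact: mono.
rewrite -(fineK (integrable_fin_num mE WI)) => /fine_cvg; apply: cvg_trans; apply: near_eq_cvg.
by apply: nearW => n; rewrite -(dyadic_crossings_integral n c01 cB).2.
Qed.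

End Green.

Section RiemannSums.
Context {R : realType}.
Implicit Types (a b s t : R).
Local Notation mu := (@lebesgue_measure R).

(** The increment of the primitive [Q] splits over 2^n steps, each of which differs from its term in
    the sum by at most C (b - a)^2 4^-n. *)
Lemma riemann_sums_area a b (K : R) (f1 f2 : R -> R) (h := fun t => a + t * (b - a)) :
  a < b -> 0 <= K -> lip a b K f1 -> lip a b K f2 ->
  \sum_(j < 2 ^ n) f1 (h (j%:R / 2 ^+ n)) *
     (f2 (h (j.+1%:R / 2 ^+ n)) - f2 (h (j%:R / 2 ^+ n))) @[n --> \oo]
  --> \int[mu]_(t in `[a, b]) (f1 t * derive1 f2 t).
Proof.
move=> ab K0 fK1 fK2.
have [Q [C [C0 Qf _ _ ->]]] := area_primitive ab K0 fK1 fK2.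
pose S n := \sum_(j < 2 ^ n) f1 (h (j%:R / 2 ^+ n)) *
     (f2 (h (j.+1%:R / 2 ^+ n)) - f2 (h (j%:R / 2 ^+ n))).
have H n : `|Q b - Q a - S n| <= C * (b - a) ^+ 2 * 2^-1 ^+ n.
  have n0 : (0 : R) < 2 ^+ n by rewrite exprn_gt0.
  have d01 (j : nat) : (j <= 2 ^ n)%N -> a <= h (j%:R / 2 ^+ n) <= b.
    move=> jn; have : 0 <= (j%:R / 2 ^+ n : R) <= 1.
      by rewrite divr_ge0 ?(ltW n0)//= ler_pdivrMr// mul1r -natrX ler_nat.
    rewrite /h; move: (_ / _) => x /andP[x0 x1].
    have : 0 <= x * (b - a) by rewrite mulr_ge0//; lra.
    have : 0 <= (1 - x) * (b - a) by rewrite mulr_ge0//; lra.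
    by lra.
  have -> : Q b - Q a = \sum_(j < 2 ^ n) (Q (h (j.+1%:R / 2 ^+ n)) - Q (h (j%:R / 2 ^+ n))).
    rewrite -(big_mkord xpredT (fun j => Q (h (j.+1%:R / 2 ^+ n)) - Q (h (j%:R / 2 ^+ n)))).
    rewrite (telescope_sumr (fun j => Q (h (j%:R / 2 ^+ n))))// natrX divff ?gt_eqF//.
    have -> : h 1 = b by rewrite /h; ring.
    by rewrite /h !mul0r addr0.
  rewrite -sumrB (le_trans (ler_norm_sum _ _ _))//.
  apply: (@le_trans _ _ (\sum_(j < 2 ^ n) C * (b - a) ^+ 2 * (2^-1 ^+ n) ^+ 2)).
    apply: ler_sum => j _; apply: (le_trans (Qf _ _ _ _)); [exact/d01/ltnW|exact: d01|].
    rewrite -mulrA ler_wpM2l// -exprMn /h -natr1 exprVn.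
    by rewrite le_eqVlt; apply/orP; left; apply/eqP; congr (_ ^+ 2); ring.
  rewrite sumr_const card_ord -[_ *+ (2 ^ n)]mulr_natr natrX -mulrA.
  by rewrite [_ ^+ 2 * _]mulrAC expr2 exprVn mulVf ?mul1r// gt_eqF.
apply/cvgrPdist_le => e e0.
have : C * (b - a) ^+ 2 * 2^-1 ^+ n @[n --> \oo] --> (0 : R).
  rewrite -[X in _ --> X](mulr0 (C * (b - a) ^+ 2)); apply: cvgMr; apply: cvg_expr.
  by rewrite ger0_norm//; lra.
move=> /cvgrPdist_le/(_ e e0); apply: filterS => n; rewrite sub0r normrN => Hn.
by apply: (le_trans (H n)); apply: (le_trans (ler_norm _)).
Qed.

End RiemannSums.

(** * Measurable and negligible sets of the plane *)

Section PlaneMeasure.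
Context {R : realType}.
Local Notation plane := (measurableTypeR R * measurableTypeR R)%type.
Local Notation mu2 := ((@lebesgue_measure R \x @lebesgue_measure R)%E).

Lemma open_measurable_plane (D : set (R * R)) : open D -> measurable (D : set plane).
Proof.
move=> oD.
pose rect (q : rat * rat * (rat * rat)) : set (R * R) :=
  `]ratr q.1.1, ratr q.1.2[ `*` `]ratr q.2.1, ratr q.2.2[.
(* A rectangle that leaves [D] contributes the empty set, so the union may run over all quadruples
   of rationals. *)
pose F q := rect q `&` [set _ | rect q `<=` D].
have -> : D = \bigcup_q F q.
  apply/seteqP; split => [[x y] Dxy|z [q _]]; last by case=> + qD => /qD.
  have := oD; rewrite openE => /(_ _ Dxy) /nbhs_ballP[e /= e0 He].
  have [p1 p1x] : exists p : rat, ratr p \in `]x - e, x[.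
    by have [|p] := @rat_in_itvoo R (x - e) x; [lra|move=> ?; exists p].
  have [p2 p2x] : exists p : rat, ratr p \in `]x, x + e[.
    by have [|p] := @rat_in_itvoo R x (x + e); [lra|move=> ?; exists p].
  have [p3 p3x] : exists p : rat, ratr p \in `]y - e, y[.
    by have [|p] := @rat_in_itvoo R (y - e) y; [lra|move=> ?; exists p].
  have [p4 p4x] : exists p : rat, ratr p \in `]y, y + e[.
    by have [|p] := @rat_in_itvoo R y (y + e); [lra|move=> ?; exists p].
  move: p1x p2x p3x p4x; rewrite !in_itv/= => p1x p2x p3x p4x.
  exists (p1, p2, (p3, p4)) => //; split; first by rewrite /rect /= !in_itv/=; split; lra.
  move=> [u v]; rewrite /rect /= !in_itv/= => -[? ?]; apply: He.
  by split; rewrite /ball /= ltr_norml; lra.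
apply: (@countable_bigcupT_measurable _ plane); first exact: countableP.
move=> q; rewrite /F; have [qD|qD] := pselect (rect q `<=` D).
  rewrite (_ : [set _ | _] = setT); last by apply/seteqP; split.
  by rewrite setIT; apply: measurableX.
rewrite (_ : [set _ | _] = set0) ?setI0; last by apply/seteqP; split.
exact: measurable0.
Qed.

(** At scale 2^-n the image is covered by 2^n + 1 squares of side 2 K / 2^n, of total area at most 8
    K^2 / 2^n. *)
Lemma lipschitz_image_negligible (h : R -> R * R) : [lipschitz h s | s in `[0, 1]] ->
  mu2.-negligible (h @` `[0, 1]).
Proof.
move=> [M [_ MH]]; pose K : R := Num.max 0 (M + 1).
have K0 : 0 <= K by rewrite le_max lexx.
have hK (s t : R) : 0 <= s <= 1 -> 0 <= t <= 1 -> `|h s - h t| <= K * `|s - t|.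
  move=> s01 t01; have /MH/(_ (s, t)) : M < K by rewrite lt_max; apply/orP; right; lra.
  by rewrite /= !in_itv/=; apply.
pose e n : R := K / 2 ^+ n.
have e0 n : 0 <= e n by rewrite divr_ge0// exprn_ge0.
pose sq n (j : nat) : set plane :=
  `[(h (j%:R / 2 ^+ n)).1 - e n, (h (j%:R / 2 ^+ n)).1 + e n] `*`
  `[(h (j%:R / 2 ^+ n)).2 - e n, (h (j%:R / 2 ^+ n)).2 + e n].
have msq n j : measurable (sq n j) by apply: measurableX.
pose U n := \big[setU/set0]_(j < (2 ^ n).+1) sq n j.
have mU n : measurable (U n) by apply: bigsetU_measurable => j _; exact: msq.
pose A := \bigcap_n U n.
have mA : measurable A by apply: bigcapT_measurable.
exists A; split=> //; last first.
  move=> _ [s s01 <-] n _; move: s s01 => s; rewrite /= in_itv/= => s01.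
  have n0 : (0 : R) < 2 ^+ n by rewrite exprn_gt0.
  have s0 : 0 <= s * 2 ^+ n by rewrite mulr_ge0 ?(ltW n0)//; lra.
  have /andP[t1 t2] := truncn_itv s0; set j := Num.truncn _ in t1 t2.
  have jn : (j < (2 ^ n).+1)%N.
    rewrite ltnS -(ler_nat R) natrX (le_trans t1)// ler_piMl ?(ltW n0)//; lra.
  rewrite /U -bigcup_mkord; exists j => //.
  have j01 : 0 <= (j%:R / 2 ^+ n : R) <= 1.
    by rewrite divr_ge0 ?(ltW n0)//= ler_pdivrMr// mul1r -natrX ler_nat -ltnS.
  have : `|h s - h (j%:R / 2 ^+ n)| <= e n.
    apply: (le_trans (hK _ _ s01 j01)); rewrite ler_wpM2l// ger0_norm.
      by rewrite lerBlDr -(ler_pM2r n0) mulrDl mulVf ?gt_eqF// mulfVK ?gt_eqF// addrC natr1 ltW.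
    by rewrite subr_ge0 ler_pdivrMr.
  rewrite prod_normE ge_max !ler_norml /sq /= !in_itv/=.
  by move=> /andP[? ?]; split; lra.
have An n : (mu2 A <= ((8 * K ^+ 2) * 2^-1 ^+ n)%:E)%E.
  have n0 : (0 : R) < 2 ^+ n by rewrite exprn_gt0.
  have := @content_subadditive _ _ _ mu2 A (sq n) (2 ^ n).+1 (fun j _ => msq n j) mA.
  move=> /(_ _)/le_trans; apply; first by move=> z /(_ n I).
  have sqE j : mu2 (sq n j) = ((2 * e n) * (2 * e n))%:E.
    by have en := e0 n; rewrite /sq lebesgue_rectangle; [congr (_%:E); ring|lra|lra].
  rewrite (eq_bigr (fun=> ((2 * e n) * (2 * e n))%:E)); last by move=> j _; exact: sqE.
  rewrite sumEFin lee_fin sumr_const card_ord -[_ *+ _.+1]mulr_natr -[(2 ^ n).+1%:R]natr1 natrX.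
  have -> : 8 * K ^+ 2 * 2^-1 ^+ n = (2 * e n * (2 * e n)) * (2 * 2 ^+ n).
    by rewrite /e exprVn; field; rewrite gt_eqF.
  rewrite ler_wpM2l ?mulr_ge0// mulrDl !mul1r lerD2l.
  by rewrite -[leLHS](expr0 (2 : R)) ler_eXn2l// ltr1n.
have Af : mu2 A \is a fin_num.
  by rewrite ge0_fin_numE// (le_lt_trans (An 0%N))// ltry.
rewrite -(fineK Af); congr (_%:E); apply/eqP; rewrite eq_le fine_ge0// andbT.
apply: (@geometric_ler _ _ _ (8 * K ^+ 2)) => n.
by rewrite add0r -lee_fin fineK.
Qed.

End PlaneMeasure.

(** * Winding numbers in the exterior of a Jordan domain *)

Section LoopFactor.
Context {R : realType}.

(* A continuous bijection of compact Hausdorff spaces is a homeomorphism. *)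
Lemma factor_within (T : topologicalType) (l : R -> T) (h : R -> R) : hausdorff_space T ->
  {within `[0, 1], continuous l} -> {within `[0, 1], continuous h} ->
  (forall s t, 0 <= s <= 1 -> 0 <= t <= 1 -> l s = l t -> h s = h t) ->
  exists2 phi : T -> R, {within l @` `[0, 1], continuous phi} &
    forall t, 0 <= t <= 1 -> phi (l t) = h t.
Proof.
move=> hT cl ch lh.
have /choice[sel selP] : forall p, exists s : R, (l @` `[0, 1]) p -> 0 <= s <= 1 /\ l s = p.
  move=> p; have [[s s01 <-]|np] := pselect ((l @` `[0, 1]) p); last by exists 0.
  by exists s => _; move: s01; rewrite /= in_itv.
have phiE (t : R) : 0 <= t <= 1 -> h (sel (l t)) = h t.
  move=> t01; have [|s01 lE] := selP (l t); first by exists t; rewrite //= in_itv.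
  exact: lh.
exists (h \o sel) => //.
apply/continuous_closedP => S clS; apply/closed_subspaceP.
have /continuous_closedP/(_ S clS)/closed_subspaceP[V clV VE] := ch.
exists (l @` (V `&` `[0, 1])).
  apply: compact_closed => //; apply: continuous_compact.
    by apply: continuous_subspaceW cl; exact: subIsetr.
  apply: (subclosed_compact _ (@segment_compact R 0 1)); last exact: subIsetr.
  by apply: closedI => //; exact: interval_closed.
rewrite VE; apply/seteqP; split => p.
  move=> [[t [St t01] <-] lt]; split=> //; change (S (h (sel (l t)))); rewrite phiE//.
move=> [Sp lp]; split=> //; have [s01 sE] := selP p lp.
exists (sel p) => //; split=> //=; by rewrite in_itv.
Qed.

End LoopFactor.

(** * Complex powers and directions *)

Section ComplexPowers.
Context {R : realType}.
Implicit Types (p q z d : R * R) (s t : R).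

Definition cmul p q : R * R := (p.1 * q.1 - p.2 * q.2, p.1 * q.2 + p.2 * q.1).
Definition cconj p : R * R := (p.1, - p.2).
(** Negative powers are powers of the conjugate instead of the inverse: the modulus differs, the
    argument is the same, and the results are normalized by [direction]. *)
Definition cpow (k : int) p : R * R :=
  match k with
  | Posz n => iter n (cmul p) (1, 0)
  | Negz n => iter n.+1 (cmul (cconj p)) (1, 0)
  end.
Definition direction p : R * R := (p.1 / Num.sqrt (dot p p), p.2 / Num.sqrt (dot p p)).

Lemma angle_cmul p q s t : angle p s -> angle q t -> angle (cmul p q) (s + t).
Proof.
move=> [r r0 ->] [r' r'0 ->]; exists (r * r'); first exact: mulr_gt0.
by rewrite /cmul /= cosD sinD; congr pair; ring.
Qed.

Lemma angle_cpow (k : int) p t : angle p t -> angle (cpow k p) (k%:~R * t).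
Proof.
have H (n : nat) q u : angle q u -> angle (iter n (cmul q) (1, 0)) (n%:R * u).
  move=> aq; elim: n => [|n IH]; first by rewrite mul0r; have := angle_unit (0 : R); rewrite cos0 sin0.
  by rewrite -natr1 mulrDl mul1r addrC /=; exact: angle_cmul.
case: k => n ap; first exact: H.
rewrite NegzE mulrNz mulNr -mulrN; apply: H.
by have [r r0 ->] := ap; exists r => //; rewrite cosN sinN mulrN.
Qed.

Lemma direction_angle p t : angle p t -> direction p = (cos t, sin t).
Proof.
move=> [r r0 ->]; rewrite /direction /dot /=.
have -> : r * cos t * (r * cos t) + r * sin t * (r * sin t) = r ^+ 2.
  by rewrite -[RHS]mulr1 -(cos2Dsin2 t); ring.
by rewrite sqrtr_sqr ger0_norm ?(ltW r0)//; congr pair; field; rewrite gt_eqF.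
Qed.

Lemma cmul_cvg (T : Type) (F : set_system T) (FF : Filter F) (f g : T -> R * R) p q :
  f x @[x --> F] --> p -> g x @[x --> F] --> q -> cmul (f x) (g x) @[x --> F] --> cmul p q.
Proof.
move=> fp gq; apply: pair_cvg; [apply: cvgB|apply: cvgD]; apply: cvgM;
  by [exact: fst_cvg|exact: snd_cvg].
Qed.

Lemma cpow_cvg (k : int) (T : Type) (F : set_system T) (FF : Filter F) (f : T -> R * R) p :
  f x @[x --> F] --> p -> cpow k (f x) @[x --> F] --> cpow k p.
Proof.
have H (n : nat) (g : T -> R * R) q : g x @[x --> F] --> q ->
    iter n (cmul (g x)) (1, 0) @[x --> F] --> iter n (cmul q) (1, 0).
  by move=> gq; elim: n => [|n IH]; [exact: cvg_cst|exact: cmul_cvg].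
case: k => n fp; first exact: H.
by apply: (H n.+1 (cconj \o f)); apply: pair_cvg; [exact: fst_cvg|apply: cvgN; exact: snd_cvg].
Qed.

Lemma direction_cvg (T : Type) (F : set_system T) (FF : Filter F) (f : T -> R * R) p :
  p <> 0 -> f x @[x --> F] --> p -> direction (f x) @[x --> F] --> direction p.
Proof.
move=> p0 fp; have d0 := dot_gt0 p0.
have Hs : (Num.sqrt (dot (f x) (f x)))^-1 @[x --> F] --> (Num.sqrt (dot p p))^-1.
  apply: cvgV; first by rewrite gt_eqF// sqrtr_gt0.
  by apply: continuous_cvg; [exact: sqrt_continuous|exact: dot_cvg].
by apply: pair_cvg; apply: cvgM => //; [exact: fst_cvg|exact: snd_cvg].
Qed.

(** The norm is the sup norm. If u1 is the larger coordinate of [p], its term exceeds u1^2 / 2,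
    while the term of the other coordinate is at least - u1^2 / 16. *)
Lemma dot_perturb p d : 2 * `|d| < `|p| -> 0 < dot p (p + d).
Proof.
have aux (u1 u2 d1 d2 : R) : `|u2| <= `|u1| -> 2 * `|d1| < `|u1| -> 2 * `|d2| < `|u1| ->
    0 < u1 * (u1 + d1) + u2 * (u2 + d2).
  move=> u21 h1 h2.
  have e1 : `|u1| * `|u1| = u1 * u1 by rewrite -normrM ger0_norm -?expr2 ?sqr_ge0.
  have e2 : `|u2| * `|u2| = u2 * u2 by rewrite -normrM ger0_norm -?expr2 ?sqr_ge0.
  have b1 : - (`|u1| * `|d1|) <= u1 * d1 by rewrite -normrM lerNl -normrN ler_norm.
  have b2 : - (`|u2| * `|d2|) <= u2 * d2 by rewrite -normrM lerNl -normrN ler_norm.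
  have := normr_ge0 u2; have := normr_ge0 d1; have := normr_ge0 d2.
  nra.
move=> dp; have d1 : `|d.1| <= `|d| by rewrite prod_normE le_max lexx.
have d2 : `|d.2| <= `|d| by rewrite prod_normE le_max lexx orbT.
move: dp; rewrite [`|p|]prod_normE /dot /=.
have [h|/ltW h] := leP `|p.1| `|p.2| => dp; first rewrite addrC.
  by apply: aux => //; lra.
by apply: aux => //; lra.
Qed.

End ComplexPowers.

Section JordanOutside.
Context {R : realType}.
Implicit Types (p q z : R * R) (s t w : R) (c l : R -> R * R).

Let J l := l @` `[0, 1].

Lemma wind_int c w : c 0 = c 1 -> wind c w -> exists k : int, w = 2 * pi * k%:~R.
Proof.
move=> c01 [th [_ ath <-]]; apply: cos_eq1; apply: (@angle_cosB _ (c 0)).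
  by apply: ath; rewrite lexx ler01.
by rewrite c01; apply: ath; rewrite lexx ler01.
Qed.

Let continuous_sub l p : {within `[0, 1], continuous l} ->
  {within `[0, 1], continuous (fun t => l t - p)}.
Proof.
move=> cl; apply/subspace_continuousP => x x01; apply: cvgB; last exact: cvg_cst.
by move/subspace_continuousP : cl; exact.
Qed.

Lemma wind_cst p : p <> 0 -> wind (fun=> p) 0.
Proof.
move=> /angle_ex[t pt]; exists (fun=> t); split=> //; last exact: subrr.
by move=> x; exact: cst_continuous.
Qed.

Lemma closed_loop l : {within `[0, 1], continuous l} -> closed (J l).
Proof.
move=> cl; apply: compact_closed; first exact: norm_hausdorff.
by apply: continuous_compact => //; exact: segment_compact.
Qed.

(** Moving the base point by less than half its distance to the loop turns every direction by less
    than a right angle. *)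
Lemma wind_near l p w : {within `[0, 1], continuous l} -> l 0 = l 1 -> ~ J l p ->
  wind (fun t => l t - p) w ->
  \forall q \near p, ~ J l q /\ wind (fun t => l t - q) w.
Proof.
move=> cl l01 Jp wp.
have oJ : open (~` J l) by apply: closed_openC; exact: closed_loop.
have /nbhs_ballP[e /= e0 He] : nbhs p (~` J l) by exact: open_nbhs_nbhs.
apply/nbhs_ballP; exists (e / 2); first by rewrite /= divr_gt0.
move=> q pq; split; first by apply: He; apply: le_ball pq; lra.
apply: wind_dot_gt0 wp; rewrite ?l01//; try exact: continuous_sub.
move=> t t01; have -> : l t - q = (l t - p) + (p - q) by rewrite addrA subrK.
apply: dot_perturb; move: pq; rewrite ball_prod_normE /= /ball_ /= => pq.
apply: (@lt_le_trans _ _ e); first by lra.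
rewrite leNgt; apply/negP => lp; apply: (He (l t)); last by exists t; rewrite //= in_itv.
by rewrite ball_prod_normE /= /ball_ /= distrC.
Qed.

Lemma wind_far l : {within `[0, 1], continuous l} -> l 0 = l 1 ->
  exists M : R, 0 < M /\ forall p, M < `|p| -> ~ J l p /\ wind (fun t => l t - p) 0.
Proof.
move=> cl l01.
have /compact_bounded[M [_ MH]] : compact (J l).
  by apply: continuous_compact => //; exact: segment_compact.
pose M1 := Num.max 0 (M + 1).
have M10 : 0 <= M1 by rewrite le_max lexx.
have HM p : J l p -> `|p| <= M1 by apply: MH; rewrite lt_max; apply/orP; right; lra.
exists (2 * M1 + 1); split; first by lra.
move=> p pM; split; first by move=> /HM; lra.
have p0 : - p <> 0 by move=> /eqP; rewrite oppr_eq0 => /eqP p0; move: pM; rewrite p0 normr0; lra.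
apply: wind_dot_gt0 (wind_cst p0); rewrite ?l01//.
- by move=> x; exact: cst_continuous.
- exact: continuous_sub.
move=> t t01; rewrite [l t - p]addrC; apply: dot_perturb; rewrite normrN.
have : `|l t| <= M1 by apply: HM; exists t; rewrite //= in_itv.
by lra.
Qed.

(** Suppose w = 2 pi k is nonzero, and let [C] consist of the points off [D] and off the loop about
    which [l] turns by w. A nowhere zero map [Q] of the plane is glued along the loop from two
    pieces: on [C] and the loop, the k-th power of the direction from z0, corrected by a phase;
    outside [C], the direction from z. The first piece is defined since z0 is in [D], the second
    since z is in [C]. On a large circle [Q] is the direction from z and turns once, yet it has a
    continuous argument on a box containing that circle and so turns by 0. *)
Lemma winding_outside (D : set (R * R)) l z0 z w :
  {within `[0, 1], continuous l} -> l 0 = l 1 -> {in `[0, 1[ &, injective l} ->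
  open D -> closure D `\` interior D = J l -> D z0 ->
  wind (fun t => l t - z0) (2 * pi) -> ~ D z -> ~ J l z ->
  wind (fun t => l t - z) w -> w = 0.
Proof.
move=> cl l01 injl oD bD Dz0 w0 nDz nJz wz.
have [k wk] : exists k : int, w = 2 * pi * k%:~R by apply: wind_int wz; rewrite l01.
apply: contrapT => wneq0; rewrite wk in wz wneq0 *; clear w wk.
set w := 2 * pi * k%:~R in wz wneq0.
have nDJ p : D p -> ~ J l p.
  by rewrite -bD => Dp -[_]; apply; move: oD; rewrite openE => /(_ _ Dp).
have clDJ : closure D `<=` D `|` J l.
  move=> p cp; have [Dp|nDp] := pselect (D p); [by left|right].
  by rewrite -bD; split=> // /interior_subset.
pose C := [set p | [/\ ~ D p, ~ J l p & wind (fun t => l t - p) w]].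
have oC : open C.
  rewrite openE => p [nDp nJp wp]; rewrite /interior.
  have : nbhs p (~` closure D).
    apply: open_nbhs_nbhs; split; first exact/closed_openC/closed_closure.
    by move=> /clDJ[].
  have := wind_near cl l01 nJp wp; apply: filterS2 => q [nJq wq] ncq.
  by split=> // Dq; apply: ncq; exact: subset_closure.
have cJ := closed_loop cl.
pose S := C `|` J l.
(* Winding numbers are locally constant off the loop, so a limit point of [S] off the loop keeps the
   value w; it is not in [D], which is open and disjoint from [S]. *)
have cS : closed S.
  move=> p cp; have [Jp|nJp] := pselect (J l p); [by right|left].
  have [w' wp] : exists w', wind (fun t => l t - p) w'.
    apply: wind_ex; first exact: continuous_sub.
    by move=> t t01 /eqP; rewrite subr_eq0 => /eqP lp; apply: nJp; exists t; rewrite //= in_itv.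
  have near_p := wind_near cl l01 nJp wp.
  have [q [[[nDq nJq wq]|Jq] [nJq' wq']]] := cp _ near_p; last by [].
  have ww : w' = w by apply: wind_uniq wq' wq.
  rewrite ww in wp; split=> // Dp.
  have [q' [[[nDq' _ _]|Jq'] Dq']] := cp _ (open_nbhs_nbhs (conj oD Dp)) => //.
  exact: nDJ Dq' Jq'.
have Cz : C z by [].
have nSz0 : ~ S z0 by case=> [[]//|]; exact: nDJ.
have [thz [cthz athz ewz]] := wz; have [th0 [cth0 ath0 ew0]] := w0.
(* The direction from z and the k-th power of the direction from z0 turn by the same amount along
   the loop, so their quotient has a single-valued argument. *)
pose h t := thz t - k%:~R * th0 t.
have ch : {within `[0, 1], continuous h}.
  apply/subspace_continuousP => x x01; apply: cvgB.
    by move/subspace_continuousP : cthz; exact.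
  by apply: cvgM; [exact: cvg_cst|move/subspace_continuousP : cth0; exact].
have h01 : h 0 = h 1.
  have -> : h 1 = h 0 + ((thz 1 - thz 0) - k%:~R * (th0 1 - th0 0)) by rewrite /h; ring.
  by rewrite ewz ew0 /w; ring.
have lh s t : 0 <= s <= 1 -> 0 <= t <= 1 -> l s = l t -> h s = h t.
  move=> s01 t01 st.
  have lt1 (x : R) : 0 <= x <= 1 -> x <> 1 -> x \in `[0, 1[.
    by move=> x01 /eqP x1; rewrite in_itv/= lt_neqAle x1 /=; lra.
  have in0 : 0 \in `[0 : R, 1[ by rewrite in_itv/= lexx ltr01.
  have [s1|s1] := pselect (s = 1); have [t1|t1] := pselect (t = 1).
  - by rewrite s1 t1.
  - by rewrite s1 -h01; congr h; apply: injl; [exact: in0|exact: lt1|rewrite l01 -s1].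
  - by rewrite t1 -h01; congr h; apply: injl; [exact: lt1|exact: in0|rewrite l01 -t1].
  - by congr h; apply: injl; rewrite ?lt1.
have [phi cphi phiE] := factor_within (@norm_hausdorff _ _) cl ch lh.
have [M [M0 phiM]] : exists M : R, 0 < M /\ forall p, J l p -> `|phi p| <= M.
  have /compact_bounded[M [_ MH]] : compact (phi @` J l).
    apply: continuous_compact => //; apply: continuous_compact => //; exact: segment_compact.
  exists (Num.max 1 (M + 1)); split; first by rewrite lt_max ltr01.
  by move=> p Jp; apply: (MH _ _ (phi p)); [rewrite lt_max; apply/orP; right; lra|exists p].
(* Tietze's theorem extends the phase from the loop to the plane. *)
have [g [gphi cg _]] := continuous_bounded_extension (@pseudometric_normal R _) cJ M0 cphi phiM.
have gE t : 0 <= t <= 1 -> g (l t) = h t.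
  move=> t01; rewrite -gphi ?phiE// inE; by exists t; rewrite //= in_itv.
pose QC p := cmul (cos (g p), sin (g p)) (direction (cpow k (p - z0))).
pose QO p := direction (p - z).
pose Q p := if p \in S then QC p else QO p.
have neq p q : p <> q -> p - q <> 0 by move=> pq /eqP; rewrite subr_eq0 => /eqP.
have angQC p : p <> z0 -> exists t, angle (QC p) t.
  move=> /neq/angle_ex[t /(angle_cpow k)/direction_angle pt].
  by exists (g p + k%:~R * t); rewrite /QC pt; apply: angle_cmul; exact: angle_unit.
have angQO p : p <> z -> exists t, angle (QO p) t.
  move=> /neq/angle_ex[t pt]; exists t.
  by rewrite /QO (direction_angle pt); exact: angle_unit.
have Q0 p : Q p <> 0.
  rewrite /Q; case: ifPn => [/set_mem Sp|/negP nSp].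
    by have [|t] := angQC p; [move=> pz; apply: nSz0; rewrite -pz|exact: angle_neq0].
  have [|t] := angQO p; last exact: angle_neq0.
  by move=> pz; apply: nSp; rewrite pz inE; left.
have QJ p : J l p -> QC p = QO p.
  move=> [t]; rewrite /= in_itv/= => t01 <-; rewrite /QO (direction_angle (athz _ t01)).
  rewrite /QC (direction_angle (angle_cpow k (ath0 _ t01))) gE//.
  have [r r0] := angle_cmul (angle_unit (h t)) (angle_unit (k%:~R * th0 t)).
  have -> : h t + k%:~R * th0 t = thz t by rewrite /h; ring.
  move=> QE; rewrite QE; suff -> : r = 1 by rewrite !mul1r.
  have : dot (cmul (cos (h t), sin (h t)) (cos (k%:~R * th0 t), sin (k%:~R * th0 t)))
    (cmul (cos (h t), sin (h t)) (cos (k%:~R * th0 t), sin (k%:~R * th0 t))) = 1.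
    rewrite /dot /cmul /=.
    have e1 := cos2Dsin2 (h t); have e2 := cos2Dsin2 (k%:~R * th0 t).
    transitivity ((cos (h t) ^+ 2 + sin (h t) ^+ 2) * (cos (k%:~R * th0 t) ^+ 2 + sin (k%:~R * th0 t) ^+ 2)); first by ring.
    by rewrite e1 e2 mulr1.
  rewrite QE /dot /= => rE; have : r ^+ 2 = 1.
    by rewrite -rE -[LHS]mulr1 -(cos2Dsin2 (thz t)); ring.
  by move=> /eqP; rewrite sqrf_eq1 => /orP[/eqP//|/eqP r1]; move: r0; rewrite r1; lra.
have cQ : continuous Q.
  have ST : S `|` (~` C) = setT by apply/seteqP; split=> // p _; have [] := pselect (C p); [left; left|right].
  rewrite continuous_subspace_setT -ST; apply: withinU_continuous => //.
  - exact: open_closedC.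
  - apply: (@subspace_eq_continuous _ _ _ QC).
      by move=> p Sp; change (QC p = Q p); rewrite /Q Sp.
    apply: continuous_for_within => p Sp; apply: cmul_cvg.
      apply: pair_cvg; apply: continuous_cvg; try exact: cg.
        exact: continuous_cos.
      exact: continuous_sin.
    apply: direction_cvg.
      have /neq/angle_ex[t pt] : p <> z0 by move=> pz; apply: nSz0; rewrite -pz.
      exact: (angle_neq0 (angle_cpow k pt)).
    apply: cpow_cvg; apply: cvgB; [exact: cvg_id|exact: cvg_cst].
  apply: (@subspace_eq_continuous _ _ _ QO).
    move=> p /set_mem nCp; change (QO p = Q p); rewrite /Q; case: ifPn => // /set_mem[//|/QJ//].
  apply: continuous_for_within => p nCp; apply: direction_cvg.
    by apply: neq => pz; apply: nCp; rewrite pz.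
  by apply: cvgB; [exact: cvg_id|exact: cvg_cst].
have [rho [rho0 farE]] := wind_far cl l01.
(* The circle of radius r has sup norm at least r / 2, which exceeds rho, so that the circle avoids
   [S], and also 2 |z|, as [dot_perturb] requires. *)
pose r := 2 * (rho + 2 * `|z| + 1).
have r0 : 0 < r by have := normr_ge0 z; rewrite /r; lra.
pose c t := (r * cos (2 * pi * t), r * sin (2 * pi * t)).
have c01 : c 0 = c 1.
  rewrite /c mulr0 mulr1; have [+ +] := sincos_shift 1 (0 : R).
  by rewrite mulr1 add0r => -> ->.
have c2pi (x : R) : (fun t => 2 * pi * t) t @[t --> x] --> 2 * pi * x by apply: cvgMr; exact: cvg_id.
have cc : continuous c.
  move=> x; apply: pair_cvg; apply: cvgMr; apply: continuous_cvg; try exact: c2pi.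
    exact: continuous_cos.
  exact: continuous_sin.
have wc : wind c (2 * pi).
  exists (fun t => 2 * pi * t); split; last by rewrite mulr1 mulr0 subr0.
    by apply: continuous_subspaceT => x; exact: c2pi.
  by move=> t _; exists r.
have cnorm t : r <= 2 * `|c t|.
  have : r ^+ 2 = dot (c t) (c t).
    transitivity (r ^+ 2 * (cos (2 * pi * t) ^+ 2 + sin (2 * pi * t) ^+ 2)).
      by rewrite cos2Dsin2 mulr1.
    by rewrite /dot /c /=; ring.
  have d1 : `|(c t).1| <= `|c t| by rewrite prod_normE le_max lexx.
  have d2 : `|(c t).2| <= `|c t| by rewrite prod_normE le_max lexx orbT.
  rewrite /dot => rE; rewrite leNgt; apply/negP => rc.
  have h1 : (c t).1 * (c t).1 <= `|c t| ^+ 2.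
    by rewrite -expr2 -real_normK ?num_real// ler_pXn2r ?nnegrE.
  have h2 : (c t).2 * (c t).2 <= `|c t| ^+ 2.
    by rewrite -expr2 -real_normK ?num_real// ler_pXn2r ?nnegrE.
  have := normr_ge0 (c t); nra.
have wcz : wind (fun t => c t - z) (2 * pi).
  apply: wind_dot_gt0 wc; rewrite ?c01//; try exact: continuous_subspaceT.
    by apply: continuous_sub; exact: continuous_subspaceT.
  by move=> t _; apply: dot_perturb; rewrite normrN; have := cnorm t; rewrite /r; lra.
have QcE t : Q (c t) = direction (c t - z).
  rewrite /Q; case: ifPn => // /set_mem; have [|nJ w'] := farE (c t).
    by have := cnorm t; have := normr_ge0 z; rewrite /r; lra.
  by case=> [[_ _ w'']|//]; case: wneq0; exact: wind_uniq w'' w'.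
have wQ : wind (Q \o c) (2 * pi).
  have [th [cth ath eth]] := wcz; exists th; split=> // t t01.
  by rewrite /= QcE (direction_angle (ath t t01)); exact: angle_unit.
pose K : set (R * R) := `[- r, r] `*` `[- r, r].
have [|p s|th thP] := @angle_lift R _ Q K cQ Q0.
- by apply: compact_setX; exact: segment_compact.
- rewrite /K /= !in_itv/= => -[p1 p2] s01.
  have H (x : R) : - r <= x <= r -> - r <= s * x <= r.
    by rewrite -!ler_norml normrM => xr; have := normr_ge0 x; rewrite ger0_norm; nra.
  by split; exact: H.
have cK t : K (c t).
  have H (x : R) : `|x| <= 1 -> - r <= r * x <= r.
    by rewrite -ler_norml normrM (gtr0_norm r0) => x1; rewrite ler_piMr// ltW.
  rewrite /K /c /= !in_itv/=; split; apply: H; [exact: cos_max|exact: sin_max].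
have wQ0 : wind (Q \o c) 0.
  exists (th \o c); split; last by rewrite /= c01 subrr.
    apply: continuous_subspaceT => x; apply: continuous_comp; first exact: cc.
    exact: (thP _ (cK x)).1.
  by move=> t _; exact: (thP _ (cK t)).2.
by have := wind_uniq wQ wQ0; have := @pi_gt0 R; lra.
Qed.

End JordanOutside.

(** * Lifting trails to the line *)

Lemma generic_point (T U : Type) (u : nat -> T) (gamma : T -> U) (I Z : set T) (E : set U) :
  injective u -> (forall n, I (u n)) -> finite_set Z -> finite_set E ->
  {in I `\` Z &, injective gamma} ->
  exists n, [/\ ~ Z (u n), ~ E (gamma (u n)) &
    forall z, I z -> gamma z = gamma (u n) -> z = u n].
Proof.
move=> inju Iu finZ finE injg.
pose E' := E `|` gamma @` Z.
have finE' : finite_set E' by rewrite finite_setU; split=> //; exact: finite_image.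
pose N1 := u @^-1` Z.
have finN1 : finite_set N1 by apply: finite_preimage => // x y _ _; exact: inju.
pose N2 := [set n | ~ N1 n /\ E' (gamma (u n))].
have finN2 : finite_set N2.
  have inj2 : {in N2 &, injective (gamma \o u)}.
    move=> x y /set_mem[nx _] /set_mem[ny _] /= xy; apply: inju; apply: injg => //; rewrite inE; split => //.
  rewrite -(eq_finite_set (inj_card_eq inj2)).
  by apply: sub_finite_set finE' => _ [n [_ ?] <-].
have [n nN] : exists n, ~ (N1 `|` N2) n.
  apply: contrapT => /forallNP H; apply: infinite_nat.
  suff -> : [set: nat] = N1 `|` N2 by rewrite finite_setU.
  by apply/seteqP; split=> // n _; apply: contrapT; exact: H.
have nZ : ~ Z (u n) by move=> ?; apply: nN; left.
have nE' : ~ E' (gamma (u n)) by move=> ?; apply: nN; right.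
exists n; split=> //; first by move=> ?; apply: nE'; left.
move=> z Iz zE; apply: injg; rewrite ?inE//; split=> // Zz.
by apply: nE'; right; exists z.
Qed.

Section Crossing.
Context {R : realType}.
Implicit Types (m M s t x y : R) (f Th Y : R -> R).

Lemma within_dist (a b : R) f x (e : R) : {within `[a, b], continuous f} -> a <= x <= b -> 0 < e ->
  exists2 d : R, 0 < d & forall y, a <= y <= b -> `|x - y| < d -> `|f x - f y| < e.
Proof.
move=> cf xab e0; have /subspace_continuousP/(_ x) := cf.
rewrite /= in_itv/= => /(_ xab) /cvgrPdist_lt/(_ e e0); rewrite near_withinE.
move=> /nbhs_ballP[d /= d0 H]; exists d => // y yab xy.
by apply: H; rewrite //= in_itv.
Qed.

Lemma first_zero f x0 x1 : x0 <= x1 -> {within `[x0, x1], continuous f} -> 0 < f x0 -> f x1 <= 0 ->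
  exists s, [/\ x0 < s <= x1, f s = 0 & forall x, x0 <= x < s -> 0 < f x].
Proof.
move=> x01 cf f0 f1; pose E := [set x | x0 <= x <= x1 /\ f x <= 0].
have E1 : E x1 by split=> //; rewrite x01 lexx.
have hE : has_inf E by split; [exists x1|exists x0 => x [/andP[]]].
pose s := inf E.
have s0 : x0 <= s by apply: lb_le_inf; [exists x1|move=> x [/andP[]]].
have s1 : s <= x1 by apply: ge_inf => //; exact: hE.2.
have fpos x : x0 <= x < s -> 0 < f x.
  move=> xs; rewrite ltNge; apply/negP => fx.
  have : s <= x by apply: ge_inf; [exact: hE.2|split=> //; lra].
  by lra.
have s01 : x0 <= s <= x1 by rewrite s0 s1.
have fs0 : f s <= 0.
  rewrite leNgt; apply/negP => fs.
  have [d d0 Hd] := within_dist cf s01 fs.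
  have [y [yx fy] ys] := inf_adherent d0 hE.
  have sy : s <= y by apply: ge_inf; [exact: hE.2|split].
  have := Hd y yx; rewrite ler0_norm -/s in ys *; last by lra.
  move=> H; have sd : - (s - y) < d by lra.
  by have := H sd; rewrite ltr_norml; lra.
have s0' : x0 < s by rewrite lt_neqAle s0 andbT; apply/eqP => sE; move: f0; rewrite sE; lra.
exists s; split=> //; first by rewrite s0' s1.
apply/eqP; rewrite eq_le fs0/= leNgt; apply/negP => fs.
have fs' : 0 < - f s by lra.
have [d d0 Hd] := within_dist cf s01 fs'.
pose x := Num.max x0 (s - d / 2).
have xs : x0 <= x < s by rewrite /x le_max lexx gt_max s0'/=; lra.
have xd : s - d / 2 <= x by rewrite /x le_max lexx orbT.
have := fpos x xs.
have : `|f s - f x| < - f s by apply: Hd; [lra|rewrite ger0_norm; lra].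
by rewrite ltr_norml; lra.
Qed.

Lemma sin_gt0_inv x : - pi < x < pi -> 0 < sin x -> 0 < x.
Proof.
move=> xpi sx; rewrite ltNge; apply/negP; rewrite le_eqVlt => /orP[/eqP x0|x0].
  by move: sx; rewrite x0 sin0 ltxx.
have : 0 < sin (- x) by rewrite sin_gt0_pi//; lra.
by rewrite sinN; lra.
Qed.

Lemma small_pos (x y z : R) : 0 < x -> 0 < y -> 0 < z ->
  exists e : R, [/\ 0 < e, e < x, e < y & e < z].
Proof.
move=> x0 y0 z0; pose q : R := Num.min (Num.min x y) z.
have q0 : 0 < q by rewrite !lt_min x0 y0.
have qx : q <= x by rewrite !ge_min lexx.
have qy : q <= y by rewrite !ge_min lexx orbT.
have qz : q <= z by rewrite !ge_min lexx orbT.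
by exists (q / 2); split; lra.
Qed.

(* A lift meeting 2 pi Z only at the translates of ts, and always upwards,
   stays above the value it takes at ts. *)
Lemma crossing_right m M ts (d : R) Th Y : m <= ts <= M -> 0 < d ->
  {within `[m, M], continuous Th} ->
  (forall x, m <= x <= M -> 0 < Y x -> 0 < sin (Th x)) ->
  (forall x, m <= x <= M -> Y x < 0 -> sin (Th x) < 0) ->
  (forall (k : int) x, Y (x + 2 * pi * k%:~R) = Y x) ->
  (forall x, m <= x <= M -> cos (Th x) = 1 -> exists k : int, x = ts + 2 * pi * k%:~R) ->
  cos (Th ts) = 1 ->
  (forall x, 0 < x < d -> 0 < Y (ts + x) /\ Y (ts - x) < 0) ->
  forall x, ts < x <= M -> Th ts < Th x.
Proof.
move=> tsm d0 cTh Yp Yn Yper visit cts Yloc x1 x1ts; rewrite ltNge; apply/negP => Thx1.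
have [n vn] := cos_eq1 cts.
pose D x := Th x - Th ts.
have sinD x : sin (Th x) = sin (D x).
  by rewrite /D vn -[in LHS](subrK (2 * pi * n%:~R) (Th x)); case: (sincos_shift n (Th x - 2 * pi * n%:~R)).
have cosD x : cos (Th x) = cos (D x).
  by rewrite /D vn -[in LHS](subrK (2 * pi * n%:~R) (Th x)); case: (sincos_shift n (Th x - 2 * pi * n%:~R)).
have pi0 := @pi_gt0 R.
have cD : {within `[m, M], continuous D}.
  apply/subspace_continuousP => x xm; apply: cvgB; last exact: cvg_cst.
  by move/subspace_continuousP : cTh; exact.
have [e e0 He] := within_dist cD tsm pi0.
have [eta [h1 h2 h3 h4]] : exists eta : R, [/\ 0 < eta, eta < d, eta < e & eta < x1 - ts].
  by apply: small_pos => //; rewrite subr_gt0; case/andP: x1ts.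
have te : m <= ts + eta <= M by clear -h1 h4 tsm x1ts; lra.
have D0 : 0 < D (ts + eta).
  apply: sin_gt0_inv.
    have : `|D ts - D (ts + eta)| < pi by apply: He; rewrite // opprD addNKr normrN gtr0_norm.
    by rewrite /D subrr sub0r normrN ltr_norml.
  by rewrite -sinD; apply: Yp => //; apply: (Yloc eta _).1; rewrite h1.
(* [D] would reach its first zero after ts from above. But that zero is a translate of ts by a
   multiple of 2 pi, where periodicity of [Y] makes the sine negative just before. *)
have [|||s [s01 Ds Dpos]] := @first_zero D (ts + eta) x1 _ _ D0 _.
- by lra.
- by apply: continuous_subspaceW cD => x; rewrite /= !in_itv/=; lra.
- by rewrite /D; lra.
have sm : m <= s <= M by lra.
have [k sk] : exists k : int, s = ts + 2 * pi * k%:~R.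
  by apply: visit => //; rewrite cosD Ds cos0.
have [e' e'0 He'] := within_dist cD sm pi0.
have [et [g1 g2 g3 g4]] : exists et : R, [/\ 0 < et, et < d, et < e' & et < s - (ts + eta)].
  by apply: small_pos => //; rewrite subr_gt0; case/andP: s01.
have se : m <= s - et <= M by clear -g1 g4 te sm; lra.
have D1 : 0 < D (s - et) by apply: Dpos; clear -g1 g4; lra.
have D2 : D (s - et) < pi.
  have : `|D s - D (s - et)| < pi by apply: He'; rewrite // subKr gtr0_norm.
  by rewrite Ds sub0r normrN ltr_norml => /andP[].
have : 0 < sin (D (s - et)) by rewrite sin_gt0_pi// D1.
have : sin (D (s - et)) < 0.
  rewrite -sinD; apply: Yn => //.
  have -> : s - et = ts - et + 2 * pi * k%:~R by rewrite sk; ring.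
  by rewrite Yper; apply: (Yloc et _).2; rewrite g1.
by clear; lra.
Qed.

(** The left side reduces to the right side by reversing both the line and the sign of the lift. *)
Lemma crossing_sides m M ts (d : R) Th Y : m <= ts <= M -> 0 < d ->
  {within `[m, M], continuous Th} ->
  (forall x, m <= x <= M -> 0 < Y x -> 0 < sin (Th x)) ->
  (forall x, m <= x <= M -> Y x < 0 -> sin (Th x) < 0) ->
  (forall (k : int) x, Y (x + 2 * pi * k%:~R) = Y x) ->
  (forall x, m <= x <= M -> cos (Th x) = 1 -> exists k : int, x = ts + 2 * pi * k%:~R) ->
  cos (Th ts) = 1 ->
  (forall x, 0 < x < d -> 0 < Y (ts + x) /\ Y (ts - x) < 0) ->
  forall x y, m <= x < ts -> ts < y <= M -> Th x < Th y.
Proof.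
move=> tsm d0 cTh Yp Yn Yper visit cts Yloc x y xts yts.
apply: (@lt_trans _ _ (Th ts)); last exact: (crossing_right tsm d0 cTh Yp Yn Yper visit cts Yloc yts).
suff : - Th (- - ts) < - Th (- - x) by rewrite !opprK; lra.
apply: (@crossing_right (- M) (- m) (- ts) d (fun u => - Th (- u)) (fun u => - Y (- u))); try lra.
- apply/subspace_continuousP => u; rewrite /= in_itv/= => um; apply: cvgN.
  apply/cvgrPdist_lt => e e0.
  have um' : m <= - u <= M by lra.
  have [d' d'0 Hd'] := within_dist cTh um' e0.
  rewrite near_withinE; apply/nbhs_ballP; exists d' => //= v uv; rewrite in_itv/= => vm.
  by apply: Hd'; [lra|rewrite opprK addrC distrC].
- by move=> u um uY; rewrite sinN; have := Yn (- u); lra.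
- by move=> u um uY; rewrite sinN; have := Yp (- u); lra.
- by move=> k u; rewrite opprD -mulrN -mulrNz Yper.
- move=> u um; rewrite cosN => /visit[|k uk]; first by lra.
  by exists (- k); rewrite -[u]opprK uk mulrNz; ring.
- by rewrite cosN opprK.
- by move=> u ud; have := Yloc u ud; rewrite opprD opprB !opprK [u + ts]addrC addrC; lra.
Qed.

End Crossing.

(** * Wrapping an arc around the circle *)

Section ArcProjection.
Context {R : realType}.
Implicit Types (p q : R * R) (s t x y : R).

Lemma clip_inner (a b x : R) : a <= b -> a < clip a b x < b -> clip a b x = x.
Proof.
move=> ab; rewrite /clip; have [xb|xb] := leP b x.
  by rewrite max_r// ltxx andbF.
have [xa|xa] := leP a x; first by [].
by rewrite ltxx.
Qed.

Lemma multiple_2pi_small (k : int) x : x = 2 * pi * k%:~R -> - (2 * pi) < x < 2 * pi -> k = 0.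
Proof.
move=> -> /andP[k1 k2]; have pi0 : 0 < 2 * pi :> R by rewrite mulr_gt0// pi_gt0.
have h1 : (-1)%:~R < k%:~R :> R by rewrite -(ltr_pM2l pi0) mulrN1z mulrN mulr1.
have h2 : k%:~R < 1%:~R :> R by rewrite -(ltr_pM2l pi0) mulr1z mulr1.
by move: h1 h2; rewrite !ltr_int; lia.
Qed.

(* Wraps the arc h around the circle, everything else going to -1. *)
Lemma arc_projection (h : R -> R * R) (G' : set (R * R)) s0 :
  {within `[0, 1], continuous h} -> {in `[0, 1] &, injective h} -> closed G' ->
  (forall s, 0 <= s <= 1 -> G' (h s) -> s = 0 \/ s = 1) -> 0 < s0 < 1 ->
  exists proj : R * R -> R * R,
  [/\ {within h @` `[0, 1] `|` G', continuous proj},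
      forall p, (proj p).1 ^+ 2 + (proj p).2 ^+ 2 = 1,
      proj (h s0) = (1, 0) &
      forall p q, (h @` `[0, 1] `|` G') p -> (h @` `[0, 1] `|` G') q ->
        0 < (proj p).1 -> proj p = proj q -> p = q].
Proof.
move=> ch injh clG' hG' s01.
have pi0 := @pi_gt0 R.
pose e := Num.min s0 (1 - s0).
have [e0 es e1] : [/\ 0 < e, e <= s0 & e <= 1 - s0].
  by rewrite /e lt_min !ge_min !lexx orbT; split=> //; lra.
have ab1 : (-1 : R) <= 1 by lra.
(* [psi] rises from - pi to pi on [s0 - e, s0 + e] and is constant on either side, so both ends of
   the arc go to -1, the value taken on [G']. *)
pose psi s : R := pi * clip (-1) 1 ((s - s0) / e).
have cpsi : continuous psi.
  move=> x; apply: cvgMr; apply: (@continuous_cvg _ _ _ _ _ _ (clip (-1) 1)).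
    exact: clip_continuous.
  by apply: cvgMl; apply: cvgB; [exact: cvg_id|exact: cvg_cst].
have psi_le s : - pi <= psi s <= pi.
  have /andP[c1 c2] := clip_itv ((s - s0) / e) ab1.
  rewrite /psi; apply/andP; split; last by rewrite -[leRHS]mulr1 ler_pM2l.
  by rewrite -[leLHS]mulr1 mulNr -mulrN ler_pM2l.
have psi0 : psi 0 = - pi.
  have h1 : - s0 / e <= -1 by rewrite ler_pdivrMr//; lra.
  by rewrite /psi sub0r /clip min_l ?max_l ?mulrN1//; lra.
have psi1 : psi 1 = pi.
  have h1 : 1 <= (1 - s0) / e by rewrite ler_pdivlMr//; lra.
  by rewrite /psi /clip min_r ?max_r ?mulr1//; lra.
have psis0 : psi s0 = 0.
  rewrite /psi subrr mul0r clip_id ?mulr0//; lra.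
have h01 s t : 0 <= s <= 1 -> 0 <= t <= 1 -> h s = h t -> psi s = psi t.
  by move=> s1 t1 st; congr psi; apply: injh; rewrite ?in_itv.
have [phi cphi phiE] := factor_within (@norm_hausdorff _ _) ch (continuous_subspaceT cpsi) h01.
pose A1 := h @` `[0, 1].
have clA1 : closed A1.
  apply: compact_closed; first exact: norm_hausdorff.
  by apply: continuous_compact => //; exact: segment_compact.
pose proj p : R * R := if p \in A1 then (cos (phi p), sin (phi p)) else (-1, 0).
have projh s : 0 <= s <= 1 -> proj (h s) = (cos (psi s), sin (psi s)).
  by move=> s1; rewrite /proj mem_set ?phiE//; exists s; rewrite //= in_itv.
have projG p : G' p -> proj p = (-1, 0).
  move=> Gp; have [[s]|nA] := pselect (A1 p); last by rewrite /proj memNset.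
  rewrite /= in_itv/= => s1 hs; rewrite -hs projh//; rewrite -hs in Gp.
  have [->|->] := hG' s s1 Gp; first by rewrite psi0 cosN sinN cospi sinpi oppr0.
  by rewrite psi1 cospi sinpi.
exists proj; split.
- apply: withinU_continuous => //.
    apply: (@subspace_eq_continuous _ _ _ (fun p => (cos (phi p), sin (phi p)))).
      by move=> p pA; change ((cos (phi p), sin (phi p)) = proj p); rewrite /proj pA.
    apply/subspace_continuousP => p Ap.
    have phip : phi x @[x --> within A1 (nbhs p)] --> phi p.
      by move/subspace_continuousP : cphi; exact.
    apply: pair_cvg; apply: continuous_cvg; try exact: phip.
      exact: continuous_cos.
    exact: continuous_sin.
  apply: (@subspace_eq_continuous _ _ _ (fun=> ((-1, 0) : R * R))).
    by move=> p /set_mem Gp; change (((-1, 0) : R * R) = proj p); rewrite projG.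
  by move=> p; exact: cst_continuous.
- move=> p; rewrite /proj; case: ifPn => _ /=; last by ring.
  exact: cos2Dsin2.
- by rewrite projh ?psis0 ?cos0 ?sin0//; lra.
have inA p : (A1 `|` G') p -> 0 < (proj p).1 -> exists2 s, 0 <= s <= 1 & p = h s.
  move=> [[s]|Gp]; first by rewrite /= in_itv => s1 <- _; exists s.
  by rewrite projG//= ltr0N1.
(* A positive abscissa keeps [psi] in a range where clipping is inactive and [psi] is injective. *)
have small s : 0 < cos (psi s) -> - (pi / 2) < psi s < pi / 2.
  move=> cs; have := psi_le s => ps.
  have H x : pi / 2 <= x <= pi -> cos x <= 0.
    move=> xpi; have -> : cos x = - cos (pi - x) by rewrite cosB cospi sinpi; ring.
    by rewrite oppr_le0 cos_ge0_pihalf//; lra.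
  rewrite !ltNge; apply/andP; split; apply/negP => h'.
    by have := H (- psi s); rewrite cosN; lra.
  by have := H (psi s); lra.
have inner s : - (pi / 2) < psi s < pi / 2 -> psi s = pi * ((s - s0) / e).
  rewrite /psi => ps; congr (pi * _); apply: clip_inner => //.
  have : pi * -1 < pi * clip (-1) 1 ((s - s0) / e) < pi * 1 by lra.
  by rewrite !ltr_pM2l.
move=> p q Ap Aq p0 pq; have q0 : 0 < (proj q).1 by rewrite -pq.
have [s s1 ps] := inA p Ap p0; have [t t1 qt] := inA q Aq q0; rewrite ps qt in p0 q0 pq *.
rewrite !projh// in p0 q0 pq; have /= hs := small s p0; have /= ht := small t q0.
have ast : cos (psi s - psi t) = 1.
  apply: (@angle_cosB _ (cos (psi t), sin (psi t))); first exact: angle_unit.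
  rewrite -pq; exact: angle_unit.
have [k kE] := cos_eq1 ast.
have k0 : k = 0 by apply: (multiple_2pi_small kE); lra.
have : psi s = psi t by move: kE; rewrite k0 mulr0; lra.
rewrite (inner s)// (inner t)// => st; congr h.
have : (s - s0) / e = (t - s0) / e.
  by apply: (mulfI (lt0r_neq0 pi0)).
move=> /(congr1 (fun x => x * e)); rewrite !mulfVK ?gt_eqF//; lra.
Qed.

End ArcProjection.

(** * Lifts of trails and their end values *)

Section TrailLift.
Context {R : realType}.
Implicit Types (p q z : R * R) (s t x y : R).

Let circ x : R * R := (cos x, sin x).

Let circ_cvg x : circ y @[y --> x] --> circ x.
Proof.
by apply: pair_cvg; [exact: continuous_cos|exact: continuous_sin].
Qed.

Let circ_eq x y : circ x = circ y -> exists k : int, x = y + 2 * pi * k%:~R.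
Proof.
move=> xy; have [|k kE] := @cos_eq1 R (x - y); last by exists k; rewrite -kE; ring.
by apply: (@angle_cosB _ (circ y)); [|rewrite -xy]; exact: angle_unit.
Qed.

Let circ_shift (k : int) x : circ (x + 2 * pi * k%:~R) = circ x.
Proof. by rewrite /circ; have [-> ->] := sincos_shift k x. Qed.

Lemma within_circ_comp (a b : R) (I : set (R * R)) (f : R * R -> R * R) :
  {within I, continuous f} -> (forall x, a <= x <= b -> I (circ x)) ->
  {within `[a, b], continuous (f \o circ)}.
Proof.
move=> cf Ic; apply/subspace_continuousP => x; rewrite /= in_itv/= => xab.
move/subspace_continuousP : cf => /(_ _ (Ic x xab)); apply: cvg_comp => U HU.
have := circ_cvg HU; apply: (@filterS _ (nbhs x)) => y Hy yab; apply: Hy; apply: Ic.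
by move: yab; rewrite /= in_itv.
Qed.

Lemma lipschitz_within_continuous (V : normedModType R) (a b : R) (f : R -> V) :
  [lipschitz f s | s in `[a, b]] -> {within `[a, b], continuous f}.
Proof.
move=> [M [_ MH]]; pose K : R := Num.max 0 (M + 1) + 1.
have K0 : 0 < K by rewrite ltr_pwDr// le_max lexx.
apply/subspace_continuousP => x xab; apply/cvgrPdist_lt => e e0; rewrite near_withinE.
apply/nbhs_ballP; exists (e / K); first by rewrite /= divr_gt0.
move=> y xy yab; have /MH/(_ (x, y)) : M < K.
  by rewrite /K; apply: ltr_wpDr => //; rewrite lt_max; apply/orP; right; lra.
move=> /= /(_ (conj xab yab)) /le_lt_trans; apply.
by rewrite mulrC -ltr_pdivlMr.
Qed.

Lemma closed_finite_plane (Z : set (R * R)) : finite_set Z -> closed Z.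
Proof.
move: Z; have /accessible_finite_set_closed : accessible_space (R * R)%type; last exact.
by apply: hausdorff_accessible; exact: norm_hausdorff.
Qed.

Lemma segment_affine (a b s : R) : a <= b -> 0 <= s <= 1 -> a <= a + s * (b - a) <= b.
Proof.
move=> ab /andP[s0 s1]; rewrite lerDl mulr_ge0 ?subr_ge0//=.
by rewrite -lerBrDl ler_piMl ?subr_ge0.
Qed.

(** Near ts the map [pr] is injective into the unit circle with positive abscissa, so its ordinate
    is injective, hence monotone. By periodicity every passage of [Th] through 2 pi Z then has the
    same direction. The decreasing case becomes the increasing one by reflecting the circle. *)
Lemma wrapping_lift_neq (m M ts : R) (pr : R -> R * R) (Th : R -> R) (d : R) :
  m < ts < M -> 0 < d -> {within `[m, M], continuous pr} ->
  (forall x, (pr x).1 ^+ 2 + (pr x).2 ^+ 2 = 1) -> pr ts = (1, 0) ->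
  (forall (j : int) x, pr (x + 2 * pi * j%:~R) = pr x) ->
  (forall x, m <= x <= M -> pr x = (1, 0) -> exists j : int, x = ts + 2 * pi * j%:~R) ->
  (forall x y, `|ts - x| < d -> `|ts - y| < d -> 0 < (pr x).1 -> pr x = pr y -> x = y) ->
  {within `[m, M], continuous Th} -> (forall x, m <= x <= M -> pr x = circ (Th x)) ->
  forall x y, m <= x < ts -> ts < y <= M -> Th x <> Th y.
Proof.
move=> tsM d0 cpr pr1 prts prper visit injd cTh prE xA xB Am Bm.
have tsm : m <= ts <= M by lra.
pose Y x := (pr x).2.
have Yper (j : int) x : Y (x + 2 * pi * j%:~R) = Y x by rewrite /Y prper.
have Ysin x : m <= x <= M -> Y x = sin (Th x) by move=> xm; rewrite /Y prE.
have cts : cos (Th ts) = 1 by have := prE ts tsm; rewrite prts => -[].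
have visit' x : m <= x <= M -> cos (Th x) = 1 -> exists j : int, x = ts + 2 * pi * j%:~R.
  move=> xm cx; apply: visit => //.
  have sx : sin (Th x) = 0.
    have := cos2Dsin2 (Th x); rewrite cx expr1n => /eqP.
    by rewrite -subr_eq0 addrAC subrr add0r sqrf_eq0 => /eqP.
  by rewrite prE// /circ cx sx.
have [e e0 He] : exists2 e : R, 0 < e & forall x, `|ts - x| < e ->
    [/\ m < x < M, 0 < (pr x).1 & `|ts - x| < d].
  have N1 : \forall x \near ts, m < x < M.
    by apply: filterS (near_in_itvoo (_ : ts \in `]m, M[)) => [x|]; rewrite in_itv.
  have N3 : \forall x \near ts, 0 < (pr x).1.
    have cpr1 : (pr x).1 @[x --> within `[m, M] (nbhs ts)] --> (1 : R).
      have -> : 1 = (pr ts).1 by rewrite prts.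
      apply: fst_cvg; move/subspace_continuousP : cpr; apply; by rewrite /= in_itv.
    have /cvgrPdist_lt/(_ 1 ltr01) := cpr1; rewrite near_withinE => W.
    move: N1 W; apply: filterS2 => x xm /(_ _); rewrite /= in_itv/= => W.
    have : `|1 - (pr x).1| < 1 by apply: W; lra.
    by rewrite ltr_norml; lra.
  have N4 : \forall x \near ts, `|ts - x| < d by apply: nbhsx_ballx.
  have /nbhs_ballP[e /= e0 H] : \forall x \near ts, [/\ m < x < M, 0 < (pr x).1 & `|ts - x| < d].
    by move: N1 N3 N4; apply: filterS3.
  by exists e.
have inE' x : x \in `]ts - e, ts + e[ -> `|ts - x| < e.
  by rewrite in_itv/= ltr_norml; lra.
have injY : {in `]ts - e, ts + e[ &, injective Y}.
  move=> x y /inE'/He[xm px xd] /inE'/He[ym py yd] xy.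
  apply: injd => //.
  have := pr1 x; rewrite -(pr1 y).
  move: px py xy; rewrite /Y; case: (pr x) (pr y) => [u v] [u' v'] /= u0 u'0 ->.
  by move=> /addIr/eqP; rewrite eqrXn2 ?(ltW u0) ?(ltW u'0)// => /eqP ->.
have cY : {within `]ts - e, ts + e[, continuous Y}.
  apply: (@continuous_subspaceW _ _ _ `[m, M]).
    move=> x /inE'/He[/andP[xm xM] _ _]; by rewrite /= in_itv/= !ltW.
  apply/subspace_continuousP => x xm; apply: snd_cvg.
  by move/subspace_continuousP : cpr; exact.
have Y0 : Y ts = 0 by rewrite /Y prts.
have inI x : - e < x < e -> ts + x \in `]ts - e, ts + e[ by rewrite in_itv/=; lra.
have ts0 : ts \in `]ts - e, ts + e[ by rewrite in_itv/=; lra.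
have sides x : 0 < x < e -> [/\ ts < ts + x, ts - x < ts,
    ts + x \in `]ts - e, ts + e[ & ts - x \in `]ts - e, ts + e[].
  by move=> xe; split; [ | | apply: inI | apply: inI]; clear -xe; lra.
have [mono|mono] := itv_continuous_inj_mono cY injY => ThE.
- have := @crossing_sides R m M ts e Th Y tsm e0 cTh _ _ Yper visit' cts _ xA xB Am Bm.
  rewrite ThE ltxx => H; apply: notF; apply: H.
  + by move=> x xm; rewrite Ysin.
  + by move=> x xm; rewrite Ysin.
  by move=> x /sides[h1 h2 h3 h4]; rewrite -Y0; split; apply: mono.
have := @crossing_sides R m M ts e (fun x => - Th x) (fun x => - Y x) tsm e0 _ _ _ _ _ _ _ xA xB Am Bm.
rewrite ThE ltxx => H; apply: notF; apply: H.
- apply/subspace_continuousP => x xm; apply: cvgN.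
  by move/subspace_continuousP : cTh; exact.
- by move=> x xm; rewrite sinN Ysin.
- by move=> x xm; rewrite sinN Ysin.
- by move=> j x; rewrite Yper.
- by move=> x xm; rewrite cosN; exact: visit'.
- by rewrite cosN.
move=> x /sides[h1 h2 h3 h4]; rewrite oppr_gt0 oppr_lt0 -Y0.
by split; apply: mono.
Qed.

Lemma lift_endpoints (a b : R) (G I Z : set (R * R)) (gamma : R * R -> R * R) (th : R -> R) :
  a < b -> lipschitz_triangulable G ->
  {within I, continuous gamma} -> gamma @` I `<=` G ->
  finite_set Z -> {in I `\` Z &, injective gamma} ->
  {within `[a, b], continuous th} -> (forall t, a <= t <= b -> I (cos (th t), sin (th t))) ->
  gamma (cos (th a), sin (th a)) = gamma (cos (th b), sin (th b)) ->
  null_homologous G (loop_cycle (fun s =>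
    gamma (cos (th (a + s * (b - a))), sin (th (a + s * (b - a)))))) ->
  th a = th b.
Proof.
move=> ab [n [h [harc GE hij _]]] cg gG finZ injg cth Ith gab nullF.
have ab' := ltW ab; have pi0 := @pi_gt0 R.
apply: contrapT => thab.
(* [A, B] is spanned by the end values of the lift, [m, M] below by all its values: the path may
   overshoot its ends, so the wrapping has to be followed on the larger interval. *)
pose A := Num.min (th a) (th b); pose B := Num.max (th a) (th b).
have AB : A < B.
  by have [q|q|//] := ltgtP (th a) (th b); rewrite /A /B lt_max !gt_min q /= ?orbT.
have [tm tmab mE] := EVT_min ab' cth; have [tM tMab ME] := EVT_max ab' cth.
rewrite !in_itv/= in tmab tMab.
pose m := th tm; pose M := th tM.
have aab : a <= a <= b by rewrite lexx.
have bab : a <= b <= b by rewrite lexx ab'.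
have thm t : a <= t <= b -> m <= th t <= M.
  by move=> tab; rewrite /m /M mE ?ME ?in_itv.
have mA : m <= A by rewrite /A le_min; have := thm a aab; have := thm b bab; lra.
have BM : B <= M by rewrite /B ge_max; have := thm a aab; have := thm b bab; lra.
have Icirc x : m <= x <= M -> I (circ x).
  move=> xm; have xm' : th tm <= x <= th tM by [].
  suff [t tab <-] : exists2 t, a <= t <= b & th t = x by exact: Ith.
  have sub u v : a <= u -> v <= b -> {within `[u, v], continuous th}.
    move=> au vb; apply: continuous_subspaceW cth => w; rewrite /= !in_itv/=; lra.
  have [tt|/ltW tt] := leP tm tM.
    have [||c + cE] := @IVT R th tm tM x tt; first by apply: sub; [case/andP: tmab|case/andP: tMab].
      by rewrite ge_min le_max; case/andP: xm' => -> ->; rewrite ?orbT.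
    by rewrite in_itv/= => cc; exists c => //; clear -cc tmab tMab; lra.
  have [||c + cE] := @IVT R th tM tm x tt; first by apply: sub; [case/andP: tMab|case/andP: tmab].
    by rewrite ge_min le_max; case/andP: xm' => -> ->; rewrite ?orbT.
  by rewrite in_itv/= => cc; exists c => //; clear -cc tmab tMab; lra.
(* a point which the trail visits once, strictly inside an arc of G *)
pose w : R := Num.min (B - A) 1.
have [w0 wB w1] : [/\ 0 < w, w <= B - A & w <= 1].
  by rewrite /w lt_min !ge_min !lexx orbT ltr01; split=> //; lra.
(* The bound w <= 1 keeps these angles in an interval shorter than 2 pi, so their points on the
   circle are distinct; w <= B - A keeps them below B. *)
pose ang (k : nat) : R := A + w / k.+2%:R.
have ang_itv k : A < ang k < B /\ ang k <= A + 1 / 2.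
  have k2 : (2 : R) <= k.+2%:R by rewrite (ler_nat R 2 k.+2).
  have k0 : (0 : R) < k.+2%:R by lra.
  have h1 : 0 < w / k.+2%:R by rewrite divr_gt0.
  have h2 : w / k.+2%:R <= w / 2 by rewrite ler_wpM2l ?(ltW w0)// lef_pV2 ?posrE.
  by rewrite /ang; move: (w / _) h1 h2 => q h1 h2; clear -h1 h2 w0 wB w1; split; lra.
have injang : injective (circ \o ang).
  move=> j k /= /circ_eq[z zE].
  have z0 : z = 0.
    apply: (@multiple_2pi_small R z (ang j - ang k)); first by rewrite zE; ring.
    by have := ang_itv j; have := ang_itv k; have := @pi_ge2 R; clear; lra.
  move: zE; rewrite z0 mulr0 addr0 /ang => /addrI/(mulfI (lt0r_neq0 w0))/invr_inj.
  by move=> /eqP; rewrite eqr_nat => /eqP[].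
pose ends : set (R * R) := \bigcup_(i in [set: 'I_n]) [set h i 0; h i 1].
have finends : finite_set ends.
  by apply: bigcup_finite => [|i _]; [exact: finite_finset|exact: finite_set2].
have [k [nZ nE uniqP]] := generic_point injang
  (fun k => Icirc (ang k) ltac:(have := ang_itv k; lra)) finZ finends injg.
pose ts := ang k; rewrite /= -/ts in nZ nE uniqP.
have tsAB : A < ts < B := (ang_itv k).1.
have [i [s0 s0i hs0]] : exists i, exists2 s, 0 <= s <= 1 & h i s = gamma (circ ts).
  have : G (gamma (circ ts)) by apply: gG; exists (circ ts) => //; apply: Icirc; lra.
  by rewrite GE => -[i _ [s]]; rewrite /= in_itv/= => s1 hs; exists i, s.
have s0i' : 0 < s0 < 1.
  have s00 : s0 != 0 by apply/eqP => s00; apply: nE; exists i => //; left; rewrite -hs0 s00.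
  have s01 : s0 != 1 by apply/eqP => s01; apply: nE; exists i => //; right; rewrite -hs0 s01.
  by rewrite !lt_neqAle s01 eq_sym s00.
have cont_arc j : {within `[0, 1], continuous (h j)}.
  have [hlip _ _] := harc j; exact: lipschitz_within_continuous hlip.
pose G' := \bigcup_(j in [set j | j != i]) (h j @` `[0, 1]).
have clG' : closed G'.
  apply: closed_bigcup => [|j _]; first exact: finite_finset.
  apply: compact_closed; first exact: norm_hausdorff.
  by apply: continuous_compact => //; exact: segment_compact.
have [hilip injhi _] := harc i.
have hG' s : 0 <= s <= 1 -> G' (h i s) -> s = 0 \/ s = 1.
  move=> s1 [j /= ji [t t1 tE]]; rewrite eq_sym in ji.
  by have [|//] := hij i j s t ji _ t1 (esym tE); rewrite in_itv.
have GE' : G = h i @` `[0, 1] `|` G'.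
  rewrite GE; apply/seteqP; split => [p [j _ pj]|p].
    by have [<-|ji] := eqVneq j i; [left|right; exists j].
  by case=> [pi|[j _ pj]]; [exists i|exists j].
have [proj [cproj proj1 projP projinj]] := arc_projection (cont_arc i) injhi clG' hG' s0i'.
rewrite -GE' hs0 in cproj projP projinj.
pose pr x := proj (gamma (circ x)).
have Gcirc x : m <= x <= M -> G (gamma (circ x)).
  by move=> xm; apply: gG; exists (circ x) => //; exact: Icirc.
have cpr : {within `[m, M], continuous pr}.
  have cpg : {within I, continuous (proj \o gamma)}.
    apply/subspace_continuousP => z Iz U.
    have Gz : G (gamma z) by apply: gG; exists z.
    move/subspace_continuousP : cproj => /(_ _ Gz)/[apply]; rewrite /nbhs/= /fmap/= => HU.
    move/subspace_continuousP : cg => /(_ _ Iz) HV; have := HV _ HU.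
    rewrite /= /within /nbhs /=; apply: filterS => y /=  H Iy.
    by apply: H => //; apply: gG; exists y.
  exact: within_circ_comp cpg Icirc.
have pr0 x : pr x <> 0.
  by move=> p0; have := proj1 (gamma (circ x)); rewrite -/(pr x) p0 /= expr0n addr0 => /esym/eqP; rewrite oner_eq0.
have mM : m <= M by clear -mA AB BM; lra.
have [Th [cTh aTh]] := angle_lift_path mM cpr (fun x _ => pr0 x).
have prE x : m <= x <= M -> pr x = circ (Th x).
  move=> xm; have [r r0 E] := aTh x xm; suff -> : circ (Th x) = (r * cos (Th x), r * sin (Th x)) by [].
  have : r ^+ 2 = 1.
    have := proj1 (gamma (circ x)); rewrite -/(pr x) E /= !exprMn -mulrDr.
    by rewrite cos2Dsin2 mulr1.
  move=> /eqP; rewrite sqrf_eq1 => /orP[/eqP ->|/eqP r1]; first by rewrite !mul1r.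
  by move: r0; rewrite r1 oppr_gt0 ltr10.
(* [Th] composed with [th] is an argument of [proj] along the loop. The comparison of homologous
   cycles is applied with an empty family of loops, so the total turning is an empty sum. *)
have turn0 : Th (th b) - Th (th a) = 0.
  have := @homologous_turning R G proj cproj _ 0
    (fun s => gamma (cos (th (a + s * (b - a))), sin (th (a + s * (b - a))))) (fun=> fun=> 0) (fun=> 0)
    (Th (th b) - Th (th a)) (fun=> 0).
  rewrite big_ord0 subr0 big_ord0; apply=> //.
  - move=> p Gp p0; have := proj1 p; rewrite p0 /= expr0n addr0 => /esym/eqP.
    by rewrite oner_eq0.
  - exists (fun s => Th (th (a + s * (b - a)))); split.
    + have cThc : continuous (Th \o clip m M).
        by apply: (within_comp cTh (@clip_continuous _ m M)) => x; rewrite /= in_itv; exact: clip_itv.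
      have cthc : continuous (th \o clip a b).
        by apply: (within_comp cth (@clip_continuous _ a b)) => x; rewrite /= in_itv; exact: clip_itv.
      have caff : continuous (fun s : R => a + s * (b - a)).
        by move=> s; apply: cvgD; [exact: cvg_cst|apply: cvgMl; exact: cvg_id].
      apply: (@subspace_eq_continuous _ _ _ ((Th \o clip m M) \o ((th \o clip a b) \o (fun s => a + s * (b - a))))).
        move=> s /set_mem; rewrite /= in_itv/= => s1.
        change (Th (clip m M (th (clip a b (a + s * (b - a))))) = Th (th (a + s * (b - a)))).
        have sab := segment_affine ab' s1.
        by rewrite [clip a b _]clip_id// clip_id//; exact: thm.
      apply: continuous_subspaceT => s.
      apply: continuous_comp; last exact: cThc.
      by apply: continuous_comp; [exact: caff|exact: cthc].
    + by move=> s s1; apply: aTh; apply: thm; exact: segment_affine.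
    + have -> : a + 1 * (b - a) = b by ring.
      by rewrite mul0r addr0.
  - by case.
have prper (j : int) x : pr (x + 2 * pi * j%:~R) = pr x by rewrite /pr circ_shift.
have tsm : m < ts < M by move: tsAB mA BM; clear; lra.
have prinj x y : m <= x <= M -> m <= y <= M -> 0 < (pr x).1 -> pr x = pr y ->
    gamma (circ x) = gamma (circ y).
  by move=> xm ym px pxy; apply: projinj => //; exact: Gcirc.
have visit x : m <= x <= M -> pr x = (1, 0) -> exists j : int, x = ts + 2 * pi * j%:~R.
  move=> xm prx; apply: circ_eq; apply: uniqP; first exact: Icirc.
  apply: prinj; rewrite ?prx ?projP//=; apply/andP; split; apply/ltW; by case/andP: tsm.
(* Off [Z] the trail separates points of the circle, and angles within 1 of ts are determined by
   their points on the circle. *)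
have [d d0 Hd] : exists2 d : R, 0 < d & forall x, `|ts - x| < d ->
    [/\ m <= x <= M, ~ Z (circ x) & `|ts - x| < 1].
  have N1 : \forall x \near ts, m <= x <= M.
    apply: filterS (near_in_itvoo (_ : ts \in `]m, M[)) => [x|]; rewrite in_itv//=.
    by case/andP=> /ltW -> /ltW ->.
  have N2 : \forall x \near ts, ~ Z (circ x).
    have clZ : closed Z.
      exact: closed_finite_plane.
    have : nbhs (circ ts) (~` Z) by apply: open_nbhs_nbhs; split=> //; exact: closed_openC.
    exact: circ_cvg.
  have N4 : \forall x \near ts, `|ts - x| < 1 by apply: nbhsx_ballx.
  have /nbhs_ballP[d /= d0 H] : \forall x \near ts, [/\ m <= x <= M, ~ Z (circ x) & `|ts - x| < 1].
    by move: N1 N2 N4; apply: filterS3.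
  by exists d.
have Am : m <= A < ts by rewrite mA/=; case/andP: tsAB.
have Bm : ts < B <= M by rewrite BM andbT; case/andP: tsAB.
apply: (@wrapping_lift_neq m M ts pr Th d tsm d0 cpr _ _ prper visit _ cTh prE A B Am Bm) => //.
- by move=> x; exact: proj1.
- move=> x y /Hd[xm nZx x1] /Hd[ym nZy y1] px pxy.
  have cxy : circ x = circ y.
    by apply: injg; rewrite ?inE; [split; [exact: Icirc|]..|exact: prinj].
  have [j jE] := circ_eq cxy.
  suff j0 : j = 0 by rewrite jE j0 mulr0 addr0.
  apply: (@multiple_2pi_small R j (x - y)); first by rewrite jE; ring.
  by have := @pi_ge2 R; move: x1 y1; rewrite !ltr_norml; clear; lra.
rewrite /A /B; move/eqP: turn0; rewrite subr_eq0 => /eqP.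
by case: ltP => _ ->.
Qed.

End TrailLift.

(** * The area formula and the theorem *)

Section AreaFormula.
Context {R : realType}.
Local Notation plane := (measurableTypeR R * measurableTypeR R)%type.
Local Notation mu2 := ((@lebesgue_measure R \x @lebesgue_measure R)%E).

Lemma restrict1_idem (c : R -> R * R) : restrict1 (restrict1 c) = restrict1 c.
Proof. by apply/funext => t; rewrite /restrict1 !patchE; case: ifP => // ->. Qed.

Lemma loop_cycle_cycle1 (G : set (R * R)) (c : R -> R * R) :
  {within `[0, 1], continuous c} -> c 0 = c 1 -> c @` `[0, 1] `<=` G ->
  cycle1 G (loop_cycle c).
Proof.
move=> cc c01 cG; split.
  move=> s; rewrite /loop_cycle domU1 inE => /eqP ->; split; last by rewrite restrict1_idem.
    apply: (@subspace_eq_continuous _ _ _ c) => // t t01.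
    by change (c t = restrict1 c t); rewrite /restrict1 patchE t01.
  move=> _ [t t01 <-]; apply: cG; exists t => //.
  by rewrite /restrict1 patchE mem_set.
rewrite /boundary1 liftU scale1r /restrict1 !patchE !mem_set/= ?in_itv/= ?lexx ?ler01//.
by rewrite c01 subrr.
Qed.

Lemma winds_once_wind (l : R -> R * R) z : winds_once l z -> wind (fun t => l t - z) (2 * pi).
Proof.
move=> [rho [th [_ cth H e]]]; exists th; split=> //; last by rewrite e; ring.
move=> t t01; have [|r0 lE] := H t; first by rewrite in_itv.
by exists (rho t) => //; rewrite lE; congr pair => /=; ring.
Qed.

Lemma winding_indicator (l : R -> R * R) (D : set (R * R)) z :
  simple_closed_lipschitz l -> bounded_domain_with_boundary D (l @` `[0, 1]) ->
  (forall p, D p -> winds_once l p) -> ~ (l @` `[0, 1]) z ->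
  wind (fun t => l t - z) (2 * pi * \1_D z).
Proof.
move=> [llip l01 linj] [[oD [z0 Dz0]] _ _ _ bD] once nJ.
have cl := lipschitz_within_continuous llip.
rewrite indicE; have [/set_mem Dz|/negP nDz] := boolP (z \in D).
  by rewrite mulr1; exact: winds_once_wind (once _ Dz).
rewrite mulr0; have [w ww] : exists w, wind (fun t => l t - z) w.
  apply: wind_ex.
    apply/subspace_continuousP => x x01; apply: cvgB; last exact: cvg_cst.
    by move/subspace_continuousP : cl; exact.
  by move=> t t01 /eqP; rewrite subr_eq0 => /eqP lz; apply: nJ; exists t; rewrite //= in_itv.
have w0 := winds_once_wind (once _ Dz0).
rewrite -(winding_outside cl l01 linj oD bD Dz0 w0 _ nJ ww)//.
by move=> Dz; apply: nDz; rewrite inE.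
Qed.

Lemma triangulable_negligible (G : set (R * R)) : lipschitz_triangulable G ->
  {ae mu2, forall z, ~ G z}.
Proof.
move=> [n [h [harc -> _ _]]].
have FF := ae_filter_ringOfSetsType mu2.
have H : {ae mu2, forall z, forall i, ~ (h i @` `[0, 1]) z}.
  apply: filter_forall => i; have [hlip _ _] := harc i.
  have [N [mN N0 HN]] := lipschitz_image_negligible hlip.
  by exists N; split=> // z /= /contrapT; exact: HN.
by move: H; apply: filterS => z H [i _]; exact: H.
Qed.

Lemma area_formula (a b K : R) (f1 f2 : R -> R) (G : set (R * R)) (m : nat)
    (l : 'I_m -> R -> R * R) (D : 'I_m -> set (R * R)) (k : 'I_m -> int)
    (c := fun s => (f1 (a + s * (b - a)), f2 (a + s * (b - a)))) :
  a < b -> 0 <= K -> lip a b K f1 -> lip a b K f2 -> f1 a = f1 b -> f2 a = f2 b ->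
  compact G -> lipschitz_triangulable G -> c @` `[0, 1] `<=` G ->
  (forall i, simple_closed_lipschitz (l i) /\ l i @` `[0, 1] `<=` G) ->
  (forall i, bounded_domain_with_boundary (D i) (l i @` `[0, 1]) /\
     (forall z, D i z -> winds_once (l i) z)) ->
  null_homologous G (loop_cycle c - \sum_i loop_cycle (l i) *~ k i) ->
  \int[lebesgue_measure]_(t in `[a, b]) (f1 t * derive1 f2 t) = \sum_i (k i)%:~R * area (D i).
Proof.
move=> ab K0 fK1 fK2 f1ab f2ab cG tG cG' Hl HD Hk; have ab' := ltW ab.
have FF := ae_filter_ringOfSetsType mu2.
have hab s : 0 <= s <= 1 -> a <= a + s * (b - a) <= b by exact: segment_affine.
have e1 : a + 1 * (b - a) = b by ring.
have c01 : c 0 = c 1 by rewrite /c e1 mul0r addr0 f1ab f2ab.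
(* One box contains [G] and all the domains, so integrals over it see their full areas. *)
have [B [B0 GB DB]] : exists B : R, [/\ 0 <= B, forall p, G p -> `|p| <= B &
    forall i p, D i p -> `|p| <= B].
  have HG : \forall B \near +oo, forall p, G p -> `|p| <= B by exact: compact_bounded cG.
  have HDB : \forall B \near +oo, forall i p, D i p -> `|p| <= B.
    by apply: filter_forall => i; have [[_ _ bD _ _] _] := HD i.
  have H0 : \forall B \near +oo, (0 : R) <= B by exact: nbhs_pinfty_ge.
  have H : \forall B \near +oo, [/\ 0 <= B, forall p, G p -> `|p| <= B &
      forall i p, D i p -> `|p| <= B] by move: H0 HG HDB; apply: filterS3.
  exact: filter_ex H.
have inbox p : `|p| <= B -> - B <= p.1 <= B /\ - B <= p.2 <= B.
  by rewrite prod_normE ge_max !ler_norml => /andP[].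
have cB t : 0 <= t <= 1 -> - B <= (c t).1 <= B /\ - B <= (c t).2 <= B.
  by move=> t01; apply/inbox/GB/cG'; exists t; rewrite //= in_itv.
have ba0 : 0 <= b - a by rewrite subr_ge0.
have caff (f : R -> R) : lip a b K f -> lip 0 1 (K * (b - a)) (fun s => f (a + s * (b - a))).
  move=> fK s t s1 t1; apply: (le_trans (fK _ _ (hab _ s1) (hab _ t1))).
  have -> : a + s * (b - a) - (a + t * (b - a)) = (s - t) * (b - a) by ring.
  by rewrite -mulrA ler_wpM2l// normrM (ger0_norm ba0) mulrC.
have KB0 : 0 <= K * (b - a) by exact: mulr_ge0.
have cc : {within `[0, 1], continuous c}.
  have H f : lip a b K f -> {within `[0, 1], continuous (fun s => f (a + s * (b - a)))}.
    by move=> fK; apply: lipschitz_within_continuous; exact: lip_lipschitz (caff f fK).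
  apply/subspace_continuousP => x x01; apply: pair_cvg.
    by have /subspace_continuousP := H _ fK1; exact.
  by have /subspace_continuousP := H _ fK2; exact.
pose W z : R := \sum_(i <- index_enum 'I_m) (k i)%:~R * \1_(D i) z.
have mD i : measurable (D i : set plane).
  by have [[[oD _] _ _ _ _] _] := HD i; exact: open_measurable_plane.
have mbox := @measurable_box R B; have finbox := box_lty B0.
have iW i : mu2.-integrable (box B) (EFin \o (fun z => (k i)%:~R * \1_(D i) z)).
  exact: integrable_indic_on.
have mW : measurable_fun (box B : set plane) (W : plane -> R).
  by apply/measurable_EFinP; apply: measurable_int (integrable_Rsum mbox _ iW).
have intW : \int[mu2]_(z in box B) W z = \sum_i (k i)%:~R * area (D i).
  rewrite (Rintegral_sum mbox _ iW); apply: eq_bigr => i _.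
  rewrite (Rintegral_indic_on mbox finbox _ (mD i)) /area setIidl//.
  by move=> p /DB/inbox; rewrite /box /= !in_itv.
have aeW : {ae mu2, forall z, box B z -> dyadic_crossings c n z @[n --> \oo] --> W z}.
  move: (triangulable_negligible tG); apply: filterS => z nGz _.
  have nz p : G p -> p - z <> 0 by move=> Gp /eqP; rewrite subr_eq0 => /eqP pz; apply: nGz; rewrite -pz.
  have cproj : {within G, continuous (fun p : R * R => p - z)}.
    by apply: continuous_subspaceT => p; apply: cvgB; [exact: cvg_id|exact: cvg_cst].
  have [w ww] : exists w, wind ((fun p : R * R => p - z) \o c) w.
    apply: wind_ex.
      apply/subspace_continuousP => x x01; apply: cvgB; last exact: cvg_cst.
      by move/subspace_continuousP : cc; exact.
    by move=> t t01; apply/nz/cG'; exists t; rewrite //= in_itv.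
  have wl i : wind ((fun p : R * R => p - z) \o l i) (2 * pi * \1_(D i) z).
    have [Hli lG] := Hl i; have [bD once] := HD i.
    by apply: winding_indicator => // /lG.
  (* For z off [G], translation by -z maps [G] to the punctured plane, so the homology relation
     turns into a relation between winding numbers about z. *)
  have wE := homologous_turning cproj nz ww wl Hk.
  pose N : int := \sum_i (z \in D i)%:R * k i.
  have NW : N%:~R = W z.
    rewrite /N rmorph_sum/=; apply: eq_bigr => i _.
    by rewrite indicE intrM mulrC; case: (z \in D i).
  have wN : w = 2 * pi * N%:~R.
    rewrite wE NW /W mulr_sumr; apply: eq_bigr => i _.
    by rewrite -mulrzr; ring.
  rewrite wN in ww; have [n0 Hn0] := dyadic_crossings_wind c01 ww.
  apply: cvg_near_cst; exists n0 => // n /= n0n; rewrite -NW; exact: Hn0.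
have := green B0 KB0 c01 cB (caff _ fK2) mW aeW; rewrite intW.
have := riemann_sums_area ab K0 fK1 fK2.
apply: cvg_unique; exact: norm_hausdorff.
Qed.

End AreaFormula.

Section Trail.
Context {R : realType}.

Lemma circle_lift (a b : R) (g : R -> R * R) : a <= b -> {within `[a, b], continuous g} ->
  (forall t, a <= t <= b -> (g t).1 ^+ 2 + (g t).2 ^+ 2 = 1) ->
  exists2 th : R -> R, {within `[a, b], continuous th} &
    forall t, a <= t <= b -> g t = (cos (th t), sin (th t)).
Proof.
move=> ab cg g1.
have [t tab g0|th [cth ath]] := angle_lift_path ab cg.
  by have := g1 t tab; rewrite g0 /= expr0n addr0 => /esym/eqP; rewrite oner_eq0.
exists th => // t tab; have := g1 t tab; have [r r0 ->] := ath t tab.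
rewrite /= !exprMn -mulrDr cos2Dsin2 mulr1 => /eqP.
rewrite sqrf_eq1 => /orP[/eqP ->|/eqP r1]; first by rewrite !mul1r.
by move: r0; rewrite r1 oppr_gt0 ltr10.
Qed.

End Trail.

Theorem theorem4p4 (R : realType) (a b : R) (f1 f2 : R -> R)
  (hab : a < b)
  (hf1 : [lipschitz f1 t | t in `[a, b]]) (hf2 : [lipschitz f2 t | t in `[a, b]])
  (nc1 : nonconstant a b f1) (nc2 : nonconstant a b f2) :
  let F : R -> R * R := fun t => (f1 t, f2 t) in
  F a = 0 -> F b = 0 ->
  lipschitz_triangulable (F @` `[a, b]) ->
  class_A a b F ->
  (abel_center a b f1 f2 <->
     \int[lebesgue_measure]_(t in `[a, b]) (f1 t * derive1 f2 t) = 0) /\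
  (abel_center a b f1 f2 -> universal_center a b f1 f2).
Proof.
move=> F [f1a f2a] [f1b f2b] _ [G [cG tG P2F [m [l [D [_ Hl Hgen HD Qind]]]]]].
have [K1 K10 fK1] := lipschitz_lip hf1; have [K2 K20 fK2] := lipschitz_lip hf2.
pose K := K1 + K2; have K0 : 0 <= K by exact: addr_ge0.
have {}fK1 : lip a b K f1 by apply: lipW fK1; rewrite lerDl.
have {}fK2 : lip a b K f2 by apply: lipW fK2; rewrite lerDr.
have hab' := ltW hab.
(* Universality of a center is reached through the integral: a center makes it vanish, and its
   vanishing yields the center and its universality together. *)
suff main : \int[lebesgue_measure]_(t in `[a, b]) (f1 t * derive1 f2 t) = 0 ->
    abel_center a b f1 f2 /\ universal_center a b f1 f2.
  have area0 : abel_center a b f1 f2 ->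
      \int[lebesgue_measure]_(t in `[a, b]) (f1 t * derive1 f2 t) = 0.
    exact: (abel_center_area hab K0 fK1 fK2 f1a f2a f1b f2b).
  by split; [split=> [|/main[]]|move=> /area0/main[]].
move=> area0.
have [Flip _ FG [X [I [gamma [XG _ euler [g [cg gI FE]]]]]]] := P2F.
have [[al [be [_ IE]]] [cgamma gammaX] [Z finZ injgamma] _ _] := euler.
have gabI t : a <= t <= b -> I (g t).
  by move=> tab; apply: gI; exists t; rewrite //= in_itv.
have [th cth gth] : exists2 th : R -> R, {within `[a, b], continuous th} &
    forall t, a <= t <= b -> g t = (cos (th t), sin (th t)).
  apply: circle_lift => // t /gabI; rewrite IE => -[x _ <-] /=; exact: cos2Dsin2.
have Fth t : a <= t <= b -> F t = gamma (cos (th t), sin (th t)).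
  by move=> tab; rewrite -gth// FE// in_itv.
pose c s : R * R := (f1 (a + s * (b - a)), f2 (a + s * (b - a))).
have aff s : 0 <= s <= 1 -> a <= a + s * (b - a) <= b by exact: segment_affine.
have cGs : c @` `[0, 1] `<=` G.
  move=> _ [s + <-]; rewrite /= in_itv/= => s1; apply: FG.
  by exists (a + s * (b - a)) => //; rewrite /= in_itv/=; exact: aff.
have e1 : a + 1 * (b - a) = b by ring.
have c01 : c 0 = c 1 by rewrite /c e1 mul0r addr0 f1a f2a f1b f2b.
have cc : {within `[0, 1], continuous c}.
  have cF : {within `[a, b], continuous F} by exact: lipschitz_within_continuous.
  have cFc : continuous (F \o clip a b).
    by apply: (within_comp cF (@clip_continuous _ a b)) => x; rewrite /= in_itv; exact: clip_itv.
  apply: (@subspace_eq_continuous _ _ _ ((F \o clip a b) \o (fun s => a + s * (b - a)))).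
    move=> s /set_mem; rewrite /= in_itv/= => s1.
    by change (F (clip a b (a + s * (b - a))) = c s); rewrite clip_id ?aff.
  apply: continuous_subspaceT => s; apply: continuous_comp; last exact: cFc.
  by apply: cvgD; [exact: cvg_cst|apply: cvgMl; exact: cvg_id].
have [k Hk] := Hgen _ (loop_cycle_cycle1 cc c01 cGs).
have f1ab : f1 a = f1 b by rewrite f1a f1b.
have f2ab : f2 a = f2 b by rewrite f2a f2b.
have AF := area_formula hab K0 fK1 fK2 f1ab f2ab cG tG cGs Hl HD Hk.
have k0 i : k i = 0.
  have := Qind (fun i => (k i)%:~R); rewrite (eq_bigr (fun i => (k i)%:~R * area (D i))).
    by rewrite -AF area0 => /(_ erefl i)/eqP; rewrite intr_eq0 => /eqP.
  by move=> j _; rewrite ratr_int.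
have {}Hk : null_homologous G (loop_cycle c).
  move: Hk; rewrite big1 ?subr0// => i _; by rewrite k0 mulr0z.
have aab : a <= a <= b by rewrite lexx.
have bab : a <= b <= b by rewrite hab' lexx.
have thab : th a = th b.
  apply: (@lift_endpoints R a b G I Z gamma th hab tG cgamma _ finZ injgamma cth).
  - by rewrite gammaX.
  - by move=> t tab; rewrite -gth//; exact: gabI.
  - by rewrite -!Fth// /F f1ab f2ab.
  suff <- : loop_cycle c = loop_cycle (fun s =>
      gamma (cos (th (a + s * (b - a))), sin (th (a + s * (b - a))))) by [].
  rewrite /loop_cycle; congr (<< _ >>); apply/funext => s; rewrite /restrict1 !patchE.
  case: ifPn => // /set_mem; rewrite /= in_itv/= => s1.
  by rewrite -Fth//; exact: aff.
(* [F] depends on t through [th t] only, and [th] is now a closed path on the line. *)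
apply: (factor_through_interval hab K0 cth fK1 fK2 _ thab) => s t sab tab st.
have : F s = F t by rewrite !Fth// st.
by move=> [].
Qed.
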